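(* There exist $\alpha>0$ and $n_\alpha$ such that for every $n\ge n_\alpha$ the following holds. Let $F$ be a forest on $n$ vertices with $\Delta(F)\le \alpha \sqrt n$ such that every component is non-trivial and is either rooted or double-rooted. Suppose that $d\geq 0$ of the components are double-rooted and that in every double-rooted component its two roots are at distance at least 7. Then for any injective assignment of the roots of $F$ to vertices of $K_n$ fixed at the beginning, Waiter, playing the Waiter-Client game on $K_n$, can force a red copy $\bar F$ of $F$ within at most $e(F)+d+1$ rounds in which every root is mapped to its assigned vertex.
   Context: Waiter-Client game on $K_n$: in each round Waiter offers two free edges, Client colors one red and the other becomes blue. ''Force a red copy within $N$ rounds'' means Waiter has a strategy guaranteeing that after at most $N$ rounds the red graph contains a copy of $F$. A component of a forest with designated roots is rooted if it contains exactly one root and double-rooted if it contains exactly two roots. Non-trivial means having at least one edge. *)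

(* Defs.v *)
From Stdlib Require Export Reals.
From mathcomp Require Export all_boot.

Set Implicit Arguments.
Unset Strict Implicit.
Unset Printing Implicit Defensive.

Section Defs.
Variable n : nat.

Definition Kn_edge (e : {set 'I_n}) : bool := #|e| == 2.

Definition simple_graph (E : rel 'I_n) : Prop := symmetric E /\ irreflexive E.

Definition is_forest (E : rel 'I_n) : Prop :=
  ~ (exists c : seq 'I_n, 3 <= size c /\ ucycle E c).

Definition edges_of (E : rel 'I_n) : {set {set 'I_n}} :=
  [set e : {set 'I_n} | [exists u : 'I_n, exists v : 'I_n, E u v && (e == [set u; v])]].

Definition n_edges (E : rel 'I_n) : nat := #|edges_of E|.

Definition degree (E : rel 'I_n) (v : 'I_n) : nat := #|[set u | E v u]|.

Definition component (E : rel 'I_n) (v : 'I_n) : {set 'I_n} :=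
  [set u | connect E v u].

Definition components (E : rel 'I_n) : {set {set 'I_n}} :=
  [set component E v | v : 'I_n].

Definition nontrivial_comp (E : rel 'I_n) (C : {set 'I_n}) : Prop :=
  exists u v, u \in C /\ v \in C /\ E u v.

Definition rooted_comp (Rt : {set 'I_n}) (C : {set 'I_n}) : bool :=
  #|C :&: Rt| == 1.
Definition double_rooted_comp (Rt : {set 'I_n}) (C : {set 'I_n}) : bool :=
  #|C :&: Rt| == 2.

Definition n_double_rooted (E : rel 'I_n) (Rt : {set 'I_n}) : nat :=
  #|[set C in components E | double_rooted_comp Rt C]|.

Definition dist_ge (E : rel 'I_n) (x y : 'I_n) (k : nat) : Prop :=
  forall p : seq 'I_n, path E x p -> last x p = y -> k <= size p.

Definition red_rooted_copy (E : rel 'I_n) (Rt : {set 'I_n}) (phi : 'I_n -> 'I_n)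
  (red : {set {set 'I_n}}) : Prop :=
  exists f : 'I_n -> 'I_n,
    injective f /\
    (forall u v, E u v -> [set f u; f v] \in red) /\
    (forall r, r \in Rt -> f r = phi r).

(* Waiter-Client game on K_n.  A position is the pair (red, blue) of already
   coloured edges.  [waiter_forces goal k red blue] holds iff Waiter has a
   strategy guaranteeing that [goal] holds for the red graph after at most k
   further rounds: either the goal already holds, or Waiter can offer two
   distinct free edges e1, e2 such that, whichever one Client colours red
   (the other becoming blue), Waiter can still force the goal within k-1
   further rounds. *)
Definition free_edge (red blue : {set {set 'I_n}}) (e : {set 'I_n}) : bool :=
  [&& Kn_edge e, e \notin red & e \notin blue].

Fixpoint waiter_forces (goal : {set {set 'I_n}} -> Prop) (k : nat)
  (red blue : {set {set 'I_n}}) : Prop :=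
  goal red \/
  match k with
  | 0 => False
  | k'.+1 =>
      exists e1 e2 : {set 'I_n},
        [&& free_edge red blue e1, free_edge red blue e2 & e1 != e2] /\
        waiter_forces goal k' (e1 |: red) (e2 |: blue) /\
        waiter_forces goal k' (e2 |: red) (e1 |: blue)
  end.

End Defs.

(* Main.v *)
(* Orient every component towards one of its roots and embed each vertex after its parent:
   offering two edges from the image of the parent to unused vertices of K_n wastes no round.
   The two unused vertices are always chosen of equal degree in the coloured graph, which
   keeps all degrees at unused vertices below log_2 n + 1.  A double-rooted component costs
   one extra round: the path down to its second root r is embedded up to the last edge, a
   Posa rotation yields a second candidate for its final vertex, and r is offered both.
   When K_n is nearly used up, only one more round may be wasted.  Since the maximum degree
   is at most sqrt n / 7, counting branchings shows that the forest has many vertices with a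
   leaf child (finish with these leaves, whose images can be exchanged), or many components
   that are bare paths between two roots, or a long bare path; in the last two cases a path
   kept for the end is embedded flexibly and closed by a final rotation. *)
Require Import Defs.
From Stdlib Require Import Reals Lra.
From mathcomp Require Import all_boot zify.

Set Implicit Arguments.
Unset Strict Implicit.
Unset Printing Implicit Defensive.

(* Cardinals are abstracted beforehand: [lia] compares its atoms up to conversion. *)
Ltac gcard :=
  cbv delta [reverse_coercion] beta;
  repeat match goal with
  | |- context [Finite.sort (fintype_ordinal__canonical__fintype_Finite ?m)] =>
      change (Finite.sort (fintype_ordinal__canonical__fintype_Finite m)) with 'I_m
  | |- context [Equality.sort (fintype_ordinal__canonical__eqtype_Equality ?m)] =>
      change (Equality.sort (fintype_ordinal__canonical__eqtype_Equality m)) with 'I_m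
  end;
  change (nat_of_bool true) with 1; change (nat_of_bool false) with 0;
  repeat match goal with
  | |- context [@card ?U ?A] =>
      let k := fresh "k" in generalize (@card U A); intro k
  | |- context [@size ?U ?s] =>
      let k := fresh "k" in generalize (@size U s); intro k
  | |- context [nat_of_bool ?b] =>
      let k := fresh "k" in generalize (nat_of_bool b); intro k
  end.
Ltac arith := clear; gcard; lia.

Lemma pick2 (I : finType) (X : {set I}) : 2 <= #|X| ->
  exists y y', [/\ y \in X, y' \in X & y != y'].
Proof. by case/card_gt1P=> y [y' [yX y'X yy']]; exists y, y'. Qed.

Lemma uniq_flatten (I J : eqType) (F : I -> seq J) s :
  uniq s -> {in s, forall x, uniq (F x)} ->
  (forall x y z, x \in s -> y \in s -> z \in F x -> z \in F y -> x = y) ->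
  uniq (flatten (map F s)).
Proof.
elim: s => //= x s IH /andP[xs us] uF dF.
have sx z : z \in s -> z \in x :: s by rewrite in_cons orbC => ->.
rewrite cat_uniq uF ?mem_head // IH // => [|y /sx/uF//|y y' z /sx ys /sx]; last exact: dF.
rewrite andbT; apply/hasPn=> z /flattenP[_ /mapP[y ys ->] zy] /=.
by apply: contra xs => zx; rewrite (dF x y z) ?mem_head ?sx.
Qed.

(** * Strategies *)

Section Game.
Variable n : nat.
Notation T := 'I_n.
Implicit Types (x y z : T) (e : {set T}) (r b c : {set {set T}}).

Definition ed x y : {set T} := [set x; y].

Lemma edC x y : ed x y = ed y x.
Proof. exact: setUC. Qed.

Lemma in_ed x y z : (x \in ed y z) = (x == y) || (x == z).
Proof. by rewrite !inE. Qed.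

Lemma edl x y : x \in ed x y.
Proof. by rewrite in_ed eqxx. Qed.

Lemma edr x y : y \in ed x y.
Proof. by rewrite in_ed eqxx orbT. Qed.

Lemma ed_inj x : injective (ed x).
Proof.
move=> y z h; have : z \in ed x y by rewrite h edr.
have : y \in ed x z by rewrite -h edr.
by rewrite !in_ed => /orP[/eqP->|/eqP//] /orP[] /eqP.
Qed.

Lemma Kn_ed x y : Kn_edge (ed x y) = (x != y).
Proof. by rewrite /Kn_edge /ed cards2; case: (x != y). Qed.

(* [c] is the set of coloured edges.  Exactly [k] rounds are played, so that strategies
   can be chained by taking as [G] the statement that the next phase succeeds. *)
Fixpoint wf (G : {set {set T}} -> {set {set T}} -> Prop) k r c : Prop :=
  match k with
  | 0 => G r c
  | k'.+1 => exists e1 e2 : {set T},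
      [/\ Kn_edge e1, Kn_edge e2, e1 \notin c, e2 \notin c & e1 != e2] /\
      wf G k' (e1 |: r) ([set e1; e2] :|: c) /\
      wf G k' (e2 |: r) ([set e1; e2] :|: c)
  end.

Arguments wf : simpl never.

Lemma wf_forces goal k r b :
  wf (fun r' _ => goal r') k r (r :|: b) -> waiter_forces goal k r b.
Proof.
elim: k r b => [|k IH] r b; first by left.
case=> e1 [e2 [[k1 k2 n1 n2 ne] [w1 w2]]]; right; exists e1, e2; split; last split.
- rewrite /free_edge k1 k2 ne /=; move: n1 n2.
  by rewrite !inE !negb_or => /andP[-> ->] /andP[-> ->].
- apply: IH; congr (wf _ _ _ _): w1; apply/setP=> e; rewrite !inE.
  by case: (e == e1); case: (e == e2); case: (e \in r); case: (e \in b).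
- apply: IH; congr (wf _ _ _ _): w2; apply/setP=> e; rewrite !inE.
  by case: (e == e1); case: (e == e2); case: (e \in r); case: (e \in b).
Qed.

Lemma forces_mono goal j k r b :
  j <= k -> @waiter_forces n goal j r b -> waiter_forces goal k r b.
Proof.
elim: j k r b => [|j IH] [|k] r b //=.
- by move=> _ [h|//]; left.
- move=> jk [h|[e1 [e2 [h [w1 w2]]]]]; first by left.
  by right; exists e1, e2; split=> //; split; apply: IH.
Qed.

Lemma wf_offer G k r c (e1 e2 : {set T}) :
  Kn_edge e1 -> Kn_edge e2 -> e1 \notin c -> e2 \notin c -> e1 != e2 ->
  wf G k (e1 |: r) ([set e1; e2] :|: c) ->
  wf G k (e2 |: r) ([set e1; e2] :|: c) -> wf G k.+1 r c.
Proof. by move=> k1 k2 n1 n2 ne w1 w2; exists e1, e2. Qed.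

End Game.

(** * Partial embeddings *)

Section Position.
Variables (n : nat) (R : {set 'I_n}) (par phi : 'I_n -> 'I_n) (K l : nat).
Notation T := 'I_n.
Implicit Types (S W : {set T}) (f : T -> T) (r c : {set {set T}}).
Implicit Types (Y : seq (T * T)).

(* [S] is the set of vertices embedded so far by [f]; [bad] collects the unused vertices of
   [K_n] that can no longer be offered at [f u]. *)
Definition bad S f c u := [set y | (y \notin f @: S) && (ed (f u) y \in c)].
Definition kids S u := [set v in S | (v \notin R) && (par v == u)].
Definition dg c (a : T) := #|[set e in c | a \in e]|.

(* [Y] lists the edges of the forest that are already red but are not of the form
   (v, par v): the last edges of the paths between two roots. *)
Record valid S f r c Y : Prop := Valid {
  v_R : R \subset S;
  v_inj : {in S &, injective f};
  v_phi : {in R, f =1 phi};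
  v_par : forall v, v \in S -> v \notin R ->
    par v \in S /\ ed (f v) (f (par v)) \in r;
  v_Y : forall p, p \in Y ->
    [/\ p.1 \in S, p.2 \in S & ed (f p.1) (f p.2) \in r];
  v_rc : r \subset c;
  v_A : forall x y, x \notin f @: S -> y \notin f @: S -> ed x y \notin c }.

(* A round offering two unused vertices of equal degree removes one of them and doubles the
   term of the other, so the sum in [i_pot] does not grow; it bounds by log2 n the number
   of coloured edges at an unused vertex. *)
Record good S f r c Y : Prop := Inv {
  i_valid :> valid S f r c Y;
  i_bad : forall u, u \in S -> #|bad S f c u| <= #|kids S u| + (u \notin R);
  i_pot : K <= #|~: S| -> \sum_(a | a \notin f @: S) 2 ^ dg c a <= n }.

Definition upd f v y : T -> T := fun x => if x == v then y else f x.

Lemma updE f v y x : x != v -> upd f v y x = f x.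
Proof. by rewrite /upd => /negbTE->. Qed.

Lemma upd_same f v y : upd f v y v = y.
Proof. by rewrite /upd eqxx. Qed.

Lemma upd_in f v y S : v \notin S -> {in S, upd f v y =1 f}.
Proof. by move=> vS x xS; apply: updE; apply: contraNneq vS => <-. Qed.

Lemma img_upd f v y S : v \notin S -> upd f v y @: (v |: S) = y |: f @: S.
Proof.
move=> vS; rewrite imsetU1 upd_same; congr (_ |: _).
by apply: eq_in_imset; apply: upd_in.
Qed.

Lemma card_free S f r c Y : valid S f r c Y -> #|~: (f @: S)| = #|~: S|.
Proof.
move=> V; apply/eqP; rewrite -(eqn_add2l #|f @: S|) cardsC.
by rewrite (card_in_imset (v_inj V)) cardsC.
Qed.

Lemma dg_off c (e1 e2 : {set T}) a : a \notin e1 -> a \notin e2 ->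
  dg ([set e1; e2] :|: c) a = dg c a.
Proof.
move=> a1 a2; apply: eq_card => e; rewrite !inE.
case: eqP => [->|_] /=; first by rewrite (negbTE a1) andbF.
by case: eqP => [->|_] //=; rewrite (negbTE a2) andbF.
Qed.

Lemma dg_loser c (e1 e2 : {set T}) a : a \notin e1 -> a \in e2 -> e2 \notin c ->
  dg ([set e1; e2] :|: c) a = (dg c a).+1.
Proof.
move=> a1 a2 e2c; rewrite /dg.
have -> : [set e in [set e1; e2] :|: c | a \in e] = e2 |: [set e in c | a \in e].
  apply/setP=> e; rewrite !inE.
  case: (eqVneq e e2) => [->|_]; first by rewrite a2 orbT.
  by rewrite orbF; case: eqP => [->|_] //=; rewrite (negbTE a1) !andbF.
by rewrite cardsU1 inE (negbTE e2c).
Qed.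

(* Between the two positions no edge at the image of [W] was coloured. *)
Definition ext W S f c S' f' c' :=
  [/\ f @: S \subset f' @: S', c \subset c', {in W, f' =1 f} &
    forall x (e : {set T}), x \in W -> e \in c' -> f x \in e -> e \in c].

Lemma ext_trans W S f c S1 f1 c1 S2 f2 c2 :
  ext W S f c S1 f1 c1 -> ext W S1 f1 c1 S2 f2 c2 -> ext W S f c S2 f2 c2.
Proof.
case=> i1 s1 e1 n1 [i2 s2 e2 n2]; split.
- exact: subset_trans i1 i2.
- exact: subset_trans s1 s2.
- by move=> x xW; rewrite e2 // e1.
- by move=> x e xW ec h; apply: (n1 x) => //; apply: (n2 x) => //; rewrite e1.
Qed.

Lemma ext_sub W' W S f c S1 f1 c1 :
  W' \subset W -> ext W S f c S1 f1 c1 -> ext W' S f c S1 f1 c1.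
Proof.
move=> /subsetP sW [i s e n1]; split=> // [x /sW /e //|x a /sW xW].
exact: n1.
Qed.

Lemma bad_ext W S f c S' f' c' x :
  ext W S f c S' f' c' -> x \in W -> bad S' f' c' x \subset bad S f c x.
Proof.
case=> i s e n1 xW; apply/subsetP=> a; rewrite !inE => /andP[a' h].
rewrite (contraNN (subsetP i a) a') /=; apply: (n1 x) => //; rewrite -e //.
exact: edl.
Qed.

Section Step.
Variables (S : {set T}) (f : T -> T) (r c : {set {set T}}) (Y : seq (T * T)).
Variables (v y y' : T).
Hypotheses (V : valid S f r c Y) (vS : v \notin S) (uS : par v \in S).
Hypotheses (yS : y \notin f @: S) (y'S : y' \notin f @: S) (yy' : y != y').
Let e := ed (f (par v)) y.
Let e' := ed (f (par v)) y'.
Let c' := [set e; e'] :|: c.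

Lemma bad_new : bad (v |: S) (upd f v y) c' v = set0.
Proof.
have fu : f (par v) \in f @: S by apply: imset_f.
apply/setP=> a; rewrite !inE upd_same img_upd // in_setU1 negb_or.
apply: contraTF isT => /andP[/andP[ay aS]].
rewrite (negbTE (v_A V _ _)) // orbF => /orP[] /eqP h.
  have : a \in e by rewrite -h edr.
  by rewrite in_ed (negbTE ay) orbF => /eqP ha; rewrite ha fu in aS.
have : y \in e' by rewrite -h edl.
rewrite in_ed (negbTE yy') orbF => /eqP hy.
by move: yS; rewrite hy fu.
Qed.

Lemma bad_par : bad (v |: S) (upd f v y) c' (par v) \subset
  y' |: bad S f c (par v).
Proof.
apply/subsetP=> a; rewrite !inE img_upd // (upd_in _ _ vS) // in_setU1 negb_or.
case/andP=> /andP[ay ->] /orP[/orP[]/eqP|->].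
- by move=> /ed_inj ha; rewrite ha eqxx in ay.
- by move=> /ed_inj ->; rewrite eqxx.
- by rewrite orbT.
Qed.

Lemma ext_step W : W \subset S -> par v \notin W ->
  ext W S f c (v |: S) (upd f v y) c'.
Proof.
move=> /subsetP WS uW; split.
- by rewrite img_upd // subsetUr.
- exact: subsetUr.
- by move=> x /WS; apply: upd_in.
move=> x a xW; have xS := WS x xW.
have xfu : f x != f (par v).
  by apply: contraNneq uW => /(v_inj V xS uS) <-.
rewrite !inE => /orP[/orP[]/eqP->|//]; rewrite in_ed (negbTE xfu) /= => /eqP hx.
  by move: yS; rewrite -hx imset_f.
by move: y'S; rewrite -hx imset_f.
Qed.

End Step.

(** Only the rejected [y'] can enter a bad set, and only that of [par v]; there the new kid [v] pays
    for it, so [i_bad] is preserved. *)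
Lemma step_inv S f r c Y v y y' :
  good S f r c Y -> v \notin S -> par v \in S -> y \notin f @: S ->
  y' \notin f @: S -> y != y' ->
  y \notin bad S f c (par v) -> y' \notin bad S f c (par v) ->
  (K <= #|~: S| -> dg c y = dg c y') ->
  let e := ed (f (par v)) y in let e' := ed (f (par v)) y' in
  good (v |: S) (upd f v y) (e |: r) ([set e; e'] :|: c) Y.
Proof.
move=> I vS uS yS y'S yy' yB y'B deg e e'; set u := par v in uS yB y'B e e' *.
have V := i_valid I; have fu : f u \in f @: S by apply: imset_f.
have uy' : f u != y' by apply: contraNneq y'S => <-.
have vR : v \notin R by apply: contra vS; apply/subsetP/(v_R V).
have imE := img_upd f y vS; have inS := upd_in f y vS.
have e'c : e' \notin c by move: y'B; rewrite inE y'S.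
split; first split.
- by apply: subset_trans (v_R V) (subsetUr _ _).
- move=> a b; rewrite !in_setU1 => /orP[/eqP->|aS] /orP[/eqP->|bS] //.
  + by rewrite upd_same inS // => ab; move: yS; rewrite ab imset_f.
  + by rewrite upd_same inS // => ab; move: yS; rewrite -ab imset_f.
  + by rewrite !inS //; apply: (v_inj V).
- by move=> a aR; rewrite inS ?(v_phi V) //; apply: subsetP (v_R V) _ aR.
- move=> a; rewrite !in_setU1 => /orP[/eqP->|aS] aR.
    by rewrite -/u uS orbT upd_same inS // edC eqxx.
  have [pS h] := v_par V aS aR.
  by rewrite pS orbT !inS // h orbT.
- move=> p pY; have [h1 h2 h3] := v_Y V pY.
  by rewrite !in_setU1 h1 h2 !orbT !inS // h3 orbT.
- apply/subsetP=> a; rewrite !inE => /orP[->//|ar].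
  by rewrite (subsetP (v_rc V) _ ar) !orbT.
- move=> a b; rewrite imE !in_setU1 !negb_or => /andP[ay aS] /andP[by_ bS].
  rewrite !inE !negb_or (v_A V) // andbT; apply/andP; split.
    apply: contraNneq aS => h; have := edl a b; rewrite h in_ed (negbTE ay).
    by rewrite orbF => /eqP->.
  apply/eqP=> h.
  have : a \in e' by rewrite -h edl.
  rewrite in_ed => /orP[/eqP ha|/eqP ha]; first by rewrite ha fu in aS.
  have : b \in e' by rewrite -h edr.
  rewrite in_ed => /orP[/eqP hb|/eqP hb]; first by rewrite hb fu in bS.
  have : f u \in ed a b by rewrite h edl.
  by rewrite in_ed ha hb orbb (negbTE uy').
- move=> x; rewrite in_setU1 => xvS.
  case: (eqVneq x v) xvS => [-> _|xv /= xS].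
    by rewrite (bad_new V) // cards0.
  have kS : kids S x \subset kids (v |: S) x.
    by apply/subsetP=> a; rewrite !inE => /andP[-> ->]; rewrite orbT.
  case: (eqVneq x u) => [xu|xu].
    move: kS; rewrite xu => kS; have := @bad_par S f c v y y' vS uS; rewrite -/u => bs.
    apply: leq_trans (subset_leq_card bs) _.
    have kk : v |: kids S u \subset kids (v |: S) u.
      by rewrite subUset kS sub1set !inE eqxx vR -/u eqxx.
    have := subset_leq_card kk; rewrite !cardsU1.
    have -> : v \notin kids S u by rewrite inE (negbTE vS).
    rewrite add1n.
    by have := i_bad I uS; have := leq_b1 (y' \notin bad S f c u); arith.
  have bs : bad (v |: S) (upd f v y) ([set e; e'] :|: c) x \subset bad S f c x.
    have E : ext [set x] S f c (v |: S) (upd f v y) ([set e; e'] :|: c).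
      by apply: (ext_step V) => //; rewrite ?sub1set // inE eq_sym.
    by apply: bad_ext E _; rewrite inE.
  have := subset_leq_card bs; have := subset_leq_card kS.
  by have := i_bad I xS; arith.
- have -> : #|~: (v |: S)| = #|~: S|.-1.
    by have := cardsC S; have := cardsC (v |: S); rewrite cardsU1 vS; arith.
  move=> hK; have hK' : K <= #|~: S| by move: hK; arith.
  have := i_pot I hK'; apply: leq_trans.
  have -> : \sum_(a | a \notin f @: S) 2 ^ dg c a = 2 ^ dg c y +
      (2 ^ dg c y' + \sum_(a | [&& a \notin f @: S, a != y & a != y']) 2 ^ dg c a).
    rewrite (bigD1 y) ?yS //; congr (_ + _).
    rewrite (bigD1 y') ?y'S 1?eq_sym ?yy' //; congr (_ + _).
    by apply: eq_bigl => a; rewrite andbA.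
  have y'e : y' \notin e by rewrite in_ed negb_or eq_sym uy' eq_sym.
  have dl : dg ([set e; e'] :|: c) y' = (dg c y').+1 by rewrite dg_loser ?edr.
  pose F a := 2 ^ dg ([set e; e'] :|: c) a.
  rewrite (eq_bigr F) //.
  have -> : \sum_(a | a \notin upd f v y @: (v |: S)) F a = F y' +
      \sum_(a | [&& a \notin f @: S, a != y & a != y']) 2 ^ dg c a.
    rewrite (bigD1 y'); last by rewrite imE in_setU1 negb_or eq_sym yy' y'S.
    congr (_ + _); apply: eq_big => [a|a].
      rewrite imE in_setU1 negb_or.
      by case: (a == y); case: (a == y'); rewrite ?andbF ?andbT.
    rewrite imE in_setU1 negb_or => /andP[/andP[ay aS] ay'].
    have afu : a != f u by apply: contraNneq aS => ->.
    by rewrite /F dg_off // in_ed negb_or afu.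
  rewrite /F dl (deg hK') addnA leq_add2r expnS mul2n -addnn; exact: leqnn.
Qed.

End Position.

(* For [n < K'] the degree clause is vacuous. *)
Lemma good_big n (R : {set 'I_n}) par phi K K' S f r c Y :
  good R par phi K S f r c Y -> n < K' -> good R par phi K' S f r c Y.
Proof.
case=> V b _ nK; split=> // h; have := leq_trans nK h.
by rewrite ltnNge (leq_trans (max_card _)) // card_ord.
Qed.

(** * Moves and endgames *)

Section Play.
Variables (n : nat) (R : {set 'I_n}) (par phi : 'I_n -> 'I_n) (K l : nat).
Notation T := 'I_n.
Implicit Types (S W : {set T}) (f : T -> T) (r c : {set {set T}}).
Implicit Types (Y : seq (T * T)).
Notation valid := (valid R par phi).
Notation good := (good R par phi K).
Notation kids := (kids R par).

Hypothesis nl : n < 2 ^ l.+1.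

(* An unused vertex seen from at most one vertex of [Q] rules out at most one rotation. *)
Definition dst (Q : {set T}) f c (y : T) :=
  {in Q &, forall a b, ed (f a) y \in c -> ed (f b) y \in c -> a = b}.

Definition child (a b : T) := par b == a.

Lemma dg_le S f r c Y a :
  good S f r c Y -> K <= #|~: S| -> a \notin f @: S -> dg c a <= l.
Proof.
move=> I hK aS; have h := i_pot I hK.
rewrite -ltnS -(ltn_exp2l _ _ (isT : 1 < 2)); apply: leq_ltn_trans nl.
by apply: leq_trans h; rewrite (bigD1 a) //= leq_addr.
Qed.

Lemma pick_pair S f r c Y (X : {set T}) :
  good S f r c Y -> #|X| + 2 <= #|~: S| -> #|X| + l + 2 <= K ->
  exists y y', [/\ [&& y \notin f @: S, y \notin X, y' \notin f @: S & y' \notin X],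
    y != y' & K <= #|~: S| -> dg c y = dg c y'].
Proof.
move=> I X2 XK; pose B := ~: (f @: S) :\: X.
have inB y : (y \in B) = (y \notin f @: S) && (y \notin X).
  by rewrite in_setD in_setC andbC.
have cB : #|~: S| <= #|B| + #|X|.
  rewrite -(card_free I); have := cardsID X (~: (f @: S)).
  have : #|~: (f @: S) :&: X| <= #|X| by rewrite subset_leq_card ?subsetIr.
  rewrite -/B; arith.
case: (leqP K #|~: S|) => hK; last first.
  have [|y [y' [h1 h2 h3]]] := @pick2 _ B; first by move: cB X2; arith.
  move: h1 h2; rewrite !inB => /andP[yS yX] /andP[y'S y'X].
  by exists y, y'; split=> //; rewrite yS yX y'S.
pose g a : 'I_l.+1 := inord (dg c a).
have : ~~ dinjectiveb g B.
  apply: contraTN XK => /dinjectiveP gi; rewrite -ltnNge.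
  have := subset_leq_card (subsetT (g @: B)).
  by rewrite card_in_imset // cardsT card_ord; move: cB hK; arith.
case/dinjectivePn=> y yB [y' /andP[y'y y'B] h].
move: y'B yB; rewrite !inB => /andP[y'S y'X] /andP[yS yX].
exists y, y'; split; [by rewrite yS yX y'S | by rewrite eq_sym |move=> _].
have dy : dg c y < l.+1 by rewrite ltnS; apply: dg_le I hK yS.
have dy' : dg c y' < l.+1 by rewrite ltnS; apply: dg_le I hK y'S.
by move/(congr1 (@nat_of_ord _)): h; rewrite /g !inordK.
Qed.

Lemma step_pair G k S f r c Y v y1 y2 :
  good S f r c Y -> v \notin S -> par v \in S ->
  y1 \notin f @: S -> y2 \notin f @: S -> y1 != y2 ->
  y1 \notin bad S f c (par v) -> y2 \notin bad S f c (par v) ->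
  (K <= #|~: S| -> dg c y1 = dg c y2) ->
  (forall y y' r', (y = y1 /\ y' = y2) \/ (y = y2 /\ y' = y1) ->
     let c' := [set ed (f (par v)) y; ed (f (par v)) y'] :|: c in
     good (v |: S) (upd f v y) r' c' Y -> wf G k r' c') ->
  wf G k.+1 r c.
Proof.
move=> I vS uS y1S y2S yy y1b y2b deg H.
have fu : f (par v) \in f @: S by apply: imset_f.
apply: (@wf_offer n G k r c (ed (f (par v)) y1) (ed (f (par v)) y2)).
- by rewrite Kn_ed; apply: contraNneq y1S => <-.
- by rewrite Kn_ed; apply: contraNneq y2S => <-.
- by move: y1b; rewrite inE y1S.
- by move: y2b; rewrite inE y2S.
- by apply: contraNneq yy => /ed_inj->.
- by apply: H; [left | apply: step_inv].
- rewrite [[set _; _]]setUC; apply: H; first by right.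
  by apply: step_inv => //; [rewrite eq_sym|move=> /deg].
Qed.

Lemma step_avoid G k S f r c Y v (X : {set T}) :
  good S f r c Y -> v \notin S -> par v \in S -> bad S f c (par v) \subset X ->
  #|X| + 2 <= #|~: S| -> #|X| + l + 2 <= K ->
  (forall y y' r', y \notin f @: S -> y' \notin f @: S -> y != y' ->
     y \notin X -> y' \notin X ->
     let c' := [set ed (f (par v)) y; ed (f (par v)) y'] :|: c in
     good (v |: S) (upd f v y) r' c' Y -> wf G k r' c') ->
  wf G k.+1 r c.
Proof.
move=> I vS uS bX X2 XK H.
have [y1 [y2 []]] := pick_pair I X2 XK.
case/and4P=> y1S y1X y2S y2X yy deg.
apply: (step_pair I vS uS y1S y2S yy _ _ deg).
- exact: contra (subsetP bX _) y1X.
- exact: contra (subsetP bX _) y2X.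
by move=> y y' r' [[-> ->]|[-> ->]]; apply: H => //; rewrite eq_sym.
Qed.

(** * Embedding paths downwards *)

Lemma card_free_step S v : v \notin S -> #|~: S| = #|~: (v |: S)|.+1.
Proof. by move=> vS; have := cardsC S; have := cardsC (v |: S); rewrite cardsU1 vS; arith. Qed.

Lemma path_plain G k ps : forall S f r c Y q,
  good S f r c Y -> q \in S -> bad S f c q = set0 ->
  path child q ps -> uniq ps -> {in ps, forall x, x \notin S} ->
  size ps < #|~: S| -> l + 2 <= K ->
  (forall f' r' c', let S' := S :|: [set x in ps] in
     good S' f' r' c' Y -> ext (S :\ q) S f c S' f' c' ->
     bad S' f' c' (last q ps) = set0 -> {in S, f' =1 f} ->
     {in q :: ps, forall x, #|bad S' f' c' x| <= 1} -> wf G k r' c') ->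
  wf G (size ps + k) r c.
Proof.
elim: ps => [|v ps IH] S f r c Y q I qS qb.
  move=> _ _ _ _ _; rewrite set_nil setU0 => H; apply: (H f) => //.
  by move=> x; rewrite inE => /eqP->; rewrite qb cards0.
rewrite -[size (v :: ps) + k]/(size ps + k).+1.
rewrite [path _ _ _]/= [uniq _]/= => /andP[/eqP pv pq] /andP[vps ups] psS sz lK H.
rewrite [size _]/= in sz lK.
have vS : v \notin S by apply: psS; rewrite mem_head.
have uS : par v \in S by rewrite pv.
apply: (step_avoid (X := set0) I vS uS); rewrite ?cards0 ?pv ?qb //.
  by move: sz; arith.
move=> y y' r1 yS y'S yy _ _ c1 I1.
have V := i_valid I.
have E1 : ext (S :\ q) S f c (v |: S) (upd f v y) c1.
  by rewrite /c1 -pv; apply: (ext_step V) => //; rewrite ?subsetDl // !inE eqxx.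
have qv : q != v by apply: contraNneq vS => <-.
have b1 : #|bad (v |: S) (upd f v y) c1 q| <= 1.
  have := subset_leq_card (@bad_par _ par S f c v y y' vS uS).
  by rewrite pv qb setU0 cards1.
apply: (IH (v |: S) (upd f v y) r1 c1 Y v) => //.
- by rewrite setU11.
- by rewrite /c1 -pv (bad_new V).
- move=> x xps; rewrite in_setU1 negb_or psS ?inE ?xps ?orbT // andbT.
  by apply: contraNneq vps => <-.
- by move: sz; rewrite (card_free_step vS); arith.
have -> : v |: S :|: [set x in ps] = S :|: [set x in v :: ps].
  by rewrite set_cons setUCA setUA.
move=> f2 r2 c2 S2 I2 E2 bl eS bp; apply: (H f2 r2 c2) => //.
- apply: ext_trans E1 _; apply: ext_sub E2; apply/subsetP=> x.
  by rewrite !inE => /andP[_ xS]; rewrite xS orbT andbT; apply: contraNneq vS => <-.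
- by move=> x xS; rewrite eS ?in_setU1 ?xS ?orbT // (upd_in _ _ vS).
- move=> x; rewrite inE => /orP[/eqP->|]; last exact: bp.
  apply: leq_trans b1; apply/subset_leq_card/(bad_ext E2).
  by rewrite !inE qv qS orbT.
Qed.

(** Prepares rotations: a vertex placed later is joined by coloured edges to at most one member of
    [Q], so nearly all chords to [Q] stay available. To preserve this, both offered vertices avoid
    everything already bad for [Q]; the rejected one then becomes bad for the new member [q] alone.
    The number [j] bounds the union of these bad sets. Each round raises it by one and uses one
    vertex, whence [j + 2 * size ps]. *)
Lemma path_dist G k ps : forall S f r c Y q (Q : {set T}) j,
  good S f r c Y -> q \in S -> bad S f c q = set0 ->
  Q \subset S -> q \notin Q -> #|\bigcup_(x in Q) bad S f c x| <= j ->
  (forall y, y \notin f @: S -> dst Q f c y) ->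
  {in Q, forall x, x != par q -> ed (f x) (f q) \notin c} ->
  path child q ps -> uniq ps -> {in ps, forall x, x \notin S} ->
  j + 2 * size ps <= #|~: S| -> j + size ps + l + 2 <= K ->
  (forall f' r' c', let S' := S :|: [set x in ps] in
     let Q' := Q :|: [set x in belast q ps] in
     good S' f' r' c' Y -> ext (S :\ q) S f c S' f' c' -> {in S, f' =1 f} ->
     bad S' f' c' (last q ps) = set0 ->
     {in q :: ps, forall x, #|bad S' f' c' x| <= 1} ->
     (forall y, y \notin f' @: S' -> dst Q' f' c' y) ->
     {in Q', forall x, x != par (last q ps) ->
        ed (f' x) (f' (last q ps)) \notin c'} -> wf G k r' c') ->
  wf G (size ps + k) r c.
Proof.
elim: ps => [|v ps IH] S f r c Y q Q j I qS qb QS qQ Qj dQ lQ.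
  move=> _ _ _ _ _; rewrite /= !set_nil !setU0 => H; apply: (H f) => //.
  by move=> x; rewrite inE => /eqP->; rewrite qb cards0.
rewrite -[size (v :: ps) + k]/(size ps + k).+1.
rewrite [path _ _ _]/= [uniq _]/= => /andP[/eqP pv pq] /andP[vps ups] psS sz lK H.
rewrite [size _]/= in sz lK.
have vS : v \notin S by apply: psS; rewrite mem_head.
have uS : par v \in S by rewrite pv.
apply: (step_avoid (X := \bigcup_(x in Q) bad S f c x) I vS uS).
- by rewrite pv qb sub0set.
- by move: sz Qj; arith.
- by move: lK Qj; arith.
move=> y y' r1 yS y'S yy yX y'X c1 I1.
have V := i_valid I.
have E1 : ext (S :\ q) S f c (v |: S) (upd f v y) c1.
  by rewrite /c1 -pv; apply: (ext_step V) => //; rewrite ?subsetDl // !inE eqxx.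
have qv : q != v by apply: contraNneq vS => <-.
have bq : bad (v |: S) (upd f v y) c1 q \subset [set y'].
  have := @bad_par _ par S f c v y y' vS uS.
  by rewrite pv qb setU0 /c1 pv.
have inS := upd_in f y vS.
have fq : upd f v y q = f q by apply: inS.
have fQ x : x \in Q -> upd f v y x = f x by move=> /(subsetP QS)/inS.
have QSq : {subset Q <= S :\ q}.
  move=> x xQ; rewrite !inE (subsetP QS) // andbT.
  by apply: contraNneq qQ => <-.
have unc x z : x \in Q -> z \notin f @: S ->
    z \notin \bigcup_(x in Q) bad S f c x -> ed (f x) z \notin c1.
  move=> xQ zS zX; apply: contra zX => h.
  have [_ _ _ n1] := E1.
  by apply/bigcupP; exists x => //; rewrite inE zS (n1 x _ (QSq x xQ) h) ?edl.
apply: (IH (v |: S) (upd f v y) r1 c1 Y v (q |: Q) j.+1) => //.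
- by rewrite setU11.
- by rewrite /c1 (bad_new V).
- by rewrite subUset sub1set in_setU1 qS orbT (subset_trans QS) // subsetUr.
- rewrite in_setU1 negb_or eq_sym qv; apply: contra vS; exact: (subsetP QS).
- rewrite bigcup_setU big_set1.
  apply: leq_trans (_ : #|[set y'] :|: \bigcup_(x in Q) bad S f c x| <= _).
    apply: subset_leq_card; apply: setUSS bq _.
    apply/bigcupsP=> x xQ; apply: subset_trans (bad_ext E1 (QSq x xQ)) _.
    exact: bigcup_sup.
  by rewrite cardsU1 y'X; move: Qj; arith.
- move=> z; rewrite img_upd // in_setU1 negb_or => /andP[zy zS] a b.
  have zq : ed (f q) z \in c1 -> z = y'.
    move=> h; apply/set1P/(subsetP bq); rewrite inE img_upd // in_setU1 negb_or zy zS.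
    by rewrite fq.
  rewrite !in_setU1 => /orP[/eqP->|aQ] /orP[/eqP->|bQ] //.
  + rewrite fq fQ // => /zq ->.
    by rewrite (negbTE (unc b y' bQ y'S y'X)).
  + rewrite fq fQ // => h /zq zy'; move: h; rewrite zy'.
    by rewrite (negbTE (unc a y' aQ y'S y'X)).
  rewrite !fQ // => ha hb; have [_ _ _ n1] := E1.
  apply: (dQ z zS a b aQ bQ).
    by apply: (n1 a _ (QSq a aQ) ha); rewrite edl.
  by apply: (n1 b _ (QSq b bQ) hb); rewrite edl.
- move=> x; rewrite in_setU1 pv => /orP[->//|xQ] _.
  by rewrite upd_same fQ // unc.
- move=> x xps; rewrite in_setU1 negb_or psS ?inE ?xps ?orbT // andbT.
  by apply: contraNneq vps => <-.
- by move: sz; rewrite (card_free_step vS); arith.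
- by move: lK; arith.
have -> : v |: S :|: [set x in ps] = S :|: [set x in v :: ps].
  by rewrite set_cons setUCA setUA.
have -> : q |: Q :|: [set x in belast v ps] = Q :|: [set x in q :: belast v ps].
  by rewrite set_cons setUCA setUA.
move=> f2 r2 c2 S2 Q2 I2 E2 eS bl bp dd ll; apply: (H f2 r2 c2) => //.
- apply: ext_trans E1 _; apply: ext_sub E2; apply/subsetP=> x.
  by rewrite !inE => /andP[_ xS]; rewrite xS orbT andbT; apply: contraNneq vS => <-.
- by move=> x xS; rewrite eS ?in_setU1 ?xS ?orbT // (upd_in _ _ vS).
- move=> x; rewrite inE => /orP[/eqP->|]; last exact: bp.
  apply: leq_trans (subset_leq_card (bad_ext E2 _)) _.
    by rewrite !inE qv qS orbT.
  by have := subset_leq_card bq; rewrite cards1.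
Qed.

(* Posa rotation: reversing the images along a final segment of a red path. *)
Definition mirror (s : seq T) x := if x \in s then nth x (rev s) (index x s) else x.
Definition revf f s x := f (mirror s x).

Lemma mirror_nth s x0 i : uniq s -> i < size s ->
  mirror s (nth x0 s i) = nth x0 s (size s - i.+1).
Proof.
move=> us si; rewrite /mirror mem_nth // index_uniq // nth_rev //.
by apply: set_nth_default; rewrite -subn_gt0 subKn.
Qed.

Lemma mirror_mem s x : uniq s -> (mirror s x \in s) = (x \in s).
Proof.
move=> us; rewrite /mirror; case xs: (x \in s); last by rewrite /= xs.
rewrite -mem_rev; apply: mem_nth; by rewrite size_rev index_mem.
Qed.

Lemma mirrorK s : uniq s -> involutive (mirror s).
Proof.
move=> us x; case xs: (x \in s); last by rewrite /mirror xs /= xs.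
have xi : index x s < size s by rewrite index_mem.
rewrite -{1}(nth_index x xs) mirror_nth // mirror_nth; first last.
- by rewrite ltn_subrL (leq_ltn_trans _ xi).
- exact: us.
by rewrite subnSK // subKn ?nth_index // ltnW.
Qed.

Lemma revf_out f s x : x \notin s -> revf f s x = f x.
Proof. by rewrite /revf /mirror => /negbTE->. Qed.

Lemma revf_img S f s : uniq s -> {subset s <= S} -> revf f s @: S = f @: S.
Proof.
move=> us sS.
have SS x : (mirror s x \in S) = (x \in S).
  case xs: (x \in s); last by rewrite /mirror xs.
  by rewrite !sS ?mirror_mem.
apply/setP=> y; apply/imsetP/imsetP=> [[x xS ->]|[x xS ->]].
  by exists (mirror s x); rewrite ?SS.
by exists (mirror s x); rewrite ?SS // /revf mirrorK.
Qed.

(** The red edge from [q] to the old end replaces the edge from [q] to the head of [s]; the other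
    edges of the path are the same ones traversed backwards. Anything else hanging from [s], or
    recorded in [Y] there, would be torn off, hence the two closure hypotheses. *)
Lemma revf_valid S f r c Y q s :
  valid S f r c Y -> q \in S -> path child q s -> uniq (q :: s) ->
  {subset s <= S} -> {in s, forall x, x \notin R} ->
  (forall v, v \in S -> v \notin R -> par v \in s -> v \in s) ->
  (forall p, p \in Y -> p.1 \notin s /\ p.2 \notin s) ->
  ed (f (last q s)) (f q) \in r -> valid S (revf f s) r c Y.
Proof.
move=> V qS pq /= /andP[qs us] sS sR sk sY lr.
have pn i : i < size s -> par (nth q s i) = nth q (q :: s) i.
  by move=> h; apply/eqP; move/(pathP q): pq; apply.
split.
- exact: v_R V.
- move=> a b aS bS.
  have SS x : x \in S -> mirror s x \in S.
    by move=> xS; case xs: (x \in s); [apply: sS; rewrite mirror_mem|rewrite /mirror xs].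
  by move/(v_inj V (SS _ aS) (SS _ bS))/(can_inj (mirrorK us)).
- move=> x xR; rewrite revf_out ?(v_phi V) //.
  by apply: contraL xR => /sR.
- move=> v vS vR; have [pS pr] := v_par V vS vR; split=> //.
  case vs: (v \in s); last first.
    rewrite !revf_out ?vs //; apply/negP => /(sk v vS vR); by rewrite vs.
  have vi : index v s < size s by rewrite index_mem.
  rewrite -(nth_index q vs) pn //.
  case E: (index v s) vi => [|i] vi /=.
    by rewrite (revf_out f qs) /revf mirror_nth // subn1 nth_last.
  rewrite /revf !mirror_nth // 1?ltnW //.
  set m := size s - i.+2; have -> : size s - i.+1 = m.+1 by rewrite subnSK.
  have ms : m.+1 < size s by rewrite subnSK // ltn_subrL (leq_trans _ vi).
  have h := sS _ (mem_nth q ms); have hR := sR _ (mem_nth q ms).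
  by have [_] := v_par V h hR; rewrite pn // edC.
- move=> p pY; have [h1 h2 h3] := v_Y V pY; have [n1 n2] := sY p pY.
  by rewrite !revf_out.
- exact: v_rc V.
- by rewrite revf_img //; apply: v_A V.
Qed.

Lemma valid_add S f r c Y r' c' :
  valid S f r c Y -> r \subset r' -> r' \subset c' ->
  (forall e, e \in c' -> e \in c \/ exists2 x, x \in S & f x \in e) ->
  valid S f r' c' Y.
Proof.
move=> V rr rc cc; split; try by case: V.
- by move=> v vS vR; have [h1 h2] := v_par V vS vR; rewrite (subsetP rr).
- by move=> p pY; have [h1 h2 h3] := v_Y V pY; rewrite (subsetP rr).
move=> x y xS yS; apply/negP=> /cc[|[z zS]]; first exact/negP/(v_A V).
rewrite in_ed => /orP[]/eqP h; move: xS yS; rewrite -h imset_f //=.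
Qed.

(** Suppose the chord from the end [w] to the vertex at position [m] of [q0 :: ps] turns red. The
    path can then also be traversed so that it ends at the image of the next vertex, [nth q0 ps m].
    Offering [t] the old and the new end therefore succeeds under both replies: [f] is kept, or the
    segment [drop m ps] is reversed. One edge is gained in two rounds. *)
Lemma rotate_and_close G k S f r c Y q0 ps i j t :
  let w := last q0 ps in
  valid S f r c Y -> q0 \in S -> path child q0 ps -> uniq (q0 :: ps) ->
  {subset ps <= S} -> {in ps, forall x, x \notin R} ->
  (forall v, v \in S -> v \notin R -> par v \in ps -> v \in ps) ->
  (forall p, p \in Y -> p.1 \notin ps /\ p.2 \notin ps) ->
  i < size ps -> j < size ps -> i != j ->
  ed (f w) (f (nth q0 (q0 :: ps) i)) \notin c ->
  ed (f w) (f (nth q0 (q0 :: ps) j)) \notin c ->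
  {in q0 :: ps, forall x, f x != t} ->
  ed t (f w) \notin c -> ed t (f (nth q0 ps i)) \notin c ->
  ed t (f (nth q0 ps j)) \notin c ->
  (forall g r' c' m, m = i \/ m = j -> g = f \/ g = revf f (drop m ps) ->
     valid S g r' c' Y -> ed t (g w) \in r' -> c \subset c' ->
     (forall e, e \in c' -> [\/ e \in c,
        exists2 x, x \in q0 :: ps & e = ed (f w) (f x),
        e = ed t (f w) | e = ed t (f (nth q0 ps m)) ]) -> wf G k r' c') ->
  wf G k.+2 r c.
Proof.
move=> w V qS pq us sS sR sk sY si sj ij ni nj tp nw ti tj H.
have PS : {subset q0 :: ps <= S}.
  by move=> x; rewrite inE => /orP[/eqP->|/sS].
have finj : {in q0 :: ps &, injective f}.
  by move=> a b /PS aS /PS bS; apply: (v_inj V).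
have wP : w \in q0 :: ps by apply: mem_last.
have qP m : m < size ps -> nth q0 (q0 :: ps) m \in q0 :: ps.
  by move=> h; apply: mem_nth; apply: ltnW.
have hP m : m < size ps -> nth q0 ps m \in q0 :: ps.
  by move=> h; rewrite inE mem_nth ?orbT.
have wlast m : m < size ps -> last (nth q0 (q0 :: ps) m) (drop m ps) = w.
  move=> h; rewrite /w -[in RHS](cat_take_drop m ps) last_cat; congr (last _ _).
  by rewrite (last_nth q0) size_take h; case: m h => //= m h; rewrite nth_take.
have qw m : m < size ps -> nth q0 (q0 :: ps) m != w.
  by move=> h; rewrite /w (last_nth q0) nth_uniq //= ?ltnS ?(ltnW h) // ltn_eqF.
have pn m : m < size ps -> par (nth q0 ps m) = nth q0 (q0 :: ps) m.
  by move=> h; apply/eqP; move/(pathP q0): pq; apply.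
(* The edge from [w] to its parent is red, so an uncoloured chord does not end at the parent; hence
   the rotated end differs from [w]. *)
have hw m : m < size ps -> ed (f w) (f (nth q0 (q0 :: ps) m)) \notin c ->
    nth q0 ps m != w.
  move=> h; apply: contraNneq => hm.
  have wps : w \in ps by rewrite -hm mem_nth.
  have [_ h1] := v_par V (sS _ wps) (sR _ wps).
  rewrite (_ : nth q0 (q0 :: ps) m = par w) ?(subsetP (v_rc V)) //.
  by rewrite -hm pn.
pose ei := ed (f w) (f (nth q0 (q0 :: ps) i)).
pose ej := ed (f w) (f (nth q0 (q0 :: ps) j)).
have fneq a b : a \in q0 :: ps -> b \in q0 :: ps -> a != b -> f a != f b.
  by move=> aP bP; apply: contra => /eqP/finj->.
have eij : ei != ej.
  apply/eqP=> /ed_inj/(finj _ _ (qP _ si) (qP _ sj))/eqP.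
  by rewrite nth_uniq ?(negbTE ij) //= ltnS ltnW.
pose c1 := [set ei; ej] :|: c.
(* Both replies are treated alike, with [m] the index of the chord that turned red. *)
suff main m e : m = i \/ m = j -> m < size ps ->
    e = ed (f w) (f (nth q0 (q0 :: ps) m)) -> e \in [set ei; ej] ->
    ed (f w) (f (nth q0 (q0 :: ps) m)) \notin c ->
    ed t (f (nth q0 ps m)) \notin c -> wf G k.+1 (e |: r) c1.
  apply: (@wf_offer n G k.+1 r c ei ej) => //.
  - by rewrite Kn_ed eq_sym fneq ?qP ?qw.
  - by rewrite Kn_ed eq_sym fneq ?qP ?qw.
  - by apply: (main i) => //; [left|rewrite !inE eqxx].
  - by apply: (main j) => //; [right|rewrite !inE eqxx orbT].
move=> mij sm Ee eee nm tm.
have e1c1 : e |: r \subset c1.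
  rewrite subUset sub1set inE eee /=; apply: subset_trans (v_rc V) _.
  exact: subsetUr.
have c1P e0 : e0 \in c1 -> e0 \in c \/ exists2 x, x \in q0 :: ps & e0 = ed (f w) (f x).
  rewrite !inE => /orP[/orP[]/eqP->|]; last by left.
    by right; exists (nth q0 (q0 :: ps) i); rewrite ?qP.
  by right; exists (nth q0 (q0 :: ps) j); rewrite ?qP.
have V1 : valid S f (e |: r) c1 Y.
  apply: valid_add V _ e1c1 _; first exact: subsetUr.
  move=> e0 /c1P[|[x xP ->]]; [by left|right].
  by exists w; rewrite ?edl // PS.
pose s := drop m ps; pose qm := nth q0 (q0 :: ps) m.
have ssub : {subset s <= ps} by move=> x; apply: mem_drop.
have uqs : uniq (qm :: s).
  have := us; rewrite -(cat_take_drop m (q0 :: ps)) cat_uniq => /and3P[_ _].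
  by rewrite (drop_nth q0) //= ltnS ltnW.
have V2 : valid S (revf f s) (e |: r) c1 Y.
  apply: (revf_valid V1 (q := qm)) => //.
  - exact/PS/qP.
  - have := pq; rewrite -{1}(cat_take_drop m ps) cat_path => /andP[_].
    rewrite (_ : last q0 (take m ps) = qm) //.
    rewrite (last_nth q0) size_take sm /qm.
    by case: (m) sm => //= m' h; rewrite nth_take.
  - by move=> x /ssub/sS.
  - by move=> x /ssub/sR.
  (* On the path the parent of a vertex is its predecessor, so a kid of a member of [drop m ps] has
     a larger index and belongs to it as well. *)
  - move=> v vS vR pv; have vps := sk v vS vR (ssub _ pv).
    have vi : index v ps < size ps by rewrite index_mem.
    have : par v = nth q0 (q0 :: ps) (index v ps).
      by rewrite -{1}(nth_index q0 vps) pn.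
    have pi : index (par v) ps < size ps by rewrite index_mem ssub.
    rewrite -{1}(nth_index q0 (ssub _ pv)).
    rewrite -[nth q0 ps _]/(nth q0 (q0 :: ps) (index (par v) ps).+1).
    move/eqP; rewrite nth_uniq //= ?ltnS 1?ltnW // => /eqP E.
    have pm : m <= index (par v) ps.
      rewrite leqNgt; apply/negP=> h.
      have pt : par v \in take m ps by rewrite in_take ?ssub.
      have := us; rewrite /= -(cat_take_drop m ps) cat_uniq => /and4P[_ _ /hasPn hh _].
      by have := hh _ pv; rewrite /= pt.
    have mv : m <= index v ps by rewrite -E leqW.
    by rewrite /s -(nth_index q0 vps) -(subnKC mv) -nth_drop mem_nth //
      size_drop ltn_sub2r // (leq_ltn_trans mv).
  - by move=> p pY; have [h1 h2] := sY p pY; split; [apply: contra h1|apply: contra h2] => /ssub.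
  - by rewrite /s /qm wlast // -Ee setU11.
have rotw : revf f s w = f (nth q0 ps m).
  have s0 : 0 < size s by rewrite size_drop subn_gt0.
  have -> : w = nth qm s (size s).-1 by rewrite nth_last -(wlast m sm).
  have us' : uniq s by case/andP: uqs.
  rewrite /revf mirror_nth // prednK // subnn nth_drop addn0.
  by congr f; apply: set_nth_default.
pose a1 := ed t (f w); pose a2 := ed t (f (nth q0 ps m)).
have tc1 x : x \in q0 :: ps -> ed t (f x) \notin c -> ed t (f x) \notin c1.
  move=> xP h; apply/negP=> /c1P[|[z zP E]]; first exact/negP.
  have := edl t (f x); rewrite E in_ed => /orP[]/eqP h'.
    by have := tp _ wP; rewrite h' eqxx.
  by have := tp _ zP; rewrite h' eqxx.
have nh : nth q0 ps m != w by apply: hw.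
have a12 : a1 != a2.
  by apply/eqP=> /ed_inj/(finj _ _ wP (hP _ sm))/eqP; rewrite eq_sym (negbTE nh).
pose c2 := [set a1; a2] :|: c1.
have c2P e0 : e0 \in c2 -> [\/ e0 \in c,
     exists2 x, x \in q0 :: ps & e0 = ed (f w) (f x), e0 = a1 | e0 = a2].
  rewrite [e0 \in c2]in_setU in_set2 => /orP[/orP[]/eqP->|h]; [exact: Or43|exact: Or44|].
  by case: (c1P _ h) => h'; [exact: Or41|exact: Or42].
have cc2 : c \subset c2 by rewrite /c2 /c1 setUA subsetUr.
have v2P g : g @: S = f @: S -> forall e0, e0 \in c2 ->
    e0 \in c1 \/ exists2 x, x \in S & g x \in e0.
  move=> gS e0; rewrite [e0 \in c2]in_setU => /orP[h|]; last by left.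
  right; suff [y yS ye] : exists2 y, y \in f @: S & y \in e0.
    by move: yS; rewrite -gS => /imsetP[x xS E]; exists x; rewrite -?E.
  move: h; rewrite !inE => /orP[]/eqP->.
    by exists (f w); rewrite ?edr // imset_f ?PS.
  by exists (f (nth q0 ps m)); rewrite ?edr // imset_f ?PS ?hP.
apply: (@wf_offer n G k (e |: r) c1 a1 a2).
- by rewrite Kn_ed eq_sym tp.
- by rewrite Kn_ed eq_sym tp ?hP.
- exact: tc1.
- by apply: tc1; rewrite ?hP.
- exact: a12.
- apply: (H f _ _ m mij) => //; first by left.
    apply: valid_add V1 _ _ (v2P f erefl); first exact: subsetUr.
    rewrite subUset sub1set !inE eqxx /= (subset_trans e1c1) //.
    exact: subsetUr.
  exact: setU11.
- apply: (H (revf f s) _ _ m mij) => //; first by right.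
    apply: valid_add V2 _ _ (v2P _ _); first exact: subsetUr.
      rewrite subUset sub1set !inE eqxx /= orbT (subset_trans e1c1) //.
      exact: subsetUr.
    by apply: revf_img; [case/andP: uqs|move=> x /ssub/sS].
  by rewrite rotw setU11.
Qed.

Lemma good_inner S f r c Y g r' c' Y' :
  good S f r c Y -> valid S g r' c' Y' -> g @: S = f @: S -> c \subset c' ->
  (forall a (e : {set T}), a \notin f @: S -> e \in c' -> a \in e -> e \in c) ->
  {in S, forall u, exists2 u', g u = f u' &
     u = u' \/ (u \notin R /\ #|bad S f c u'| <= 1)} ->
  good S g r' c' Y'.
Proof.
move=> I V im cc new gg; split=> //.
- move=> u uS; have [u' gu hu] := gg u uS.
  have sb : bad S g c' u \subset bad S f c u'.
    apply/subsetP=> a; rewrite !inE im gu => /andP[aS h]; rewrite aS.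
    exact: new aS h (edr _ _).
  apply: leq_trans (subset_leq_card sb) _.
  case: hu => [<-|[uR h]]; first by move: (i_bad I uS).
  by apply: leq_trans h _; rewrite uR leq_addl.
move=> hK; apply: leq_trans (i_pot I hK); rewrite im; apply: eq_leq.
apply: eq_bigr => a aS; congr (2 ^ _); apply: eq_card => e; rewrite !inE.
case ae: (a \in e); rewrite ?andbF // !andbT; apply/idP/idP => [h|].
  exact: new aS h ae.
exact: subsetP cc e.
Qed.

(** * Closing the paths to the second roots *)

Lemma set_seq_cat (s1 s2 : seq T) :
  [set x in s1 ++ s2] = [set x in s1] :|: [set x in s2].
Proof. by apply/setP=> x; rewrite !inE mem_cat. Qed.

Lemma card_free_seq S ps : uniq ps -> {in ps, forall x, x \notin S} ->
  #|~: S| = #|~: (S :|: [set x in ps])| + size ps.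
Proof.
elim: ps S => [|v ps IH] S; first by rewrite set_nil setU0 addn0.
move=> /= /andP[vps ups] pS; have vS : v \notin S by rewrite pS ?mem_head.
rewrite set_cons setUCA setUA addnS -addSn.
rewrite (card_free_step vS) (IH (v |: S)) //.
move=> x xps; rewrite in_setU1 negb_or pS ?inE ?xps ?orbT // andbT.
by apply: contraNneq vps => <-.
Qed.

(** At a root [i_bad] has no allowance for rotations, so without embedded kids its bad set must be
    empty. *)
Lemma fresh_bad S f r c Y u : good S f r c Y -> u \in R ->
  (forall v, v \in S -> v \notin R -> par v != u) -> bad S f c u = set0.
Proof.
move=> I uR h; apply/eqP; rewrite -cards_eq0 -leqn0.
apply: leq_trans (i_bad I (subsetP (v_R I) u uR)) _.
rewrite uR addn0 leqn0 cards_eq0; apply/eqP/setP=> v; rewrite !inE.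
by apply/negP=> /and3P[vS vR]; apply/negP/h.
Qed.

(* The path is built first, and then a chord from its end to one of two inner vertices is
   offered; the rotation along the chord gives a second candidate for the end, and [x] is
   offered both.  These are the two extra rounds. *)
Lemma close_path G k S f r c Y q ps x :
  good S f r c Y -> q \in S -> bad S f c q = set0 ->
  x \in S -> x != q -> bad S f c x = set0 ->
  path child q ps -> uniq ps -> {in ps, forall z, z \notin S} ->
  (forall v, v \in S -> v \notin R -> par v \notin ps) ->
  5 <= size ps -> size ps < #|~: S| -> l + 5 <= K ->
  (forall f' r' c', good (S :|: [set z in ps]) f' r' c' ((x, last q ps) :: Y) ->
     ext ((S :\ q) :\ x) S f c (S :|: [set z in ps]) f' c' -> wf G k r' c') ->
  wf G (size ps + k.+2) r c.
Proof.
move=> I qS qb xS xq xb pq us psS kS s5 sz lK H.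
case E: ps s5 => [|a [|b [|d p2]]] // s5.
have V := i_valid I.
(* Only the head of the path needs [path_dist]: whatever image the end gets later, at most one of
   the chords to [q], [a], [b] is coloured, and two remain to be offered. *)
pose p1 := [:: a; b; d].
have Ep : ps = p1 ++ p2 by rewrite E.
have := us; rewrite Ep cat_uniq => /and3P[us1 /hasPn us12 us2].
have := pq; rewrite Ep cat_path => /andP[pq1 pq2].
have p1S : {in p1, forall z, z \notin S} by move=> z h; rewrite psS // Ep mem_cat h.
have c1E := card_free_seq us1 p1S.
rewrite -[_ :: _]/(p1 ++ p2) size_cat -addnA.
have qps : q \notin ps by apply: contraL qS => /psS.
apply: (path_dist (Q := set0) (j := 0) I qS qb) => //.
- exact: sub0set.
- by rewrite inE.
- by rewrite big_set0 cards0.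
- by move=> y _ z; rewrite inE.
- by move=> z; rewrite inE.
- by apply: leq_trans sz; rewrite E ltnS ltnS ltnS ltnS ltnS ltnS in s5 *.
- by rewrite /=; move: lK; clear; lia.
move=> f1 r1 c1 S1 Q1 I1 E1 eS1 bd b1 dd _.
have p2S1 : {in p2, forall z, z \notin S1}.
  move=> z h; rewrite in_setU negb_or psS ?Ep ?mem_cat ?h ?orbT // inE.
  exact: us12.
apply: (path_plain I1 _ bd pq2 us2 p2S1) => //.
- by rewrite !inE eqxx !orbT.
- by move: sz; rewrite Ep size_cat c1E addnC ltn_add2r.
- by move: lK; clear; lia.
have -> : S1 :|: [set z in p2] = S :|: [set z in ps].
  by rewrite Ep set_seq_cat setUA.
set S2 := S :|: [set z in ps].
move=> f2 r2 c2 S2' I2 E2 bw eS2 b2; rewrite {}/S2' in I2 E2 bw b2.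
set w := last _ p2 in bw.
have V2 := i_valid I2.
have p2n : p2 <> [::] by move=> p20; rewrite p20 in s5.
have wp2 : w \in p2 by rewrite /w; case: (p2) p2n => // z s _; exact: (mem_last z s).
have wps : w \in ps by rewrite Ep mem_cat wp2 orbT.
have wE : w = last q ps by rewrite Ep last_cat.
have SS1 : {subset S <= S1} by move=> z; rewrite in_setU => ->.
have S1S2 : {subset S1 <= S2}.
  by move=> z zS; rewrite /S2 Ep set_seq_cat setUA in_setU zS.
have psS2 : {subset ps <= S2} by move=> z h; rewrite in_setU inE h orbT.
have dq z : z \in [:: q; a; b] -> z \in S1 :\ d.
  have udps : d \notin [:: q; a; b].
    move: us qps; rewrite Ep /= !inE !negb_or.
    case/and4P=> /and3P[ab ad _] /andP[bd' _] _ _ /and4P[_ _ qd _].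
    by rewrite eq_sym qd eq_sym ad eq_sym bd'.
  move=> h; rewrite in_setD1 (contraNneq _ udps) => [|<- //].
  move: h; rewrite !inE => /or3P[]/eqP->; rewrite ?qS ?eqxx ?orbT //.
have f2w : f2 w \notin f1 @: S1.
  apply/imsetP=> -[z zS1 h]; have := p2S1 w wp2; rewrite (_ : w = z) ?zS1 //.
  by apply: (v_inj V2); [exact: psS2|exact: S1S2|rewrite h eS2].
have col2 z z' : z \in [:: q; a; b] -> z' \in [:: q; a; b] ->
    ed (f2 z) (f2 w) \in c2 -> ed (f2 z') (f2 w) \in c2 -> z = z'.
  have Q1E y : y \in [:: q; a; b] -> y \in Q1.
    by rewrite !inE => ->.
  have fc y : y \in [:: q; a; b] -> ed (f2 y) (f2 w) \in c2 ->
      ed (f1 y) (f2 w) \in c1.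
    move=> /dq yS; have [_ _ e2 n2] := E2; rewrite e2 // => h.
    by apply: (n2 y) => //; rewrite edl.
  by move=> hz hz' /(fc _ hz) h /(fc _ hz'); apply: (dd _ f2w); rewrite ?Q1E.
have E3 : ext (S :\ q) S f c S2 f2 c2.
  apply: ext_trans E1 _; apply: ext_sub E2; apply/subsetP=> z.
  rewrite !in_setD1 => /andP[_ zS]; rewrite SS1 // andbT.
  by apply: contraTneq zS => ->; apply: p1S; rewrite !inE eqxx !orbT.
have feq z : z \in S -> f2 z = f z by move=> zS; rewrite eS2 ?eS1 ?SS1.
have SS2 : {subset S <= S2} by move=> z /SS1/S1S2.
have f2S z : z \in ps -> f2 z \notin f @: S.
  move=> zp; apply/imsetP=> -[u uS]; rewrite -feq // => h.
  have := psS z zp; rewrite (_ : z = u) ?uS //.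
  by apply: (v_inj V2); [exact: psS2|exact: SS2|exact: h].
(* The root [x] was clean at the start, and no round is played at it while the path is built. *)
have xu z : z \in ps -> ed (f2 x) (f2 z) \notin c2.
  move=> zp; apply/negP=> h; have [_ _ _ n3] := E3.
  have : f2 z \in bad S f c x.
    rewrite inE f2S //= -feq //; apply: (n3 x) => //.
      by rewrite in_setD1 xq.
    by rewrite -feq // edl.
  by rewrite xb inE.
have [i [j [i3 j3 ij ni nj]]] : exists i j, [/\ i < 3, j < 3, i != j,
    ed (f2 w) (f2 (nth q [:: q; a; b] i)) \notin c2 &
    ed (f2 w) (f2 (nth q [:: q; a; b] j)) \notin c2].
  have ne : uniq [:: q; a; b].
    move: us qps; rewrite Ep /= !inE !negb_or.
    by case/and4P=> /and3P[-> _ _] _ _ _ /and4P[-> -> _ _].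
  have cm i j : i < 3 -> j < 3 -> i != j ->
      ed (f2 w) (f2 (nth q [:: q; a; b] i)) \in c2 ->
      ed (f2 w) (f2 (nth q [:: q; a; b] j)) \notin c2.
    move=> i3 j3 ij; rewrite ![ed (f2 w) _]edC => h; apply/negP=> h'.
    have := col2 _ _ (@mem_nth _ q [:: q; a; b] i i3) (@mem_nth _ q [:: q; a; b] j j3) h h'.
    by move/eqP; rewrite nth_uniq // (negbTE ij).
  case h0: (ed (f2 w) (f2 (nth q [:: q; a; b] 0)) \in c2).
    by exists 1, 2; split=> //; apply: (cm 0).
  case h1: (ed (f2 w) (f2 (nth q [:: q; a; b] 1)) \in c2).
    by exists 0, 2; split=> //; [rewrite h0|apply: (cm 1)].
  by exists 0, 1; split=> //; rewrite ?h0 ?h1.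
have nE m : m < 3 -> nth q (q :: ps) m = nth q [:: q; a; b] m.
  by rewrite E; case: m => [|[|[|]]].
have szm m : m < 3 -> m < size ps by move=> h; rewrite E; apply: leq_trans h _.
have xps : x \notin q :: ps.
  by rewrite inE negb_or xq; apply: contraL xS => /psS.
have PS2 : {subset q :: ps <= S2}.
  by move=> z; rewrite inE => /orP[/eqP->|/psS2//]; rewrite SS2.
have tneq z : z \in q :: ps -> f2 z != f2 x.
  move=> zp; apply: contraNneq xps => /(v_inj V2 (PS2 _ zp) (SS2 _ xS)) <-.
  exact: zp.
apply: (rotate_and_close (q0 := q) (ps := ps) (i := i) (j := j) (t := f2 x) V2); rewrite -?wE ?nE ?szm //.
- exact: SS2.
- by rewrite /= qps.
- by move=> z /psS; apply: contra; apply/subsetP/(v_R V).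
- move=> v; rewrite in_setU inE => /orP[vS|//] vR pv.
  by move: (kS v vS vR); rewrite pv.
- move=> p pY; have [h1 h2 _] := v_Y V pY.
  by split; [apply: contraL h1|apply: contraL h2] => /psS.
- by apply: xu; rewrite Ep mem_cat wp2 orbT.
- by apply: xu; rewrite mem_nth ?szm.
- by apply: xu; rewrite mem_nth ?szm.
move=> g r3 c3 m mij gE V3 tw cc3 new.
have m3 : m < 3 by case: mij => ->.
have us' : uniq (drop m ps) by apply: drop_uniq.
have gout z : z \notin ps -> g z = f2 z.
  move=> zp; case: gE => ->//; rewrite revf_out //.
  by apply: contra zp; apply: mem_drop.
have gin z : z \in ps -> exists2 z', z' \in ps & g z = f2 z'.
  case: gE => -> zp; first by exists z.
  case zd: (z \in drop m ps); last by exists z; rewrite ?revf_out ?zd.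
  by exists (mirror (drop m ps) z) => //; apply: (@mem_drop m); rewrite mirror_mem.
have gim : g @: S2 = f2 @: S2.
  case: gE => -> //; apply: revf_img => // z zd; apply: psS2; exact: mem_drop zd.
have gS z : z \in S -> g z = f z.
  move=> zS; rewrite gout ?feq //; by apply: contraL zS => /psS.
have bps z : z \in ps -> #|bad S2 f2 c2 z| <= 1.
  rewrite Ep mem_cat => /orP[z1|z2]; last by apply: b2; rewrite inE z2 orbT.
  case: (eqVneq z d) => [->|zd]; first by apply: b2; rewrite inE eqxx.
  apply: leq_trans (b1 z _); last by rewrite inE z1 orbT.
  by apply/subset_leq_card/(bad_ext E2); rewrite in_setD1 zd in_setU [z \in [set _ in _]]inE z1 orbT.
have new' (e : {set T}) z : e \in c3 -> z \in e ->
    e \in c2 \/ exists2 u, u \in x :: q :: ps & z = f2 u.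
  have up u : u \in q :: ps -> u \in x :: q :: ps by move=> h; rewrite inE h orbT.
  have wu : w \in x :: q :: ps by apply: up; rewrite inE wps orbT.
  have xu' : x \in x :: q :: ps by apply: mem_head.
  have hu : nth q ps m \in x :: q :: ps by apply: up; rewrite inE mem_nth ?szm ?orbT.
  case/new=> [h|[u uqp ->]|->|->]; first by left.
  - rewrite in_ed => /orP[]/eqP->; right; last by exists u => //; exact: up.
    by exists w; rewrite -?wE.
  - rewrite in_ed => /orP[]/eqP->; right; first by exists x.
    by exists w; rewrite -?wE.
  - rewrite in_ed => /orP[]/eqP->; right; first by exists x.
    by exists (nth q ps m).
have XS2 : {subset x :: q :: ps <= S2}.
  by move=> z; rewrite inE => /orP[/eqP->|/PS2//]; apply: SS2.
apply: (H g).
  apply: (good_inner I2 (Y' := (x, last q ps) :: Y) _ gim cc3).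
  - split; try by case: V3.
    move=> p; rewrite inE => /orP[/eqP->|]; last exact: (v_Y V3).
    rewrite -wE; split; [exact: SS2|exact: psS2|].
    by rewrite [_.1]/= [_.2]/= (gS x xS) -(feq x xS).
  - move=> z e zS ec ze; case: (new' e z ec ze) => // -[u /XS2 uS zE].
    by rewrite zE imset_f in zS.
  move=> u uS; case up: (u \in ps); last first.
    by exists u; [rewrite gout ?up|left].
  have [u' u'p gu] := gin u up; exists u' => //; right; split; last exact: bps.
  by apply: contraL up => /(subsetP (v_R V)) h; apply: contraL h => /psS.
have [i3' s3' e3' n3'] := E3; split.
- by rewrite gim.
- exact: subset_trans s3' cc3.
- by move=> z; rewrite !in_setD1 => /and3P[_ _ /gS].
move=> z e; rewrite !in_setD1 => /and3P[zx zq zS] ec fe.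
have zqS : z \in S :\ q by rewrite in_setD1 zq.
case: (new' e _ ec fe) => [h|[u uX zE]]; first exact: n3' zqS h fe.
have zu : z = u.
  by apply: (v_inj V2); [exact: SS2|exact: XS2|rewrite feq].
move: uX; rewrite -zu !inE (negbTE zx) (negbTE zq) /= => /psS.
by rewrite zS.
Qed.

Variables (top lab : T -> T) (pth : T -> seq T).
Hypothesis lab_par : forall v, v \notin R -> lab (par v) = lab v.

(** Members of [rs] have different labels, so no vertex embedded for one of them is a kid of the
    roots of another; by [fresh_bad] those roots are still clean when their turn comes. Each path
    costs its vertices plus two rounds. *)
Lemma close_all G k rs : forall S f r c Y,
  good S f r c Y -> uniq rs -> {in rs &, injective lab} ->
  {in rs, forall x, [/\ x \in R, top x \in R, top x != x,
     lab (top x) = lab x & path child (top x) (pth x)]} ->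
  {in rs, forall x, uniq (pth x) /\ 5 <= size (pth x)} ->
  {in rs, forall x z, z \in pth x -> lab z = lab x /\ z \notin S} ->
  (forall v, v \in S -> v \notin R -> lab v \notin map lab rs) ->
  size (flatten (map pth rs)) < #|~: S| -> l + 5 <= K ->
  (forall f' r' c' Y', good (S :|: [set z in flatten (map pth rs)]) f' r' c' Y' ->
     (forall W, W \subset S -> {in W, forall z, lab z \notin map lab rs} ->
        ext W S f c (S :|: [set z in flatten (map pth rs)]) f' c') ->
     (forall p, p \in Y' = (p \in Y) || (p \in [seq (x, last (top x) (pth x)) | x <- rs])) ->
     wf G k r' c') ->
  wf G (size (flatten (map pth rs)) + 2 * size rs + k) r c.
Proof.
elim: rs => [|x rs IH] S f r c Y I.
  move=> _ _ _ _ _ _ _ _ H; apply: (H f _ _ Y); rewrite ?set_nil ?setU0 //.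
  by move=> p; rewrite orbF.
move=> /= /andP[xrs urs] linj tP pP pS sS sz lK H.
have [xR tR tx lt pq] := tP x (mem_head _ _).
have [upx s5] := pP x (mem_head _ _).
have pxS := pS x (mem_head _ _).
have V := i_valid I; have RS := subsetP (v_R V).
have E : size (pth x ++ flatten (map pth rs)) + 2 * (size rs).+1 + k =
  size (pth x) + (size (flatten (map pth rs)) + 2 * size rs + k).+2.
  by rewrite size_cat; clear; lia.
rewrite E.
have fr u : u \in R -> lab u = lab x -> bad S f c u = set0.
  move=> uR lu; apply: (fresh_bad I) => // v vS vR.
  apply: contraNneq (sS v vS vR) => vu.
  by rewrite -lab_par // vu lu inE eqxx.
have fS := card_free_seq upx (fun z h => (pxS z h).2).
apply: (close_path I _ (fr _ tR lt) _ _ (fr x xR erefl) pq upx) => //.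
- exact: RS.
- exact: RS.
- by rewrite eq_sym.
- by move=> z /pxS[].
- move=> v vS vR; apply/negP=> /pxS[h _]; have := sS v vS vR.
  by rewrite -lab_par // h inE eqxx.
- by apply: leq_ltn_trans sz; rewrite size_cat leq_addr.
set S1 := S :|: _ => f1 r1 c1 I1 E1.
have ES1 s : S1 :|: [set z in s] = S :|: [set z in pth x ++ s].
  by rewrite set_seq_cat setUA.
have SS1 : S \subset S1 by apply: subsetUl.
apply: (IH S1 f1 r1 c1 _ I1) => //.
- by move=> a b ha hb; apply: linj; rewrite inE ?ha ?hb orbT.
- by move=> z h; apply: tP; rewrite inE h orbT.
- by move=> z h; apply: pP; rewrite inE h orbT.
- move=> y yrs z zp; have yx : y \in x :: rs by rewrite inE yrs orbT.
  have [lz zS] := pS y yx z zp; split=> //.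
  rewrite in_setU negb_or zS inE; apply/negP=> /pxS[lzx _].
  have := linj y x yx (mem_head _ _); rewrite -lz -lzx => /(_ erefl) yE.
  by move: xrs; rewrite -yE yrs.
- move=> v; rewrite in_setU inE => /orP[vS|/pxS[lv _]] vR.
    by have := sS v vS vR; rewrite inE negb_or => /andP[].
  apply/mapP=> -[y yrs]; rewrite lv => /linj h.
  by move: xrs; rewrite h ?yrs // inE ?eqxx ?yrs ?orbT.
- by move: sz; rewrite fS size_cat addnC ltn_add2r.
rewrite ES1 => f2 r2 c2 Y2 I2 E2 Y2E; apply: (H f2 r2 c2 Y2) => //.
- move=> W WS WL; apply: ext_trans (E2 W _ _).
  + apply: ext_sub E1; apply/subsetP=> z zW; rewrite !in_setD1 (subsetP WS) // andbT.
    have := WL z zW; rewrite inE negb_or => /andP[h _].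
    by apply/andP; split; apply: contraNneq h => ->; rewrite ?lt.
  + exact: subset_trans WS SS1.
  + by move=> z /WL; rewrite inE negb_or => /andP[].
- move=> p; rewrite Y2E !inE.
  by case: (p == _); rewrite ?orbT.
Qed.

Variables (D : nat) (dep : T -> nat).
Hypothesis dep_par : forall v, v \notin R -> dep (par v) < dep v.
Hypothesis kidsD : forall u, #|[set v | (v \notin R) && (par v == u)]| <= D.

Lemma bad_le S f r c Y u : good S f r c Y -> u \in S -> #|bad S f c u| <= D.+1.
Proof.
move=> I uS; apply: leq_trans (i_bad I uS) _; rewrite -addn1.
apply: leq_add; last exact: leq_b1.
apply: leq_trans (kidsD u); apply: subset_leq_card; apply/subsetP=> v.
by rewrite !inE => /andP[].
Qed.

Lemma greedy_fill G k m : forall (U : {set T}) S f r c Y,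
  #|U| = m -> good S f r c Y -> {in U, forall v, v \notin S} ->
  {in U, forall v, par v \in S :|: U} ->
  m + D + 3 <= #|~: S| -> D + l + 3 <= K ->
  (forall f' r' c', good (S :|: U) f' r' c' Y -> wf G k r' c') ->
  wf G (m + k) r c.
Proof.
elim: m => [|m IH] U S f r c Y Um I US pU sz DK H.
  move/eqP: Um; rewrite cards_eq0 => /eqP U0; apply: (H f).
  by rewrite U0 setU0.
have [v0 v0U] : exists v, v \in U by apply/card_gt0P; rewrite Um.
pose v := [arg min_(v < v0 in U) dep v].
have [vU vmin] : v \in U /\ forall u, u \in U -> dep v <= dep u.
  by rewrite /v; case: arg_minnP.
have V := i_valid I; have vS := US v vU.
have vR : v \notin R by apply: contra vS; apply/subsetP/(v_R V).
have pS : par v \in S.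
  have := pU v vU; rewrite in_setU => /orP[//|/vmin].
  by rewrite leqNgt dep_par.
have bD := bad_le I pS.
rewrite addSn.
apply: (step_avoid (X := bad S f c (par v)) I vS pS) => //.
- by move: bD sz; arith.
- by move: bD DK; arith.
move=> y y' r1 _ _ _ _ _ c1 I1.
have UvE : v |: S :|: (U :\ v) = S :|: U.
  apply/setP=> z; rewrite !inE; case: (eqVneq z v) => [->|] //=.
  by rewrite vU orbT.
apply: (IH (U :\ v) (v |: S) _ r1 c1 Y _ I1) => //.
- by move: Um; rewrite (cardsD1 v) vU add1n => -[].
- move=> z; rewrite in_setD1 => /andP[zv zU].
  by rewrite in_setU1 negb_or zv US.
- by move=> z; rewrite in_setD1 UvE => /andP[_ /pU].
- by move: sz; rewrite (card_free_step vS); arith.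
by rewrite UvE.
Qed.

(** * The endgame with exchangeable leaves *)

Definition leafy S :=
  (forall u v, v \notin S -> u \notin R -> par u != v) /\ {in ~: S &, injective par}.
(** Counts the pending leaves for which [a] is spoilt. The bound is inherited from the degree of
    [a], and later rounds preserve it as long as they are not played at parents of pending
    leaves. *)
Definition low_deg S f c :=
  forall a, #|[set v in ~: S | a \in bad S f c (par v)]| <= l.

Lemma leafy_sub S S' : S \subset S' -> leafy S -> leafy S'.
Proof.
move=> /subsetP SS [h1 h2]; split.
  by move=> u v vS; apply: h1; apply: contra vS; apply: SS.
move=> u v; rewrite !in_setC => uS vS; apply: h2; rewrite in_setC.
  by apply: contra uS; apply: SS.
by apply: contra vS; apply: SS.
Qed.

Lemma leafy_R S f r c Y v : valid S f r c Y -> v \notin S -> v \notin R.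
Proof. by move=> V; apply: contra; apply: (subsetP (v_R V)). Qed.

Lemma leafy_par S f r c Y v : valid S f r c Y -> leafy S -> v \notin S -> par v \in S.
Proof.
move=> V [h _] vS; apply/negPn/negP=> pS.
by have := h v (par v) pS (leafy_R V vS); rewrite eqxx.
Qed.

Lemma low_deg_ext S f c S' f' c' : S \subset S' ->
  ext (par @: (~: S')) S f c S' f' c' -> low_deg S f c -> low_deg S' f' c'.
Proof.
move=> SS E h a; apply: leq_trans (h a); apply: subset_leq_card.
apply/subsetP=> v; rewrite in_set => /andP[vS' ab]; rewrite in_set.
rewrite (subsetP _ _ vS') ?setCS //=.
by apply: (subsetP (bad_ext E _)) ab; apply: imset_f.
Qed.

Lemma setCU_sub S S' : S \subset S' -> {subset ~: S' <= ~: S}.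
Proof. by move=> h; apply/subsetP; rewrite setCS. Qed.

(** Parents of leaves are distinct, so placing one leaf colours nothing at the parents of the
    pending ones and their bad sets cannot grow. *)
Lemma leafy_img S f r c Y S' v : valid S f r c Y -> leafy S -> S \subset S' ->
  v \notin S -> v \in S' ->
  par @: (~: S') \subset S /\ par v \notin par @: (~: S').
Proof.
move=> V L SS vS vS'; split.
  apply/subsetP=> _ /imsetP[u uS ->].
  by apply: (leafy_par V L); rewrite -in_setC (setCU_sub SS).
apply/imsetP=> -[u uS /(proj2 L) E]; move: (uS).
by rewrite -E ?in_setC ?vS' // -in_setC (setCU_sub SS).
Qed.

Lemma play G k vs : forall S f r c Y,
  good S f r c Y -> leafy S -> uniq vs -> {in vs, forall v, v \notin S} ->
  {in vs, forall v, #|bad S f c (par v)| + size vs + 1 <= #|~: S|} ->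
  D + l + 3 <= K ->
  (forall f' r' c', let S' := S :|: [set v in vs] in
     good S' f' r' c' Y -> {in S, f' =1 f} ->
     (forall W, W \subset S -> {in vs, forall v, par v \notin W} ->
        ext W S f c S' f' c') ->
     wf G (#|~: S'| + k) r' c') -> wf G (#|~: S| + k) r c.
Proof.
elim: vs => [|v vs IH] S f r c Y I L.
  by move=> _ _ _ _; rewrite set_nil setU0 => H; apply: (H f r c I).
move=> /= /andP[vvs uvs] vS sz DK H; have V := i_valid I.
have v0 : v \notin S by rewrite vS ?mem_head.
have pS := leafy_par V L v0; have bD := bad_le I pS.
rewrite (card_free_step v0) addSn.
apply: (step_avoid (X := bad S f c (par v)) I v0 pS) => //.
- by move: (sz v (mem_head _ _)); rewrite /=; arith.
- by move: bD DK; arith.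
move=> y y' r1 yS y'S yy _ _ c1 I1.
have S1 : S \subset v |: S by apply: subsetUr.
have E1 W : W \subset S -> par v \notin W -> ext W S f c (v |: S) (upd f v y) c1.
  by move=> WS vW; apply: (ext_step V).
apply: (IH (v |: S) (upd f v y) r1 c1 Y I1 (leafy_sub S1 L) uvs) => //.
- move=> u uvs'; rewrite in_setU1 negb_or vS ?inE ?uvs' ?orbT // andbT.
  by apply: contraNneq vvs => <-.
- move=> u uvs'; have uS : u \notin S by rewrite vS // inE uvs' orbT.
  have pu : par v \notin [set par u].
    rewrite in_set1; apply: contraNneq vvs => /(proj2 L) ->; rewrite ?in_setC //.
  have := bad_ext (E1 [set par u] _ pu) (set11 _).
  rewrite sub1set (leafy_par V L uS) => /(_ isT).
  move/subset_leq_card => h; have := sz u; rewrite inE uvs' orbT => /(_ isT).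
  rewrite (card_free_step v0) !addn1 ltnS addnS; apply: leq_trans.
  by rewrite ltnS leq_add2r.
have -> : v |: S :|: [set x in vs] = S :|: [set x in v :: vs].
  by rewrite set_cons setUCA setUA.
move=> f2 r2 c2 S2 I2 e2 E2; apply: (H f2 r2 c2) => //.
  by move=> z zS; rewrite e2 ?in_setU1 ?zS ?orbT // (upd_in _ _ v0).
move=> W WS hW; apply: ext_trans (E1 W WS _) (E2 W _ _).
- exact: hW (mem_head _ _).
- exact: subset_trans WS S1.
- by move=> z zvs; apply: hW; rewrite inE zvs orbT.
Qed.

(* Low degrees leave, for any two vertices of [W], a leaf to which both can be offered. *)
Lemma use_up G k (W B : {set T}) m : forall S f r c Y,
  good S f r c Y -> leafy S -> low_deg S f c -> #|W :\: f @: S| <= m ->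
  B \subset ~: S -> 2 * l + m < #|~: S :\: B| -> #|~: S| < K ->
  (forall S' f' r' c', S \subset S' -> good S' f' r' c' Y ->
     ext (par @: (~: S')) S f c S' f' c' -> #|W :\: f' @: S'| <= 1 ->
     B \subset ~: S' -> wf G (#|~: S'| + k) r' c') -> wf G (#|~: S| + k) r c.
Proof.
elim: m => [|m IH] S f r c Y I L LD Wm BS sz SK H.
  by apply: (H S f) => //; apply: leq_trans Wm _.
case: (leqP #|W :\: f @: S| 1) => W1.
  by apply: (H S f).
have V := i_valid I.
have [y1 [y2 []]] := pick2 W1.
rewrite !in_setD => /andP[y1S y1W] /andP[y2S y2W] y12.
pose bd y := [set v in ~: S | y \in bad S f c (par v)].
have [v] : exists v, v \in (~: S :\: B) :\: (bd y1 :|: bd y2).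
  apply/card_gt0P; rewrite cardsD.
  have h1 : #|bd y1 :|: bd y2| <= l + l.
    by rewrite cardsU; have := LD y1; have := LD y2; rewrite -/(bd y1) -/(bd y2); arith.
  have h2 : #|(~: S :\: B) :&: (bd y1 :|: bd y2)| <= #|bd y1 :|: bd y2|.
    by rewrite subset_leq_card ?subsetIr.
  by move: h1 h2 sz; arith.
rewrite !in_setD in_setU negb_or !in_set => /andP[/andP[v1 v2] /andP[vB v0]].
rewrite v0 /= in v1 v2.
have pS := leafy_par V L v0.
rewrite (card_free_step v0) addSn.
apply: (step_pair I v0 pS y1S y2S y12) => //; rewrite ?inE //.
  by rewrite leqNgt SK.
move=> y y' r1 yy c1 I1.
have yS : y \notin f @: S by case: yy => -[-> _].
have y'S : y' \notin f @: S by case: yy => -[_ ->].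
have yW : y \in W by case: yy => -[-> _].
have S1 : S \subset v |: S by apply: subsetUr.
have E1 W' : W' \subset S -> par v \notin W' -> ext W' S f c (v |: S) (upd f v y) c1.
  by move=> WS vW; apply: (ext_step V).
have pP S' : v |: S \subset S' -> par @: (~: S') \subset S /\ par v \notin par @: (~: S').
  move=> SS'; apply: (leafy_img V L _ v0); first exact: subset_trans SS'.
  by rewrite (subsetP SS') // setU11.
have [p1 p2] := pP _ (subxx (v |: S)).
apply: (IH (v |: S) (upd f v y) r1 c1 Y I1 (leafy_sub S1 L)).
- exact: low_deg_ext S1 (E1 _ p1 p2) LD.
- rewrite img_upd //.
  have -> : W :\: (y |: f @: S) = (W :\: f @: S) :\ y.
    by apply/setP=> z; rewrite !in_setD !in_setU1 negb_or in_set1 andbA.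
  by move: Wm; rewrite (cardsD1 y) in_setD yS yW add1n ltnS.
- apply/subsetP=> z zB; rewrite in_setC in_setU1 negb_or.
  have := subsetP BS z zB; rewrite in_setC => ->; rewrite andbT.
  by apply: contraNneq vB => <-.
- have -> : ~: (v |: S) :\: B = (~: S :\: B) :\ v.
    apply/setP=> z; rewrite !in_setD !in_setC in_setU1 negb_or in_set1.
    by case: (z \in B); rewrite ?andbF.
  move: sz; rewrite (cardsD1 v (~: S :\: B)) in_setD in_setC vB v0 /=; arith.
- by move: SK; rewrite (card_free_step v0); arith.
move=> S' f' r' c' SS' I' E' W1' BS'; apply: (H S' f') => //.
  exact: subset_trans SS'.
by have [q1 q2] := pP _ SS'; apply: ext_trans (E1 _ q1 q2) E'.
Qed.

Lemma play_avoid G k S f r c Y v (X : {set T}) :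
  good S f r c Y -> leafy S -> v \notin S -> bad S f c (par v) = set0 ->
  #|X| + 2 <= #|~: S| -> #|X| + l + 2 <= K ->
  (forall f' r' c', good (v |: S) f' r' c' Y ->
     ext (S :\ par v) S f c (v |: S) f' c' -> {in S, f' =1 f} ->
     #|bad (v |: S) f' c' (par v)| <= 1 ->
     {in X, forall a, a \notin bad (v |: S) f' c' (par v)} -> wf G k r' c') ->
  wf G k.+1 r c.
Proof.
move=> I L vS b0 sX XK H; have V := i_valid I; have pS := leafy_par V L vS.
apply: (step_avoid (X := X) I vS pS) => //; first by rewrite b0 sub0set.
move=> y y' r1 yS y'S yy yX y'X c1 I1.
have := @bad_par _ par S f c v y y' vS pS; rewrite b0 setU0 => bp.
apply: H I1 _ _ _ _.
- by apply: (ext_step V) => //; rewrite ?subsetDl // in_setD1 eqxx.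
- exact: upd_in.
- by have := subset_leq_card bp; rewrite cards1.
move=> a aX; apply/negP=> /(subsetP bp)/set1P E.
by move: y'X; rewrite -E aX.
Qed.

Lemma valid_upd_last S f r c Y v y r' c' : valid S f r c Y -> par v \in S ->
  v \notin S -> y \notin f @: S -> v |: S = setT -> r \subset r' -> r' \subset c' ->
  ed y (f (par v)) \in r' -> valid setT (upd f v y) r' c' Y.
Proof.
move=> V pS vS yS vT rr rc yr.
have inS := upd_in f y vS.
have all x : (x == v) || (x \in S) by have := in_setT x; rewrite -vT in_setU1.
have fi a : a \in S -> f a != y by apply: contraTneq => h; apply: contra yS => aS; rewrite -h imset_f.
split=> //.
- move=> a b _ _; case/orP: (all a) => [/eqP->|aS]; case/orP: (all b) => [/eqP->|bS] //.
  + by rewrite upd_same inS // => h; move: (fi b bS); rewrite h eqxx.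
  + by rewrite upd_same inS // => h; move: (fi a aS); rewrite h eqxx.
  + by rewrite !inS //; apply: (v_inj V).
- by move=> x xR; rewrite inS ?(v_phi V) //; apply: (subsetP (v_R V)).
- move=> u _ uR; rewrite in_setT; split=> //; case/orP: (all u) => [/eqP->|uS].
    by rewrite upd_same inS.
  by have [h1 h2] := v_par V uS uR; rewrite !inS // (subsetP rr).
- by move=> p /(v_Y V)[h1 h2 h3]; rewrite !in_setT !inS // (subsetP rr).
move=> a b; rewrite -vT img_upd // => h.
move: h; rewrite in_setU1 negb_or => /andP[ay aS] _.
have : 1 < #|~: (f @: S)| by apply/card_gt1P; exists a, y; rewrite !in_setC aS yS.
by rewrite (card_free V) (card_free_step vS) vT setCT cards0.
Qed.

(* A childless [w] may hand over its image to [v], provided [par v] is joined to it. *)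
Lemma valid_swap S f r c Y v w : valid S f r c Y -> v \notin S -> w \in S ->
  w \notin R -> v \notin R -> (forall u, u \notin R -> par u != w) ->
  par v \in S -> (forall p, p \in Y -> p.1 != w /\ p.2 != w) ->
  ed (f w) (f (par v)) \in r ->
  valid (v |: (S :\ w)) (upd f v (f w)) r c Y /\
  upd f v (f w) @: (v |: (S :\ w)) = f @: S.
Proof.
move=> V vS wS wR vR wk pS wY er.
have vSw : v \notin S :\ w by rewrite in_setD1 (negbTE vS) andbF.
have im : upd f v (f w) @: (v |: (S :\ w)) = f @: S.
  by rewrite img_upd // -imsetU1 setD1K.
have inS := upd_in f (f w) vSw.
have inj a : a \in S :\ w -> f a != f w.
  by rewrite in_setD1 => /andP[aw aS]; apply: contra aw => /eqP/(v_inj V aS wS)->.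
split=> //; split.
- apply/subsetP=> x xR; rewrite in_setU1 in_setD1 (subsetP (v_R V) _ xR) andbT.
  by rewrite (contraTneq _ xR) ?orbT // => ->.
- move=> a b; rewrite !in_setU1 => /orP[/eqP->|aS] /orP[/eqP->|bS] //.
  + by rewrite upd_same inS // => h; have := inj b bS; rewrite h eqxx.
  + by rewrite upd_same inS // => h; have := inj a aS; rewrite h eqxx.
  + rewrite !inS //; move: aS bS; rewrite !in_setD1 => /andP[_ aS] /andP[_ bS].
    exact: (v_inj V).
- move=> x xR; rewrite inS ?(v_phi V) // in_setD1 (subsetP (v_R V) _ xR) andbT.
  by apply: contraTneq xR => ->.
- have pw u : u \notin R -> par u \in S -> par u \in S :\ w.
    by move=> uR h; rewrite in_setD1 wk.
  move=> a; rewrite !in_setU1 => /orP[/eqP->|aS] aR.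
    by rewrite pw // orbT upd_same inS ?pw.
  have aS' : a \in S by move: aS; rewrite in_setD1 => /andP[].
  by have [h1 h2] := v_par V aS' aR; rewrite pw // orbT !inS ?pw.
- move=> p pY; have [h1 h2 h3] := v_Y V pY; have [n1 n2] := wY p pY.
  by rewrite !in_setU1 !inS !in_setD1 ?n1 ?n2 ?h1 ?h2 ?orbT.
- exact: v_rc V.
- by rewrite im; apply: v_A V.
Qed.

Lemma clean_endgame G S f r c Y :
  good S f r c Y -> leafy S -> #|~: S| = 6 ->
  (forall v, v \notin S -> bad S f c (par v) = set0) -> D + l + 6 <= K ->
  (forall f' r' c', valid setT f' r' c' Y -> G r' c') -> wf G 7 r c.
Proof.
move=> I L S6 cl lK H; have V := i_valid I.
have sE : enum (~: S) =i ~: S by move=> z; rewrite mem_enum.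
have us := enum_uniq (~: S); have szE : size (enum (~: S)) = 6 by rewrite -cardE.
move: (enum (~: S)) sE us szE.
case=> [|v0 [|v1 [|v2 [|v3 [|v4 [|v5 [|? ?]]]]]]] // sE us _.
have vS v : v \in [:: v0; v1; v2; v3; v4; v5] -> v \notin S by rewrite sE in_setC.
have pinj u v : u \in [:: v0; v1; v2; v3; v4; v5] ->
    v \in [:: v0; v1; v2; v3; v4; v5] -> u != v -> par u != par v.
  by move=> uv vv; apply: contra => /eqP/(proj2 L)->; rewrite ?in_setC ?vS.
have pS v : v \in [:: v0; v1; v2; v3; v4; v5] -> par v \in S.
  by move/vS/(leafy_par V L).
have [i0 i1 i2 [i3 i4 i5]] : [/\ v0 \in [:: v0; v1; v2; v3; v4; v5],
   v1 \in [:: v0; v1; v2; v3; v4; v5], v2 \in [:: v0; v1; v2; v3; v4; v5] &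
   [/\ v3 \in [:: v0; v1; v2; v3; v4; v5], v4 \in [:: v0; v1; v2; v3; v4; v5] &
       v5 \in [:: v0; v1; v2; v3; v4; v5]]].
  by rewrite !inE !eqxx !orbT.
have [[n01 n02 n03] [n12 n13 n23] [[n14 n15 n24] [n25 n34 n35] [n04 n05 n45]]] :
  [/\ [/\ v0 != v1, v0 != v2 & v0 != v3], [/\ v1 != v2, v1 != v3 & v2 != v3] &
   [/\ [/\ v1 != v4, v1 != v5 & v2 != v4], [/\ v2 != v5, v3 != v4 & v3 != v5] &
       [/\ v0 != v4, v0 != v5 & v4 != v5]]].
  move: us; rewrite /= !inE !negb_or.
  by case/and5P=> /and5P[-> -> -> -> ->] /and4P[-> -> -> ->] /and3P[-> -> ->]
    /andP[-> ->] /andP[-> _].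
set vv := [:: v0; v1; v2; v3; v4; v5] in vS pinj pS i0 i1 i2 i3 i4 i5 sE us.
clearbody vv.
have neq u v : u \in vv -> v \in vv -> u != v -> par u \in S :\ par v.
  by move=> uv vv' uv'; rewrite in_setD1 pinj //= pS.
have S0 := card_free_step (vS v1 i1).
apply: (play_avoid (v := v1) (X := set0) I L (vS _ i1) (cl _ (vS _ i1))).
- by rewrite cards0 S6.
- by rewrite cards0; move: lK; clear; lia.
set S1 := v1 |: S; move=> f1 r1 c1 I1 E1 e1 b1 _.
have SS1 : S \subset S1 by apply: subsetUr.
have L1 := leafy_sub SS1 L.
have cl1 u : u \in vv -> u != v1 -> bad S1 f1 c1 (par u) = set0.
  move=> uv un; apply/eqP; rewrite -subset0 -(cl u (vS u uv)).
  by apply: bad_ext E1 _; apply: neq.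
have v2S1 : v2 \notin S1 by rewrite in_setU1 negb_or eq_sym n12 vS.
have S1c : #|~: S1| = 5 by move: S0; rewrite S6 => -[].
apply: (play_avoid (v := v2) (X := bad S1 f1 c1 (par v1)) I1 L1 v2S1).
- by apply: cl1 => //; rewrite eq_sym.
- by rewrite S1c; move: b1; arith.
- by move: lK b1; arith.
set S2 := v2 |: S1; move=> f2 r2 c2 I2 E2 e2 b2 d2.
have SS2 : S1 \subset S2 by apply: subsetUr.
have L2 := leafy_sub SS2 L1.
have S1in u : u \in S -> u \in S1 by apply: (subsetP SS1).
have neq2 u : u \in vv -> u != v2 -> par u \in S1 :\ par v2.
  by move=> uv un; rewrite in_setD1 pinj //= S1in // pS.
have cl2 u : u \in vv -> u != v1 -> u != v2 -> bad S2 f2 c2 (par u) = set0.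
  move=> uv un un2; apply/eqP; rewrite -subset0 -(cl1 u uv un).
  by apply: bad_ext E2 _; apply: neq2.
have v3S2 : v3 \notin S2.
  by rewrite in_setU1 in_setU1 !negb_or eq_sym n23 eq_sym n13 vS.
have S2c : #|~: S2| = 4 by have := card_free_step v2S1; rewrite S1c => -[].
have b12 : bad S2 f2 c2 (par v1) \subset bad S1 f1 c1 (par v1).
  by apply: bad_ext E2 _; apply: neq2.
have b1' : #|bad S2 f2 c2 (par v1)| <= 1 by apply: leq_trans (subset_leq_card b12) b1.
apply: (play_avoid (v := v3)
  (X := bad S2 f2 c2 (par v1) :|: bad S2 f2 c2 (par v2)) I2 L2 v3S2).
- by apply: cl2 => //; rewrite eq_sym.
- by rewrite S2c cardsU; move: b1' b2; arith.
- by rewrite cardsU; move: lK b1' b2; arith.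
set S3 := v3 |: S2; move=> f3 r3 c3 I3 E3 e3 b3 d3.
have SS3 : S2 \subset S3 by apply: subsetUr.
have L3 := leafy_sub SS3 L2.
have S2in u : u \in S -> u \in S2 by move/S1in; apply: (subsetP SS2).
have neq3 u : u \in vv -> u != v3 -> par u \in S2 :\ par v3.
  by move=> uv un; rewrite in_setD1 pinj //= S2in // pS.
have cl3 u : u \in vv -> u != v1 -> u != v2 -> u != v3 ->
    bad S3 f3 c3 (par u) = set0.
  move=> uv un un2 un3; apply/eqP; rewrite -subset0 -(cl2 u uv un un2).
  by apply: bad_ext E3 _; apply: neq3.
have S3c : #|~: S3| = 3 by have := card_free_step v3S2; rewrite S2c => -[].
have v45 u : u \in [:: v4; v5] -> [/\ u \in vv, u != v1, u != v2 & u != v3].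
  rewrite !inE => /orP[]/eqP->.
    by rewrite i4 (eq_sym v4) n14 (eq_sym v4) n24 (eq_sym v4) n34.
  by rewrite i5 (eq_sym v5) n15 (eq_sym v5) n25 (eq_sym v5) n35.
rewrite (_ : 4 = #|~: S3| + 1); last by rewrite S3c.
apply: (play (vs := [:: v4; v5]) I3 L3) => //.
- by rewrite /= inE n45.
- move=> u /v45[uv u1 u2 u3]; rewrite /S3 /S2 /S1 !inE !negb_or u1 u2 u3; exact: vS.
- by move=> u /v45[uv u1 u2 u3]; rewrite cl3 // cards0 S3c.
- by move: lK; clear; lia.
move=> f4 r4 c4 S4 I4 e4 E4.
have V4 := i_valid I4.
have SS4 : S3 \subset S4 by apply: subsetUl.
have S3in u : u \in S -> u \in S3 by move/S2in; apply: (subsetP SS3).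
have neq4 u : u \in vv -> u != v4 -> u != v5 ->
    ext [set par u] S3 f3 c3 S4 f4 c4.
  move=> uv u4 u5; apply: E4; first by rewrite sub1set S3in ?pS.
  move=> z; rewrite !inE => /orP[]/eqP->; rewrite eq_sym; exact: pinj.
have v0S4 : v0 \notin S4.
  by rewrite /S4 /S3 /S2 /S1 !inE !negb_or n01 n02 n03 n04 n05 (vS _ i0).
have S4c : #|~: S4| = 1.
  have u45 : uniq [:: v4; v5] by rewrite /= inE n45.
  have h u : u \in [:: v4; v5] -> u \notin S3.
    by move=> /v45[uv u1 u2 u3]; rewrite /S3 /S2 /S1 !inE !negb_or u1 u2 u3; exact: vS.
  by have := card_free_seq u45 h; rewrite S3c addn2 => -[].
rewrite S4c.
have /cards1P[a aE] : #|~: (f4 @: S4)| == 1 by rewrite (card_free V4) S4c.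
have aS4 : a \notin f4 @: S4 by rewrite -in_setC aE set11.
have fE u : u \in S -> f4 u = f u.
  by move=> uS; rewrite e4 ?S3in // e3 ?S2in // e2 ?S1in // e1.
have SS04 : S \subset S4.
  exact: subset_trans SS1 (subset_trans SS2 (subset_trans SS3 SS4)).
have E04 : ext [set par v0] S f c S4 f4 c4.
  apply: ext_trans (ext_sub _ E1) _; first by rewrite sub1set neq.
  apply: ext_trans (ext_sub _ E2) _; first by rewrite sub1set neq2.
  apply: ext_trans (ext_sub _ E3) _; first by rewrite sub1set neq3.
  exact: neq4.
have p0b z : z \notin f @: S -> ed (f4 (par v0)) z \notin c4.
  move=> zS; apply/negP=> h; have [_ _ _ n0] := E04.
  have : z \in bad S f c (par v0).
    rewrite inE zS -fE ?pS //; apply: (n0 (par v0)); rewrite ?set11 //.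
    by rewrite -fE ?pS // edl.
  by rewrite cl ?vS // inE.
have img04 : f @: S \subset f4 @: S4 by case: E04.
have b4 u : u \in vv -> u != v4 -> u != v5 ->
    bad S4 f4 c4 (par u) \subset bad S3 f3 c3 (par u).
  by move=> uv u4 u5; apply: bad_ext (neq4 u uv u4 u5) (set11 _).
have b3' u : u \in vv -> u != v3 -> bad S3 f3 c3 (par u) \subset bad S2 f2 c2 (par u).
  by move=> uv u3; apply: bad_ext E3 _; apply: neq3.
(* The three bad sets are disjoint, so [a] lies in at most one of them. *)
suff main vi vj : vi \in [:: v1; v2; v3] -> vj \in [:: v1; v2; v3] -> vi != vj ->
    a \notin bad S4 f4 c4 (par vi) -> a \notin bad S4 f4 c4 (par vj) ->
    wf G 2 r4 c4.
  have t1 : v1 \in [:: v1; v2; v3] by rewrite !inE eqxx.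
  have t2 : v2 \in [:: v1; v2; v3] by rewrite !inE eqxx orbT.
  have t3 : v3 \in [:: v1; v2; v3] by rewrite !inE eqxx !orbT.
  case h3: (a \in bad S4 f4 c4 (par v3)).
    have h3' := subsetP (b4 _ i3 n34 n35) _ h3.
    apply: (main v1 v2) => //; apply/negP=> h.
      have h' := subsetP (b3' _ i1 n13) _ (subsetP (b4 _ i1 n14 n15) _ h).
      by have := d3 a; rewrite in_setU h' h3' => /(_ isT).
    have h' := subsetP (b3' _ i2 n23) _ (subsetP (b4 _ i2 n24 n25) _ h).
    by have := d3 a; rewrite in_setU h' orbT h3' => /(_ isT).
  case h2: (a \in bad S4 f4 c4 (par v2)).
    have h2' := subsetP (b3' _ i2 n23) _ (subsetP (b4 _ i2 n24 n25) _ h2).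
    apply: (main v1 v3) => //; rewrite ?h3 //; apply/negP=> h.
    have h' := subsetP (b3' _ i1 n13) _ (subsetP (b4 _ i1 n14 n15) _ h).
    by have := d2 a (subsetP b12 _ h'); rewrite h2'.
  by apply: (main v2 v3) => //; rewrite ?h2 ?h3.
move=> ti tj ij ai aj.
have tt u : u \in [:: v1; v2; v3] -> [/\ u \in vv, u \in S4, v0 != u & u \notin S].
  have s1 : v1 \in S4 by rewrite /S4 /S3 /S2 /S1 !inE eqxx ?orbT.
  have s2 : v2 \in S4 by rewrite /S4 /S3 /S2 !inE eqxx ?orbT.
  have s3 : v3 \in S4 by rewrite /S4 /S3 !inE eqxx ?orbT.
  move=> ut; have : [|| u == v1, u == v2 | u == v3] by move: ut; rewrite !inE.
  by case/or3P=> /eqP->; split=> //; apply: vS.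
have f4S u : u \in [:: v1; v2; v3] -> f4 u \notin f @: S.
  move=> /tt[uv uS4 _ uS]; apply/imsetP=> -[z zS]; rewrite -fE // => h.
  have := v_inj V4 uS4 (subsetP SS04 z zS) h => E; by rewrite E zS in uS.
have p04 : par v0 \in S4 by apply: (subsetP SS04); apply: pS.
pose ei := ed (f4 (par v0)) (f4 vi); pose ej := ed (f4 (par v0)) (f4 vj).
have [iv iS4 _ iS] := tt _ ti; have [jv jS4 _ jS] := tt _ tj.
have fp u : u \in [:: v1; v2; v3] -> f4 (par v0) != f4 u.
  move=> /tt[_ uS4 _ uS]; apply: contraNneq uS => /(v_inj V4 p04 uS4) <-; exact: pS.
have nij : ei != ej by apply/eqP=> /ed_inj/(v_inj V4 iS4 jS4)/eqP; rewrite (negbTE ij).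
pose c5 := [set ei; ej] :|: c4.
suff fin vm e : vm \in [:: v1; v2; v3] -> e = ed (f4 (par v0)) (f4 vm) ->
    e \in [set ei; ej] -> a \notin bad S4 f4 c4 (par vm) -> wf G 1 (e |: r4) c5.
  apply: (@wf_offer n G 1 r4 c4 ei ej) => //.
  - by rewrite Kn_ed fp.
  - by rewrite Kn_ed fp.
  - by apply: p0b; apply: f4S.
  - by apply: p0b; apply: f4S.
  - by apply: (fin vi) => //; rewrite !inE eqxx.
  - by apply: (fin vj) => //; rewrite !inE eqxx orbT.
move=> tm Ee eij am; have [mv mS4 n0m mS] := tt _ tm.
have pm4 : par vm \in S4 by apply: (subsetP SS04); apply: pS.
pose a1 := ed a (f4 (par v0)); pose a2 := ed a (f4 (par vm)).
have ac5 z : ed a z \notin c4 -> ed a z \notin c5.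
  move=> h; rewrite in_setU in_set2 negb_or h andbT; apply/norP.
  have ae u : u \in S4 -> ed a z != ed (f4 (par v0)) (f4 u).
    move=> uS4; apply/eqP=> E; have := edl a z; rewrite E in_ed.
    by case/orP=> /eqP E'; move: aS4; rewrite E' imset_f.
  by rewrite !ae.
have a1c : a1 \notin c5.
  by apply: ac5; rewrite edC p0b //; apply: contra aS4; apply: (subsetP img04).
have a2c : a2 \notin c5 by apply: ac5; move: am; rewrite inE aS4 edC.
have a12 : a1 != a2.
  apply/eqP=> /ed_inj/(v_inj V4 p04 pm4)/eqP; apply/negP; exact: pinj.
have af u : u \in S4 -> a != f4 u by move=> uS; apply: contraNneq aS4 => ->; apply: imset_f.
have vT : v0 |: S4 = setT.
  apply/eqP; rewrite eqEsubset subsetT /=; apply/subsetP=> z _.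
  have /cards1P[z0 zE] : #|~: S4| == 1 by rewrite S4c.
  have : v0 \in ~: S4 by rewrite in_setC.
  rewrite zE => /set1P v0E; rewrite in_setU1; case zS: (z \in S4); rewrite ?orbT //.
  have : z \in ~: S4 by rewrite in_setC zS.
  by rewrite zE v0E => /set1P->; rewrite eqxx.
pose c6 := [set a1; a2] :|: c5.
have rc5 : e |: r4 \subset c5.
  rewrite subUset sub1set in_setU eij /=; apply: subset_trans (v_rc V4) _.
  exact: subsetUr.
have rc6 b : b \in [set a1; a2] -> b |: (e |: r4) \subset c6.
  by move=> h; rewrite subUset sub1set in_setU h /= (subset_trans rc5) // subsetUr.
apply: (@wf_offer n G 0 _ c5 a1 a2) => //.
- by rewrite Kn_ed af.
- by rewrite Kn_ed af.
- apply: (H (upd f4 v0 a)); apply: (valid_upd_last V4 p04 v0S4 aS4 vT).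
  + by rewrite setUA subsetUr.
  + by apply: rc6; rewrite !inE eqxx.
  + exact: setU11.
have V5 : valid S4 f4 (e |: r4) c5 Y.
  apply: valid_add V4 _ rc5 _; first exact: subsetUr.
  move=> e'; rewrite in_setU => /orP[|h]; last by left.
  by rewrite !inE => /orP[]/eqP->; right; exists (par v0); rewrite ?edl.
have mR : vm \notin R by apply: leafy_R V mS.
have v0R : v0 \notin R by apply: leafy_R V4 v0S4.
have [V6 im6] : valid (v0 |: (S4 :\ vm)) (upd f4 v0 (f4 vm)) (e |: r4) c5 Y /\
   upd f4 v0 (f4 vm) @: (v0 |: (S4 :\ vm)) = f4 @: S4.
  apply: (valid_swap V5 v0S4 mS4 mR v0R) => //.
  - by move=> u uR; apply: (proj1 L).
  - move=> p pY; have [h1 h2 _] := v_Y V pY.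
    by split; apply: contraNneq mS => <-.
  - by rewrite edC -Ee setU11.
have m6 : vm \notin v0 |: (S4 :\ vm).
  by rewrite in_setU1 in_setD1 eqxx /= orbF eq_sym.
have L6 : leafy (v0 |: (S4 :\ vm)).
  have h z : z \notin v0 |: (S4 :\ vm) -> z = vm.
    rewrite in_setU1 in_setD1 negb_or => /andP[z0]; apply: contraNeq => ->.
    by have := in_setT z; rewrite -vT in_setU1 (negbTE z0).
  split=> [u v /h-> uR|u v]; first exact: (proj1 L).
  by rewrite !in_setC => /h -> /h ->.
apply: (H (upd (upd f4 v0 (f4 vm)) vm a)).
apply: (valid_upd_last V6 (leafy_par V6 L6 m6) m6).
- by rewrite im6.
- rewrite setUCA setD1K //.
- exact: subsetUr.
- by apply: rc6; rewrite !inE eqxx orbT.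
rewrite updE ?setU11 //; apply: contraNneq v0S4 => <-; exact: pm4.
Qed.

Lemma card_bigcup_le (I J : finType) (P : {set I}) (F : I -> {set J}) m :
  {in P, forall i, #|F i| <= m} -> #|\bigcup_(i in P) F i| <= #|P| * m.
Proof.
move=> h; rewrite -sum_nat_const.
apply: leq_trans (_ : \sum_(i in P) #|F i| <= _); last exact: leq_sum.
elim/big_rec2: _ => [|i a A iP IH]; first by rewrite cards0.
by apply: leq_trans (leq_add (leqnn _) IH); rewrite cardsU leq_subr.
Qed.

Lemma half_low S f r c Y : good S f r c Y -> low_deg S f c ->
  #|~: S| <= 2 * #|[set v in ~: S | #|bad S f c (par v)| <= 2 * l]|.
Proof.
move=> I LD; set L := [set v in _ | _].
have h1 : \sum_(v in ~: S) #|bad S f c (par v)| <= #|~: S| * l.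
  rewrite (eq_bigr (fun v => \sum_(a in ~: (f @: S)) (a \in bad S f c (par v)))).
    rewrite exchange_big /= -(card_free I) -sum_nat_const; apply: leq_sum => a _.
    apply: leq_trans (LD a); apply: eq_leq; rewrite -sum1_card.
    rewrite [LHS]big_mkcond [RHS]big_mkcond; apply: eq_bigr => v _.
    by rewrite in_set; case: (v \in ~: S) => //=; case: (a \in _).
  move=> v _; rewrite -sum1_card big_mkcond [RHS]big_mkcond; apply: eq_bigr => a _.
  by rewrite !inE; case: (a \in f @: S).
have h2 : #|~: S :\: L| * (2 * l).+1 <= #|~: S| * l.
  apply: leq_trans h1; rewrite -sum_nat_const [X in _ <= X](bigID (mem L)) /=.
  apply: leq_trans (leq_addl _ _); rewrite (eq_bigl (fun v => (v \in ~: S) && (v \notin L))).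
    apply: leq_sum => v; rewrite [v \in L]in_set => /andP[-> /=].
    by rewrite -ltnNge.
  by move=> v; rewrite in_setD andbC.
have h3 : #|~: S| = #|L| + #|~: S :\: L|.
  rewrite -(cardsID L) (setIidPr _) //.
  by apply/subsetP=> v; rewrite in_set => /andP[].
rewrite h3 in h2 *; move: h2; clear.
move: #|L| #|~: S :\: L| => a b h; rewrite mul2n -addnn leq_add2l.
rewrite leqNgt; apply/negP=> ab.
have : b * (2 * l).+1 <= (b + b) * l.
  by apply: leq_trans h _; rewrite leq_mul2r leq_add2r ltnW ?orbT.
by rewrite mulnS mulnDl mul2n -addnn mulnDr; move: ab; clear; move: (b * l); lia.
Qed.

Lemma take_sup (A B : {set T}) m : A \subset B -> #|A| <= m <= #|B| ->
  exists s, [/\ uniq s, size s = m, {subset A <= s} & {subset s <= B}].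
Proof.
move=> AB /andP[Am mB]; exists (take m (enum A ++ enum (B :\: A))); split.
- apply: take_uniq; rewrite cat_uniq !enum_uniq andbT /=.
  by apply/hasPn=> x; rewrite !mem_enum in_setD => /andP[].
- rewrite size_takel // size_cat -!cardE cardsD (setIidPr AB).
  by rewrite subnKC // subset_leq_card.
- move=> x xA; rewrite take_cat -cardE.
  case: ltnP => h; last by rewrite mem_cat mem_enum xA.
  by move: h; rewrite ltnNge Am.
move=> x /mem_take; rewrite mem_cat !mem_enum in_setD => /orP[/(subsetP AB)|/andP[]] //.
Qed.

Lemma leaf_endgame G S f r c Y :
  good S f r c Y -> leafy S -> low_deg S f c -> #|~: S| < K ->
  D + l + 6 <= K -> 2 * (D + 2) <= #|~: S| ->
  2 * ((2 * l).+1 * (2 * l + 6) + 2 * l + 1) <= #|~: S| ->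
  (forall f' r' c', valid setT f' r' c' Y -> G r' c') ->
  wf G (#|~: S| + 1) r c.
Proof.
move=> I L LD SK DK s1 s2 H; have V := i_valid I.
set Lw := [set v in ~: S | #|bad S f c (par v)| <= 2 * l].
have LwS : Lw \subset ~: S by apply/subsetP=> v; rewrite in_set => /andP[].
have hL := half_low I LD; rewrite -/Lw in hL.
(* The size of [P]: six leaves for [clean_endgame], and [2 * l] to cover those whose parents are not
   clean. It also exceeds the bad sets, of size at most [2 * l], met when the leaves outside [P] are
   finished. *)
set m0 := 2 * l + 6 in s2.
have cD : #|~: S :\: Lw| + #|Lw| = #|~: S|.
  by rewrite -(cardsID Lw (~: S)) (setIidPr LwS) addnC.
have L1 : D + 2 <= #|Lw| by move: s1 hL; arith.
have L2 : (2 * l).+1 * m0 + 2 * l + 1 <= #|Lw|.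
  by move: s2 hL; clear; move: (_ * m0) #|Lw| #|~: S|; lia.
have m0L : m0 <= #|Lw|.
  by apply: leq_trans L2; do 2!apply: leq_trans (leq_addr _ _); apply: leq_pmull.
have DK3 : D + l + 3 <= K by move: DK; clear; lia.
apply: (play (vs := enum (~: S :\: Lw)) I L) => //.
- exact: enum_uniq.
- by move=> v; rewrite mem_enum in_setD in_setC => /andP[].
- move=> v; rewrite mem_enum in_setD in_setC => /andP[_ vS].
  have := bad_le I (leafy_par V L vS); rewrite -cardE -cD; move: L1; arith.
move=> f1 r1 c1 S1 I1 _ E1.
have S1C : ~: S1 = Lw.
  apply/setP=> v; rewrite in_setC in_setU inE mem_enum in_setD in_setC.
  have := subsetP LwS v; rewrite in_setC.
  by case: (v \in Lw); case: (v \in S) => // /(_ isT).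
have SS1 : S \subset S1 by apply: subsetUl.
have Lf1 := leafy_sub SS1 L.
have E1' W : W \subset S -> {in ~: S :\: Lw, forall v, par v \notin W} ->
    ext W S f c S1 f1 c1.
  by move=> WS h; apply: E1 => // v; rewrite mem_enum; apply: h.
have E1p : ext (par @: (~: S1)) S f c S1 f1 c1.
  have hv v : v \in ~: S :\: Lw -> v \notin S /\ v \in S1.
    by rewrite in_setD in_setC => /andP[vL vS]; split=> //; rewrite -[_ \in S1]negbK -in_setC S1C.
  case: (set_0Vmem (~: S :\: Lw)) => [E0|[v0 /hv[a b]]].
    apply: E1'; last by move=> v; rewrite E0 inE.
    apply/subsetP=> _ /imsetP[u uS ->]; apply: (leafy_par V L).
    by rewrite -in_setC (setCU_sub SS1).
  apply: E1'; first by case: (leafy_img V L SS1 a b).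
  by move=> v /hv[c0 d]; case: (leafy_img V L SS1 c0 d).
have LD1 := low_deg_ext SS1 E1p LD.
have bd1 v : v \notin S1 -> #|bad S1 f1 c1 (par v)| <= 2 * l.
  rewrite -in_setC => vS; have := vS; rewrite {1}S1C in_set => /andP[_].
  by apply: leq_trans; apply/subset_leq_card/(bad_ext E1p)/imset_f.
have [s [us sm _ sL]] : exists s, [/\ uniq s, size s = m0, {subset set0 <= s}
    & {subset s <= Lw}].
  by move=> *; apply: take_sup; rewrite ?sub0set // cards0 m0L.
pose P := [set x in s].
have cP : #|P| = m0 by rewrite cardsE (card_uniqP us).
have PL : P \subset ~: S1 by apply/subsetP=> x; rewrite S1C inE; apply: sL.
pose W := \bigcup_(v in P) bad S1 f1 c1 (par v).
have cW : #|W| <= m0 * (2 * l).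
  rewrite -cP; apply: card_bigcup_le => v vP; apply: bd1.
  by rewrite -in_setC (subsetP PL).
apply: (use_up (W := W) (B := P) (m := m0 * (2 * l)) I1 Lf1 LD1) => //.
- by apply: leq_trans cW; rewrite subset_leq_card ?subsetDl.
- rewrite cardsD (setIidPr PL) cP S1C; move: L2.
  by rewrite mulSn mulnC; clear; move: (m0 * _) #|Lw|; lia.
- by move: SK; rewrite S1C -cD; arith.
move=> S2 f2 r2 c2 SS2 I2 E2 W2 PS2.
have Lf2 := leafy_sub SS2 Lf1; have V2 := i_valid I2.
have LD2 := low_deg_ext SS2 E2 LD1.
have bs2 v : v \notin S2 -> bad S2 f2 c2 (par v) \subset bad S1 f1 c1 (par v).
  by move=> vS; apply: bad_ext E2 _; apply: imset_f; rewrite in_setC.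
have S12 v : v \notin S2 -> v \notin S1 by apply: contra; apply: (subsetP SS2).
have bd2 v : v \notin S2 -> #|bad S2 f2 c2 (par v)| <= 2 * l.
  by move=> vS; apply: leq_trans (subset_leq_card (bs2 v vS)) (bd1 v (S12 v vS)).
have cD2 : #|~: S2 :\: P| + m0 = #|~: S2|.
  by rewrite -cP -(cardsID P (~: S2)) (setIidPr PS2) addnC.
apply: (play (vs := enum (~: S2 :\: P)) I2 Lf2) => //.
- exact: enum_uniq.
- by move=> v; rewrite mem_enum in_setD in_setC => /andP[].
- move=> v; rewrite mem_enum in_setD in_setC => /andP[_ vS].
  by have := bd2 v vS; rewrite -cardE -cD2 /m0; arith.
move=> f3 r3 c3 S3 I3 e3 E3.
have S3C : ~: S3 = P.
  apply/setP=> v; rewrite in_setC in_setU [v \in [set _ in _]]inE mem_enum in_setD in_setC.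
  have := subsetP PS2 v; rewrite in_setC.
  by case: (v \in P); case: (v \in S2) => // /(_ isT).
have SS3 : S2 \subset S3 by apply: subsetUl.
have Lf3 := leafy_sub SS3 Lf2.
have E3p : ext (par @: (~: S3)) S2 f2 c2 S3 f3 c3.
  apply: E3.
    apply/subsetP=> _ /imsetP[u uS ->]; apply: (leafy_par V2 Lf2).
    by rewrite -in_setC (setCU_sub SS3).
  move=> v; rewrite mem_enum => vv.
  have vS3 : v \in S3 by rewrite /S3 in_setU [v \in [set _ in _]]inE mem_enum vv orbT.
  have vS2 : v \notin S2 by move: vv; rewrite in_setD in_setC => /andP[].
  by case: (leafy_img V2 Lf2 SS3 vS2 vS3).
have LD3 := low_deg_ext SS3 E3p LD2.
have bs3 v : v \notin S3 -> bad S3 f3 c3 (par v) \subset W :\: f2 @: S2.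
  rewrite -in_setC => vS; have vP : v \in P by rewrite -S3C.
  have vS2 : v \notin S2 by rewrite -in_setC (setCU_sub SS3).
  apply: subset_trans (bad_ext E3p (imset_f par vS)) _.
  apply/subsetP=> a ab; rewrite in_setD; apply/andP; split.
    by move: ab; rewrite inE => /andP[].
  by apply/bigcupP; exists v => //; apply: (subsetP (bs2 v vS2)).
have bd3 v : v \notin S3 -> #|bad S3 f3 c3 (par v)| <= 1.
  by move=> /bs3/subset_leq_card h; apply: leq_trans h W2.
(* All bad sets now lie in [W :\: f2 @: S2], which has at most one element, so [low_deg] at this
   element bounds [Dt]. *)
pose Dt := [set v in P | bad S3 f3 c3 (par v) != set0].
have DtP : Dt \subset P by apply/subsetP=> v; rewrite in_set => /andP[].
have cDt : #|Dt| <= l.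
  case: (set_0Vmem Dt) => [->|[v1 v1D]]; first by rewrite cards0.
  have : v1 \in P /\ bad S3 f3 c3 (par v1) != set0 by move: v1D; rewrite in_set => /andP.
  rewrite -S3C in_setC => -[v1S] /set0Pn[w wv1].
  apply: leq_trans (LD3 w); apply: subset_leq_card; apply/subsetP=> v.
  rewrite in_set => /andP[vP] /set0Pn[w' wv]; rewrite in_set S3C vP /=.
  have vS : v \notin S3 by rewrite -in_setC S3C.
  suff <- : w' = w by [].
  have [|x0 hx] := @cards1P _ (W :\: f2 @: S2) _.
    rewrite eqn_leq W2 /=; apply/card_gt0P; exists w; exact: (subsetP (bs3 _ v1S)).
  have := subsetP (bs3 _ v1S) _ wv1; have := subsetP (bs3 _ vS) _ wv.
  by rewrite hx => /set1P-> /set1P->.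
have [t [ut tm Dtt tP]] : exists s, [/\ uniq s, size s = 2 * l, {subset Dt <= s}
    & {subset s <= P}].
  apply: take_sup => //; rewrite cP /m0 leq_addr andbT.
  by apply: leq_trans cDt _; rewrite leq_pmull.
have tS3 v : v \in t -> v \notin S3 by move=> /tP; rewrite -S3C in_setC.
have S3n : #|~: S3| = 2 * l + 6 by rewrite S3C cP.
apply: (play (vs := t) I3 Lf3) => //.
  by move=> v /tS3/bd3; rewrite tm S3n; arith.
move=> f4 r4 c4 S4 I4 e4 E4.
have SS4 : S3 \subset S4 by apply: subsetUl.
have Lf4 := leafy_sub SS4 Lf3; have V3 := i_valid I3.
have S4n : #|~: S4| = 6.
  have := card_free_seq ut tS3; rewrite S3n tm addnC -/S4 => h.
  by apply/eqP; rewrite -(eqn_add2r (2 * l)) -h.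
rewrite S4n; apply: (clean_endgame I4 Lf4 S4n) => //.
move=> v vS4; have vS3 : v \notin S3 by apply: contra vS4; apply: (subsetP SS4).
have b0 : bad S3 f3 c3 (par v) = set0.
  apply/eqP/negPn/negP=> h; have : v \in Dt by rewrite in_set -S3C in_setC vS3.
  by move=> /Dtt vt; move: vS4; rewrite in_setU inE vt orbT.
apply/eqP; rewrite -subset0 -b0.
apply: bad_ext (E4 [set par v] _ _) (set11 _).
  by rewrite sub1set; apply: (leafy_par V3 Lf3).
move=> u ut'; rewrite in_set1; apply: contraNneq vS4 => /(proj2 Lf3) E.
have <- : u = v by apply: E; rewrite in_setC // tS3.
by rewrite /S4 in_setU [u \in [set _ in _]]inE ut' orbT.
Qed.

(** * Red Hamilton paths on a set without coloured edges *)

Definition red_rel r (a b : T) := ed a b \in r.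

Lemma ed_neq (e : {set T}) z a b : z \in e -> z != a -> z != b -> (ed a b == e) = false.
Proof.
move=> ze za zb; apply/eqP=> E; move: ze; rewrite -E in_ed.
by rewrite (negbTE za) (negbTE zb).
Qed.

(** The path grows at its last vertex by offers inside [A]. That vertex becomes an inner one, so the
    rejected edge touches neither new end, and no edge within [A] is ever coloured. The final vertex
    of [A] cannot be refused, since it is offered to both ends of the path. *)
Lemma grow_red_path G k m (B : {set T}) : forall (A : {set T}) x0 s r c,
  #|A| = m.+1 -> A \subset B -> {subset x0 :: s <= B} -> x0 != last x0 s ->
  [disjoint A & x0 :: s] -> uniq (x0 :: s) -> path (red_rel r) x0 s ->
  {in A, forall a, ed x0 a \notin c} -> {in A, forall a, ed (last x0 s) a \notin c} ->
  {in A &, forall a b, ed a b \notin c} ->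
  (forall y0 t r' c', path (red_rel r') y0 t -> uniq (y0 :: t) ->
     (y0 :: t) =i [predU A & x0 :: s] -> r \subset r' -> c \subset c' ->
     (forall e, e \in c' -> e \in c \/ e \subset B) ->
     (r \subset c -> r' \subset c') -> wf G k r' c') ->
  wf G (m.+1 + k) r c.
Proof.
have rcs e1 e2 r c : r \subset c -> e1 |: r \subset [set e1; e2] :|: c.
  by move=> h; rewrite subUset sub1set !inE eqxx /= (subset_trans h) ?subsetUr.
have rpS r r' x s : r \subset r' -> path (red_rel r) x s -> path (red_rel r') x s.
  by move=> /subsetP rr; apply: sub_path => a b; apply: rr.
elim: m => [|m IH] A x0 s r c Am AB sB xl dA us pr xA lA AA H.
  have /cards1P[a aE] : #|A| == 1 by rewrite Am.
  have aA : a \in A by rewrite aE set11.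
  have axs : a \notin x0 :: s by rewrite (disjointFr dA aA).
  have aB := subsetP AB a aA.
  have x0B : x0 \in B by rewrite sB ?mem_head.
  have lB : last x0 s \in B by rewrite sB ?mem_last.
  have anx : a != x0 by apply: contraNneq axs => ->; rewrite mem_head.
  have anl : a != last x0 s by apply: contraNneq axs => ->; rewrite mem_last.
  have cc e1 e2 : c \subset [set e1; e2] :|: c by rewrite subsetUr.
  have new e : e \in [set ed x0 a; ed (last x0 s) a] :|: c -> e \in c \/ e \subset B.
    rewrite !inE => /orP[/orP[]/eqP->|]; last by left.
      by right; apply/subsetP=> z; rewrite in_ed => /orP[]/eqP->.
    by right; apply/subsetP=> z; rewrite in_ed => /orP[]/eqP->.
  apply: (@wf_offer n G k r c (ed x0 a) (ed (last x0 s) a)).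
  - by rewrite Kn_ed eq_sym.
  - by rewrite Kn_ed eq_sym.
  - exact: xA.
  - exact: lA.
  - by apply: contra xl => /eqP; rewrite ![ed _ a]edC => /ed_inj/eqP.
  - apply: (H a (x0 :: s)) => //.
    + rewrite /= /red_rel edC setU11 /=; apply: rpS pr; exact: subsetUr.
    + by rewrite cons_uniq axs.
    + by move=> z; rewrite inE [RHS]inE /= aE in_set1.
    + exact: subsetUr.
    + exact: cc.
    + exact: rcs.
  apply: (H x0 (rcons s a)) => //.
  - rewrite rcons_path /red_rel setU11 andbT; apply: rpS pr; exact: subsetUr.
  - by rewrite -rcons_cons rcons_uniq axs.
  - by move=> z; rewrite -rcons_cons mem_rcons inE [RHS]inE /= aE in_set1.
  - exact: subsetUr.
  - exact: cc.
  - by rewrite [[set _; _]]setUC; exact: rcs.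
have [y1 [y2 [y1A y2A y12]]] : exists y1 y2, [/\ y1 \in A, y2 \in A & y1 != y2].
  by apply: pick2; rewrite Am.
set w := last x0 s in xl lA.
have wxs : w \in x0 :: s by rewrite mem_last.
have nin a z : a \in A -> z \in x0 :: s -> a != z.
  by move=> aA; apply: contraTneq => <-; rewrite (disjointFr dA aA).
suff main y y' : y \in A -> y' \in A -> y != y' ->
    wf G (m.+1 + k) (ed w y |: r) ([set ed w y; ed w y'] :|: c).
  apply: (@wf_offer n G _ r c (ed w y1) (ed w y2)).
  - by rewrite Kn_ed eq_sym nin.
  - by rewrite Kn_ed eq_sym nin.
  - exact: lA.
  - exact: lA.
  - by apply: contra y12 => /eqP/ed_inj->.
  - exact: main.
  - by rewrite [[set _; _]]setUC; apply: main => //; rewrite eq_sym.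
move=> yA y'A yy'; set c1 := _ :|: c.
have c1P a b : ed a b \notin c -> a != w -> b != w -> ed a b \notin c1.
  move=> abc aw bw; rewrite !inE !negb_or abc andbT.
  have ne z : ed a b != ed w z.
    apply/eqP=> E; have := edl w z; rewrite -E in_ed => /orP[]/eqP h.
      by rewrite h eqxx in aw.
    by rewrite h eqxx in bw.
  by rewrite !ne.
have yw := nin y w yA wxs.
have Ay z : z \in A :\ y -> z \in A /\ z != y by rewrite in_setD1 => /andP[].
apply: (IH (A :\ y) x0 (rcons s y) _ c1).
- by move: Am; rewrite (cardsD1 y) yA add1n => -[].
- by apply: subset_trans AB; apply: subsetDl.
- move=> z; rewrite -rcons_cons mem_rcons inE => /orP[/eqP->|]; last exact: sB.
  exact: (subsetP AB).
- by rewrite last_rcons eq_sym nin ?mem_head.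
- apply/pred0P=> z /=; apply/negbTE/negP=> /andP[/Ay[zA zy]].
  rewrite -rcons_cons mem_rcons inE (negbTE zy) /= => zs.
  by have := nin z z zA zs; rewrite eqxx.
- rewrite -rcons_cons rcons_uniq us andbT; apply/negP=> ys.
  by have := nin y y yA ys; rewrite eqxx.
- rewrite rcons_path /red_rel setU11 andbT; apply: rpS pr; exact: subsetUr.
- move=> a /Ay[aA _]; apply: c1P => //; [exact: xA|exact: nin].
- move=> a /Ay[aA ay]; rewrite last_rcons !inE !negb_or AA // andbT.
  have yin z : ed y a != ed w z.
    apply/eqP=> E; have := edl w z; rewrite -E in_ed => /orP[]/eqP h.
      by rewrite h eqxx in yw.
    by have := nin a w aA wxs; rewrite -h eqxx.
  by rewrite !yin.
- move=> a b /Ay[aA _] /Ay[bA _]; apply: c1P; [exact: AA|exact: nin|exact: nin].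
move=> y0 t r' c' p' u' E rr cc new rc'; apply: (H y0 t r' c') => //;
  last by move=> /(rcs (ed w y) (ed w y')); apply: rc'.
- move=> z; rewrite E [LHS]inE [RHS]inE /= -rcons_cons mem_rcons inE in_setD1.
  by case: (eqVneq z y) => [->|]; rewrite ?yA ?orbT.
- by apply: subset_trans rr; apply: subsetUr.
- by apply: subset_trans cc; apply: subsetUr.
move=> e /new[|]; last by right.
have wB : w \in B by apply: sB.
have eB z : z \in A -> ed w z \subset B.
  by move=> zA; apply/subsetP=> v; rewrite in_ed => /orP[]/eqP-> //; apply: (subsetP AB).
by rewrite !inE => /orP[/orP[]/eqP->|]; [right; apply: eB|right; apply: eB|left].
Qed.

(** The start must produce two ends without coloured edges to the rest. Two disjoint edges are
    offered first, so that the ends of the red one carry no rejected edge. The path goes on to an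
    end [y] of the rejected edge, and then to a vertex outside the four already met, for which six
    vertices are needed. After these three rounds every newly coloured edge meets an inner vertex,
    [b0] or [y], and [grow_red_path] takes over. *)
Lemma red_ham_path G k (A : {set T}) r c : 6 <= #|A| ->
  {in A &, forall a b, ed a b \notin c} ->
  (forall y0 t r' c', path (red_rel r') y0 t -> uniq (y0 :: t) -> (y0 :: t) =i A ->
     r \subset r' -> c \subset c' ->
     (forall e, e \in c' -> e \in c \/ e \subset A) ->
     (r \subset c -> r' \subset c') -> wf G k r' c') ->
  wf G (#|A|.-1 + k) r c.
Proof.
move=> A6 AA H.
have sE z : (z \in enum A) = (z \in A) by rewrite mem_enum.
have := enum_uniq A; have szE : size (enum A) = #|A| by rewrite -cardE.
move: (enum A) sE szE A6 => s sE szE; rewrite -szE.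
case: s sE szE => [|a [|b [|u [|v s]]]] // sE szE s6 us.
have ins z : z \in [:: a; b; u; v] -> z \in A.
  by rewrite -sE !inE => /or4P[]/eqP->; rewrite eqxx ?orbT.
have [iA ib iu iv] : [/\ a \in A, b \in A, u \in A & v \in A].
  by split; apply: ins; rewrite !inE eqxx ?orbT.
have [[nab nau nav] [nbu nbv nuv]] :
    [/\ a != b, a != u & a != v] /\ [/\ b != u, b != v & u != v].
  move: us; rewrite /= !inE !negb_or => /and5P[/and4P[-> -> -> _] /and3P[-> -> _]].
  by case/andP=> ->.
rewrite [size _]/= in szE s6 *; rewrite [_.-1]/=.
have s2 : 2 <= size s by [].
have main a0 b0 u0 v0 : a0 \in A -> b0 \in A -> u0 \in A -> v0 \in A ->
   [/\ a0 != b0, a0 != u0 & a0 != v0] -> [/\ b0 != u0, b0 != v0 & u0 != v0] ->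
   wf G ((size s).+2 + k) (ed a0 b0 |: r) ([set ed a0 b0; ed u0 v0] :|: c).
  move=> aA bA uA vA [ab au av] [bu bv uv]; set r1 := _ |: r; set c1 := _ :|: c.
  have bc1 z : z \in A -> z != b0 -> z != a0 -> ed b0 z \notin c1.
    move=> zA zb za; rewrite !inE !negb_or AA // andbT; apply/andP; split.
      by apply: contra za; rewrite (edC a0) => /eqP/ed_inj->.
    apply/eqP=> E; have := edl b0 z; rewrite E in_ed.
    by rewrite (negbTE bu) (negbTE bv).
  suff step y y' : (y = u0 /\ y' = v0) \/ (y = v0 /\ y' = u0) ->
      wf G ((size s).+1 + k) (ed b0 y |: r1) ([set ed b0 y; ed b0 y'] :|: c1).
    apply: (@wf_offer n G _ r1 c1 (ed b0 u0) (ed b0 v0)).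
    - by rewrite Kn_ed.
    - by rewrite Kn_ed.
    - by apply: bc1 => //; rewrite eq_sym.
    - by apply: bc1 => //; rewrite eq_sym.
    - by apply: contra uv => /eqP/ed_inj->.
    - by apply: step; left.
    - by rewrite [[set _; _]]setUC; apply: step; right.
  move=> yy; set r2 := _ |: r1; set c2 := _ :|: c1.
  have [yA y'A yuv] : [/\ y \in A, y' \in A & y \in ed u0 v0].
    by case: yy => -[-> ->]; rewrite ?edl ?edr.
  have [yb ya yy'] : [/\ b0 != y, a0 != y & y != y'].
    by case: yy => -[-> ->]; split=> //; rewrite eq_sym.
  have c2P al be : al \in A -> be \in A -> b0 != al -> b0 != be ->
      y != al -> y != be -> ed al be \notin c2.
    move=> lA eA bl be' yl ye; rewrite !inE !negb_or AA // andbT.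
    by rewrite (ed_neq (edl b0 y) bl be') (ed_neq (edl b0 y') bl be')
      (ed_neq (edr a0 b0) bl be') (ed_neq yuv yl ye).
  have [p [q []]] : exists p q, [/\ p \in A :\: [set a0; b0; u0; v0],
      q \in A :\: [set a0; b0; u0; v0] & p != q].
    apply: pick2; rewrite cardsD -szE.
    have : #|A :&: [set a0; b0; u0; v0]| <= 4.
      apply: leq_trans (subset_leq_card (subsetIr _ _)) _.
      by rewrite !cardsU !cards1; arith.
    by move: s2; arith.
  have outP z : z \in A :\: [set a0; b0; u0; v0] ->
      [/\ z \in A, a0 != z, b0 != z & y != z].
    rewrite !inE !negb_or => /andP[/andP[/andP[/andP[za zb] zu] zv] ->].
    split=> //; rewrite eq_sym //; by case: yy => -[-> _].
  move=> pD qD pq; have [pA pa pb py] := outP p pD; have [qA qa qb qy] := outP q qD.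
  suff fin p1 p2 : p1 \in A -> p2 \in A -> a0 != p1 -> b0 != p1 -> y != p1 ->
      wf G (size s + k) (ed y p1 |: r2) ([set ed y p1; ed y p2] :|: c2).
    have yc2 z : z \in A :\: [set a0; b0; u0; v0] -> ed y z \notin c2.
      move=> zD; have [zA za zb yz] := outP z zD.
      have zuv : z \notin ed u0 v0.
        by move: zD; rewrite in_ed !inE !negb_or => /andP[/andP[/andP[_ ->] ->]].
      have ne : ed y z != ed u0 v0 by apply: contraNneq zuv => <-; rewrite edr.
      rewrite !inE !negb_or AA // andbT ne andbT.
      by rewrite (ed_neq (edl b0 y) yb zb) (ed_neq (edl b0 y') yb zb)
        (ed_neq (edr a0 b0) yb zb).
    apply: (@wf_offer n G _ r2 c2 (ed y p) (ed y q)).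
    - by rewrite Kn_ed.
    - by rewrite Kn_ed.
    - exact: yc2.
    - exact: yc2.
    - by apply: contra pq => /eqP/ed_inj->.
    - exact: fin.
    - by rewrite [[set _; _]]setUC; apply: fin.
  move=> p1A p2A pa1 pb1 py1; set r3 := _ |: r2; set c3 := _ :|: c2.
  have sz : size s = (size s).-1.+1 by rewrite prednK // (leq_trans _ s2).
  have c3P al be : al \in A -> be \in A -> b0 != al -> b0 != be ->
      y != al -> y != be -> ed al be \notin c3.
    move=> lA eA bl be' yl ye; rewrite in_setU in_set2 !negb_or c2P // andbT.
    by rewrite (ed_neq (edl y p1) yl ye) (ed_neq (edl y p2) yl ye).
  have r23 : r \subset r3 by rewrite /r3 /r2 /r1 !setUA subsetUr.
  have c23 : c \subset c3 by rewrite /c3 /c2 /c1 !setUA subsetUr.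
  pose A' := A :\: [set z in [:: a0; b0; y; p1]].
  have A'P z : z \in A' -> [/\ z \in A, a0 != z, b0 != z, y != z & p1 != z].
    rewrite !inE !negb_or => /andP[/and4P[h1 h2 h3 h4] ->].
    by split=> //; rewrite eq_sym.
  have u4 : uniq [:: a0; b0; y; p1].
    by rewrite /= !inE !negb_or ab ya pa1 yb pb1 py1.
  have s4 : {subset [:: a0; b0; y; p1] <= A}.
    by move=> z; rewrite !inE => /or4P[]/eqP->.
  rewrite sz; apply: (grow_red_path (B := A) (A := A') (x0 := a0) (s := [:: b0; y; p1])).
  - rewrite cardsD (setIidPr _); last by apply/subsetP=> z; rewrite inE; apply: s4.
    by rewrite cardsE (card_uniqP u4) -szE -sz /= subSS subSS subSS subSS subn0.
  - exact: subsetDl.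
  - exact: s4.
  - exact: pa1.
  - apply/pred0P=> z /=; apply/negbTE/negP=> /andP[]; rewrite in_setD inE.
    by case/andP=> /negbTE->.
  - exact: u4.
  - rewrite /= /red_rel /r3 /r2 /r1 !in_setU1 !eqxx ?orbT /=; by rewrite ?orbT.
  - by move=> z /A'P[zA za zb zy zp]; apply: c3P => //; rewrite eq_sym.
  - by move=> z /A'P[zA za zb zy zp]; apply: c3P.
  - by move=> z z' /A'P[zA za zb zy zp] /A'P[zA' za' zb' zy' zp']; apply: c3P.
  have rc3 : r \subset c -> r3 \subset c3.
    move=> /subsetP h; apply/subsetP=> e; rewrite !in_setU !in_set1.
    by do ![case/orP]; try (by move->; rewrite ?orbT); move/h->; rewrite !orbT.
  move=> y0 t r' c' pt ut tE rr cc new rc'; apply: (H y0 t r' c') => //;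
    last by move/rc3/rc'.
  - move=> z; rewrite tE [LHS]inE /= in_setD inE; case zz: (z \in _); rewrite ?orbT ?orbF //=.
    by rewrite s4.
  - exact: subset_trans r23 rr.
  - exact: subset_trans c23 cc.
  have eA z z' : z \in A -> z' \in A -> ed z z' \subset A.
    by move=> h h'; apply/subsetP=> x; rewrite in_ed => /orP[]/eqP->.
  move=> e /new[|]; last by right.
  rewrite !in_setU !in_set1; do ![case/orP]; try by move/eqP->; right; apply: eA.
  by left.
apply: (@wf_offer n G _ r c (ed a b) (ed u v)).
- by rewrite Kn_ed.
- by rewrite Kn_ed.
- exact: AA.
- exact: AA.
- by rewrite (ed_neq (edl u v)) // eq_sym.
- exact: main.
- rewrite [[set _; _]]setUC; apply: main => //; split=> //; by rewrite eq_sym.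
Qed.

(* Both ends of the red path on [A] stay available, so attaching it to [t] costs nothing. *)
Lemma red_ham_path_from G k (A : {set T}) t r c : 6 <= #|A| -> t \notin A ->
  {in A, forall a, ed t a \notin c} -> {in A &, forall a b, ed a b \notin c} ->
  (forall s r' c', path (red_rel r') t s -> uniq s -> s =i A ->
     r \subset r' -> c \subset c' ->
     (forall e, e \in c' -> e \in c \/ e \subset t |: A) ->
     (r \subset c -> r' \subset c') -> wf G k r' c') ->
  wf G (#|A| + k) r c.
Proof.
move=> A6 tA tc AA H.
have A0 : #|A| = #|A|.-1.+1 by rewrite prednK // (leq_trans _ A6).
rewrite A0 addSnnS; apply: red_ham_path => // y0 s r1 c1 p u sA rr cc new rc'.
have yA : y0 \in A by rewrite -sA mem_head.
have lA : last y0 s \in A by rewrite -sA mem_last.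
have yl : y0 != last y0 s.
  move: A6; rewrite -(eq_card sA) (card_uniqP u) /=.
  case: s u sA p lA {H} => // z s /= /andP[ys _] _ _ _ _.
  by apply: contraNneq ys => {1}->; apply: (mem_last z s).
have tc1 a : a \in A -> ed t a \notin c1.
  move=> aA; apply/negP=> /new[|/subsetP]; first exact/negP/tc.
  by move/(_ t (edl _ _)); rewrite (negbTE tA).
have tn a : a \in A -> t != a by apply: contraTneq => <-.
have st z e1 e2 : z \in A -> e1 = ed t y0 -> e2 = ed t (last y0 s) ->
    forall e, e \in [set e1; e2] :|: c1 -> e \in c \/ e \subset t |: A.
  move=> zA E1 E2 e; rewrite !in_setU !in_set1 => /orP[/orP[]/eqP->|/new[|h]].
  - by right; rewrite E1; apply/subsetP=> x; rewrite in_ed in_setU1 => /orP[]/eqP->; rewrite ?eqxx ?yA ?orbT.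
  - by right; rewrite E2; apply/subsetP=> x; rewrite in_ed in_setU1 => /orP[]/eqP->; rewrite ?eqxx ?lA ?orbT.
  - by left.
  - by right; apply: subset_trans h (subsetUr _ _).
have rpS r0 r' x s0 : r0 \subset r' -> path (red_rel r0) x s0 -> path (red_rel r') x s0.
  by move=> /subsetP sr; apply: sub_path => a b; apply: sr.
have rcs e1 e2 : r \subset c -> e1 |: r1 \subset [set e1; e2] :|: c1.
  by move=> h; rewrite subUset sub1set !inE eqxx /= (subset_trans (rc' h)) ?subsetUr.
apply: (@wf_offer n G k r1 c1 (ed t y0) (ed t (last y0 s))).
- by rewrite Kn_ed tn.
- by rewrite Kn_ed tn.
- exact: tc1.
- exact: tc1.
- by apply: contra yl => /eqP/ed_inj/eqP.
- apply: (H (y0 :: s)) => //.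
  + rewrite /= /red_rel setU11 /=; apply: rpS p; exact: subsetUr.
  + by apply: subset_trans rr (subsetUr _ _).
  + by apply: subset_trans cc (subsetUr _ _).
  + exact: (st y0).
  + exact: rcs.
- apply: (H (rev (y0 :: s))) => //.
  + have pr : path (red_rel r1) (last y0 s) (rev (belast y0 s)).
      by rewrite rev_path; apply: sub_path p => a b; rewrite /red_rel edC.
    rewrite lastI rev_rcons /= /red_rel setU11 /=; apply: rpS pr; exact: subsetUr.
  + by rewrite rev_uniq.
  + by move=> z; rewrite mem_rev sA.
  + by apply: subset_trans rr (subsetUr _ _).
  + by apply: subset_trans cc (subsetUr _ _).
  + exact: (st y0).
  + by rewrite [[set _; _]]setUC; exact: rcs.
Qed.

(** * Endgames on reserved paths *)

Lemma two_left (I : finType) (A B : {set I}) :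
  #|A| <= 1 -> #|B| <= 1 -> 4 <= #|I| ->
  exists i j, [/\ i \notin A, i \notin B, j \notin A, j \notin B & i != j].
Proof.
move=> A1 B1 I4; have [|i [j []]] := @pick2 I (~: (A :|: B)).
  have := cardsC (A :|: B); have := cardsU A B; move: A1 B1 I4.
  by move: #|A| #|B| #|_ :|: _| #|_ :&: _| #|I| #|~: _|; clear; lia.
rewrite !in_setC !in_setU !negb_or => /andP[iA iB] /andP[jA jB] ij.
by exists i, j.
Qed.

Lemma extend_chain S f r c Y x us s r' c' : valid S f r c Y -> x \in S ->
  path child x us -> uniq us -> us =i ~: S -> uniq s -> s =i ~: (f @: S) ->
  path (red_rel r') (f x) s -> r \subset r' -> r' \subset c' ->
  valid setT (fun z => if z \in us then nth (f x) s (index z us) else f z) r' c' Y.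
Proof.
move=> V xS px uu usE u_s sE ps rr rc; set g := fun _ => _.
have gS z : z \in S -> g z = f z.
  by move=> zS; rewrite /g usE in_setC zS.
have szE : size s = size us.
  by rewrite -(card_uniqP u_s) -(card_uniqP uu) (eq_card sE) (eq_card usE) (card_free V).
have gU z : z \in us -> g z = nth (f x) s (index z us) by move=> zu; rewrite /g zu.
have gs z : z \in us -> g z \in s.
  by move=> zu; rewrite gU // mem_nth // szE index_mem.
have SU z : (z \in S) || (z \in us) by rewrite usE in_setC orbN.
have sf z w : z \in us -> w \in S -> g z != f w.
  move=> zu wS; apply/eqP=> h; have := gs z zu.
  by rewrite sE h in_setC imset_f.
split=> //.
- move=> a b _ _; case/orP: (SU a) => ha; case/orP: (SU b) => hb.
  + by rewrite !gS //; apply: (v_inj V).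
  + by rewrite [g a]gS // => h; have := sf b a hb ha; rewrite h eqxx.
  + by rewrite [g b]gS // => h; have := sf a b ha hb; rewrite h eqxx.
  rewrite !gU // => /eqP; rewrite nth_uniq ?szE ?index_mem // => /eqP.
  exact: index_inj.
- by move=> z zR; rewrite gS ?(v_phi V) //; apply: (subsetP (v_R V)).
- move=> v _ vR; rewrite in_setT; split=> //; case/orP: (SU v) => hv.
    by have [h1 h2] := v_par V hv vR; rewrite !gS // (subsetP rr).
  have vi : index v us < size us by rewrite index_mem.
  have pv : par v = nth x (x :: us) (index v us).
    by rewrite -{1}(nth_index x hv); apply/eqP; move/(pathP x): px; apply.
  have gp : g (par v) = nth (f x) (f x :: s) (index v us).
    rewrite pv; case: (index v us) vi => [|i] vi /=; first by rewrite gS.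
    by rewrite gU ?mem_nth 1?ltnW // index_uniq // ltnW.
  rewrite gp gU // edC; move/(pathP (f x)): ps; apply; by rewrite szE.
- by move=> p /(v_Y V)[h1 h2 h3]; rewrite !in_setT !gS // (subsetP rr).
move=> a b aT; case/negP: aT; have := sE a; rewrite in_setC.
case: (boolP (a \in f @: S)) => [/imsetP[z zS ->] _|_ as_].
  by rewrite -gS // imset_f.
have ai : index a s < size us by rewrite -szE index_mem as_.
apply/imsetP; exists (nth x us (index a s)) => //.
by rewrite gU ?mem_nth // index_uniq // nth_index ?as_.
Qed.

Lemma chain_endgame G S f r c Y x us q0 q1 q2 q3 q4 q5 :
  let qs := [:: q1; q2; q3; q4; q5] in
  valid S f r c Y -> x \in S -> bad S f c x = set0 ->
  path child x us -> uniq us -> us =i ~: S -> 6 <= size us ->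
  q0 \in S -> path child q0 qs -> uniq (q0 :: qs) -> {subset qs <= S} ->
  {in qs, forall z, z \notin R} -> x \notin q0 :: qs ->
  (forall v, v \notin R -> par v \in qs -> v \in qs) ->
  (forall p, p \in Y -> p.1 \notin qs /\ p.2 \notin qs) ->
  bad S f c q5 = set0 ->
  (forall y, y \notin f @: S -> dst [set z in [:: q0; q1; q2; q3; q4]] f c y) ->
  {in [:: q0; q1; q2; q3], forall z, ed (f z) (f q5) \notin c} ->
  (forall g r' c', valid setT g r' c' Y ->
     ed (g (last x us)) (g q5) \in r' -> G r' c') -> wf G (#|~: S| + 2) r c.
Proof.
move=> qs V xS xb px uu usE s6 q0S pq uq qsS qsR xq qk qY q5b dd l5 H.
have cU : #|~: S| = size us by rewrite -(eq_card usE) (card_uniqP uu).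
have fxA : f x \notin ~: (f @: S) by rewrite in_setC negbK imset_f.
rewrite -(card_free V); apply: (red_ham_path_from (t := f x)) => //.
- by rewrite (card_free V) cU.
- move=> a; rewrite in_setC => aS; apply/negP=> h.
  have : a \in bad S f c x by rewrite inE aS.
  by rewrite xb inE.
- by move=> a b; rewrite !in_setC; apply: (v_A V).
move=> s r1 c1 ps u_s sE rr cc new rc1.
have rc := rc1 (v_rc V).
have V1 := extend_chain V xS px uu usE u_s sE ps rr rc.
set g := fun _ => _ in V1.
have gS z : z \in S -> g z = f z by move=> zS; rewrite /g usE in_setC zS.
have QS : {subset q0 :: qs <= S}.
  by move=> z; rewrite inE => /orP[/eqP->|/qsS].
have xl : last x us \in us.
  by case: (us) s6 => // z t _; exact: (mem_last z t).
have xlS : last x us \notin S by rewrite -in_setC -usE.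
set tt := g (last x us).
have ttA : tt \notin f @: S.
  apply/imsetP=> -[z zS]; rewrite -gS // => /(v_inj V1 (in_setT _) (in_setT _)) h.
  by rewrite h zS in xlS.
have newq z e : z \in q0 :: qs -> e \in c1 -> f z \in e -> e \in c.
  move=> zq /new[//|/subsetP h] ze; have := h _ ze.
  rewrite in_setU1 in_setC imset_f ?QS // orbF => /eqP/(v_inj V (QS _ zq) xS) E.
  by rewrite -E zq in xq.
have i05 z : z \in [:: q0; q1; q2; q3; q4] -> z \in q0 :: qs.
  by rewrite !inE => /or4P[->|->|->|/orP[]->]; rewrite ?orbT.
have dt a b : a \in [:: q0; q1; q2; q3; q4] -> b \in [:: q0; q1; q2; q3; q4] ->
    ed tt (f a) \in c1 -> ed tt (f b) \in c1 -> a = b.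
  move=> ha hb h h'; apply: (dd tt ttA a b).
  - by rewrite in_set.
  - by rewrite in_set.
  - by rewrite edC; apply: (newq a) h _; rewrite ?i05 ?edr.
  by rewrite edC; apply: (newq b) h' _; rewrite ?i05 ?edr.
pose A : {set 'I_4} := [set i : 'I_4 | ed tt (f (nth q0 qs i)) \in c1].
have nin (i : 'I_4) : nth q0 qs i \in [:: q0; q1; q2; q3; q4].
  by case: i => -[|[|[|[|]]]] //= _; rewrite !inE eqxx ?orbT.
have cA : #|A| <= 1.
  apply/card_le1_eqP=> i j; rewrite !inE => hi hj.
  have /eqP := dt _ _ (nin i) (nin j) hi hj.
  rewrite nth_uniq; first by move/eqP/val_inj.
  - by rewrite (leq_trans (ltn_ord i)).
  - by rewrite (leq_trans (ltn_ord j)).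
  - by case/andP: uq.
have [|||i [j [iA _ jA _ ij]]] := @two_left _ A set0 => //.
- by rewrite cards0.
- by rewrite card_ord.
have nout (m : 'I_4) : m \notin A -> ed (g q5) (g (nth q0 (q0 :: qs) m)) \notin c1 /\
    ed tt (g (nth q0 qs m)) \notin c1.
  rewrite inE => hm; split; last by rewrite gS ?QS ?i05 ?nin.
  have q03 : nth q0 (q0 :: qs) m \in [:: q0; q1; q2; q3].
    by case: (m) => -[|[|[|[|]]]] //= _; rewrite !inE eqxx ?orbT.
  have q03' : nth q0 (q0 :: qs) m \in q0 :: qs.
    by apply: i05; move: q03; rewrite !inE => /or4P[]->; rewrite ?orbT.
  have q5q : q5 \in q0 :: qs by rewrite !inE eqxx !orbT.
  rewrite !gS ?QS //; apply/negP=> /(newq _ _ q03')h.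
  by have := l5 _ q03; rewrite edC h // edr.
have [ni1 ni2] := nout i iA; have [nj1 nj2] := nout j jA.
have qu (m : 'I_4) : m < 5 by apply: leq_trans (ltn_ord m) _.
apply: (rotate_and_close (q0 := q0) (ps := qs) (i := i) (j := j) (t := tt) V1) => //.
- by move=> z _; rewrite in_setT.
- by move=> v _; apply: qk.
- move=> z zq; rewrite gS ?QS //; apply: contraNneq ttA => <-.
  by rewrite imset_f ?QS.
- have q5q : q5 \in q0 :: qs by rewrite !inE eqxx !orbT.
  apply/negP; rewrite gS ?QS // => h.
  have : tt \in bad S f c q5.
    by rewrite inE ttA edC; apply: (newq q5) h _; rewrite ?edr.
  by rewrite q5b inE.
move=> g' r2 c2 m _ gE V2 er _ _; apply: (H g' r2 c2) => //.
rewrite (_ : g' (last x us) = tt) //; case: gE => -> //.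
rewrite revf_out //; apply: contra xlS => /mem_drop; exact: qsS.
Qed.

Lemma path_endgame G S f r c Y x w q0 q1 q2 q3 q4 qs' :
  let qs := [:: q1, q2, q3, q4 & qs'] in let v := last q0 qs in
  valid S f r c Y -> x \in S -> bad S f c x = set0 -> w |: S = setT -> w \notin S ->
  q0 \in S -> path child q0 (rcons qs w) -> uniq (q0 :: qs) -> {subset qs <= S} ->
  qs' <> [::] -> {in qs, forall z, z \notin R} -> x \notin q0 :: qs ->
  (forall u, u \notin R -> par u \in rcons qs w -> u \in rcons qs w) ->
  (forall p, p \in Y -> p.1 \notin qs /\ p.2 \notin qs) ->
  bad S f c v = set0 ->
  {in qs, forall z, ed (f x) (f z) \notin c} ->
  (forall y, y \notin f @: S -> dst [set z in [:: q0; q1; q2; q3; q4]] f c y) ->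
  dst [set z in [:: q0; q1; q2; q3]] f c (f v) ->
  (forall g r' c', valid setT g r' c' Y -> ed (g x) (g w) \in r' -> G r' c') ->
  wf G 4 r c.
Proof.
move=> qs v V xS xb wT wS q0S pqw uq qsS n' qsR xq qk qY vb xun dd dv H.
have [pq pw] : path child q0 qs /\ par w = v.
  by move: pqw; rewrite rcons_path => /andP[? /eqP].
have Sc : #|~: S| = 1 by rewrite (card_free_step wS) wT setCT cards0.
have /cards1P[a aE] : #|~: (f @: S)| == 1 by rewrite (card_free V) Sc.
have aS : a \notin f @: S by rewrite -in_setC aE set11.
have QS : {subset q0 :: qs <= S}.
  by move=> z; rewrite inE => /orP[/eqP->|/qsS].
have wq : w \notin q0 :: qs by apply: contra wS; apply: QS.
have vQ : v \in q0 :: qs by apply: mem_last.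
have i05 z : z \in [:: q0; q1; q2; q3; q4] -> z \in q0 :: qs.
  by rewrite !inE => /or4P[->|->|->|/orP[]->]; rewrite ?orbT.
pose A : {set 'I_4} := [set i : 'I_4 | ed (f (nth q0 (q0 :: qs) i)) (f v) \in c].
pose B : {set 'I_4} := [set i : 'I_4 | ed (f (nth q0 qs i)) a \in c].
have n4 (i : 'I_4) : i < size qs by apply: leq_trans (ltn_ord i) _.
have n5 (i : 'I_4) : i < size (q0 :: qs) by apply: leqW (n4 i).
have cA : #|A| <= 1.
  apply/card_le1_eqP=> i j; rewrite !inE => hi hj.
  have nin (m : 'I_4) : nth q0 (q0 :: qs) m \in [set z in [:: q0; q1; q2; q3]].
    by case: m => -[|[|[|[|]]]] //= _; rewrite !inE eqxx ?orbT.
  have /eqP := dv _ _ (nin i) (nin j) hi hj.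
  by rewrite nth_uniq // => /eqP/val_inj.
have cB : #|B| <= 1.
  apply/card_le1_eqP=> i j; rewrite !inE => hi hj.
  have nin (m : 'I_4) : nth q0 qs m \in [set z in [:: q0; q1; q2; q3; q4]].
    by case: m => -[|[|[|[|]]]] //= _; rewrite !inE eqxx ?orbT.
  have /eqP := dd a aS _ _ (nin i) (nin j) hi hj.
  by rewrite nth_uniq // => [/eqP/val_inj|]; last by case/andP: uq.
have [|i [j [iA iB jA jB ij]]] := two_left cA cB; first by rewrite card_ord.
rewrite !inE in iA iB jA jB.
have fa z : z \in S -> f z != a by move=> zS; apply: contraNneq aS => <-; apply: imset_f.
apply: (rotate_and_close (k := 2) (q0 := q0) (ps := qs) (i := i) (j := j) (t := a) V); rewrite -?/v //.
- move=> u uS uR pu; have : u \in rcons qs w by apply: qk; rewrite // mem_rcons inE pu orbT.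
  by rewrite mem_rcons inE => /orP[/eqP E|//]; rewrite -E uS in wS.
- by rewrite edC.
- by rewrite edC.
- by move=> z /QS; apply: fa.
- apply/negP=> h; have : a \in bad S f c v by rewrite inE aS edC.
  by rewrite vb inE.
- by rewrite edC.
- by rewrite edC.
move=> g r1 c1 m mij gE V1 er cc new.
have m4 : m < 4 by case: mij => ->; apply: ltn_ord.
have us' : uniq (drop m qs) by apply: drop_uniq; case/andP: uq.
have gim : g @: S = f @: S.
  case: gE => -> //; apply: revf_img => // z /mem_drop; exact: qsS.
have aS1 : a \notin g @: S by rewrite gim.
have gout z : z \notin qs -> g z = f z.
  by move=> zq; case: gE => -> //; rewrite revf_out //; apply: contra zq; apply: mem_drop.
(* The new chords are chosen by their images; after a possible reversal these may sit at other
   positions of the path. *)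
have gpre z : z \in q0 :: qs -> exists2 u, u \in q0 :: qs & g u = f z.
  move=> zq; case: gE => ->; first by exists z.
  exists (mirror (drop m qs) z); last by rewrite /revf mirrorK.
  case zd: (z \in drop m qs); last by rewrite /mirror zd.
  by rewrite inE (@mem_drop m) ?orbT // mirror_mem.
have gpost u : u \in qs -> exists2 z, z \in qs & g u = f z.
  move=> uq'; case: gE => ->; first by exists u.
  exists (mirror (drop m qs) u) => //.
  case ud: (u \in drop m qs); last by rewrite /mirror ud.
  by apply: (@mem_drop m); rewrite mirror_mem.
have vS : par w \in S by rewrite pw QS.
have V2 : valid setT (upd g w a) r1 c1 Y.
  apply: (valid_upd_last V1 vS wS aS1 wT) => //; first exact: v_rc V1.
  by rewrite pw.
have hS z : z \in S -> upd g w a z = g z.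
  by move=> zS; rewrite updE //; apply: contraNneq wS => <-.
have xqs : x \notin qs by apply: contra xq => h; rewrite in_cons h orbT.
have hx : upd g w a x = f x by rewrite hS // gout.
have uq5 : uniq [:: q0; q1; q2; q3; q4].
  by have := take_uniq 5 uq; rewrite /= take0.
pose C : {set 'I_5} := [set i : 'I_5 |
  ed (f (nth q0 [:: q0; q1; q2; q3; q4] i)) a \in c].
have cC : #|C| <= 1.
  apply/card_le1_eqP=> i' j'; rewrite !inE => hi hj.
  have nin (m' : 'I_5) : nth q0 [:: q0; q1; q2; q3; q4] m' \in
      [set z in [:: q0; q1; q2; q3; q4]].
    by rewrite inE mem_nth // ltn_ord.
  have /eqP := dd a aS _ _ (nin i') (nin j') hi hj.
  by rewrite nth_uniq ?ltn_ord // => /eqP/val_inj.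
pose M : {set 'I_5} := [set i : 'I_5 | nth q0 [:: q0; q1; q2; q3; q4] i == nth q0 qs m].
have cM : #|M| <= 1.
  apply/card_le1_eqP=> i' j'; rewrite !inE => /eqP hi /eqP hj.
  have /eqP := etrans hi (esym hj).
  by rewrite nth_uniq ?ltn_ord // => /eqP/val_inj.
have [|i1 [j1 [iC iM jC jM ij1]]] := two_left cC cM; first by rewrite card_ord.
have vn z : z \in [:: q0; q1; q2; q3; q4] -> z != v.
  have /and3P[_ /hasPn hh _] : [&& uniq [:: q0; q1; q2; q3; q4],
      ~~ has (mem [:: q0; q1; q2; q3; q4]) qs' & uniq qs'] by rewrite -cat_uniq.
  have vq' : v \in qs'.
    by rewrite /v /qs /=; case: (qs') n' => // u t _; exact: (mem_last u t).
  by move=> z5; have := hh v vq'; rewrite /=; apply: contraNneq => <-.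
have nC (i' : 'I_5) : i' \notin C -> i' \notin M ->
    ed a (f (nth q0 [:: q0; q1; q2; q3; q4] i')) \notin c1.
  set z := nth _ _ _; rewrite !inE -/z => zC zM.
  have z5 : z \in [:: q0; q1; q2; q3; q4] by rewrite mem_nth.
  have zS : z \in S by rewrite QS ?i05.
  have zv := vn z z5.
  apply/negP=> /new[h|[u uQ E]|/ed_inj h|/ed_inj h].
  - by move: zC; rewrite edC h.
  - have := edl a (f z); rewrite E in_ed => /orP[]/eqP h.
      by have := fa v (QS _ vQ); rewrite h eqxx.
    by have := fa u (QS _ uQ); rewrite h eqxx.
  - by move/(v_inj V zS (QS _ vQ)): h => h; rewrite h eqxx in zv.
  - have mS : nth q0 qs m \in S by apply: qsS; rewrite mem_nth // (leq_trans m4).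
    by move/(v_inj V zS mS): h => h; rewrite h eqxx in zM.
have [u1 u1Q u1E] := gpre _ (i05 _ (mem_nth q0 (ltn_ord i1 : i1 < size [:: q0; q1; q2; q3; q4]))).
have [u2 u2Q u2E] := gpre _ (i05 _ (mem_nth q0 (ltn_ord j1 : j1 < size [:: q0; q1; q2; q3; q4]))).
have u12 : u1 != u2.
  apply: contra ij1 => /eqP E; move: u1E; rewrite E u2E => /(v_inj V).
  rewrite !QS ?i05 ?mem_nth // => /(_ isT isT)/eqP.
  by rewrite nth_uniq // eq_sym => /eqP/val_inj->.
have nu u : u \in q0 :: qs -> nth q0 (q0 :: rcons qs w) (index u (q0 :: qs)) = u.
  by move=> uQ; rewrite -rcons_cons nth_rcons index_mem uQ nth_index.
have su u : u \in q0 :: qs -> index u (q0 :: qs) < size (rcons qs w).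
  by move=> uQ; rewrite size_rcons -[(size qs).+1]/(size (q0 :: qs)) index_mem.
have lw : last q0 (rcons qs w) = w by rewrite last_rcons.
have xnc z : z \in rcons qs w -> ed (f x) (upd g w a z) \notin c1.
  have fxQ u : u \in q0 :: qs -> f x != f u.
    by move=> uQ; apply: contraNneq xq => /(v_inj V xS (QS _ uQ)) ->.
  have xa : f x != a by apply: fa.
  have xc e : e \in c1 -> f x \in e -> e \in c.
    case/new=> // [[u uQ ->]|->|->]; rewrite in_ed.
    - by rewrite (negbTE (fxQ _ vQ)) (negbTE (fxQ _ uQ)).
    - by rewrite (negbTE xa) (negbTE (fxQ _ vQ)).
    - rewrite (negbTE xa) (negbTE (fxQ _ _)) // inE mem_nth ?orbT //.
      by rewrite (leq_trans m4).
  rewrite mem_rcons [_ \in w :: _]in_cons => /orP[/eqP->|zq]; apply/negP=> /xc.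
    rewrite upd_same edl => /(_ isT) h.
    have : a \in bad S f c x by rewrite inE aS.
    by rewrite xb inE.
  rewrite edl => /(_ isT); rewrite hS ?qsS //; have [z' z'q ->] := gpost z zq.
  by apply/negP/xun.
apply: (rotate_and_close (k := 0) (q0 := q0) (ps := rcons qs w) (i := index u1 (q0 :: qs))
   (j := index u2 (q0 :: qs)) (t := f x) V2); rewrite ?lw ?nu ?su //.
- by rewrite -rcons_cons rcons_uniq wq uq.
- by move=> z _; rewrite in_setT.
- move=> z; rewrite mem_rcons inE => /orP[/eqP->|]; last exact: qsR.
  by apply: contra wS; apply: (subsetP (v_R V)).
- by move=> u _; apply: qk.
- move=> p pY; have [h1 h2] := qY p pY; have [k1 k2 _] := v_Y V pY.
  have nr z : z \notin qs -> z != w -> z \notin rcons qs w.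
    by move=> zq zw; rewrite mem_rcons in_cons (negbTE zw).
  by split; apply: nr => //; apply: contraNneq wS => <-.
- by apply: contra u12 => /eqP E; rewrite -(nu _ u1Q) E nu.
- by rewrite upd_same hS ?QS // u1E nC.
- by rewrite upd_same hS ?QS // u2E nC.
- move=> z zq; rewrite -hx; apply/eqP=> /(v_inj V2 (in_setT _) (in_setT _)) E.
  move: zq; rewrite E -rcons_cons mem_rcons inE (negbTE xq) orbF => /eqP E'.
  by rewrite -E' xS in wS.
- by apply: xnc; rewrite mem_rcons mem_head.
- by apply: xnc; rewrite mem_nth ?su.
- by apply: xnc; rewrite mem_nth ?su.
move=> g' r2 c2 m' _ gE' V3 er' _ _; apply: (H g' r2 c2) => //.
rewrite (_ : g' x = f x) //; case: gE' => ->; rewrite ?revf_out ?hx //.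
apply/negP=> /mem_drop; rewrite mem_rcons inE (negbTE xqs) orbF => /eqP E.
by rewrite -E xS in wS.
Qed.

Lemma bare_endgame G S f r c Y x us q0 q1 q2 q3 q4 q5 :
  let qs := [:: q1; q2; q3; q4; q5] in
  good S f r c Y -> par x \in S -> path child x us ->
  par q0 \in S -> path child q0 qs -> uniq ((x :: us) ++ (q0 :: qs)) ->
  (x :: us) ++ (q0 :: qs) =i ~: S -> D + 6 <= size us -> D + l + 10 <= K ->
  (forall v, v \notin R -> par v \in qs -> v \in qs) ->
  (forall g r' c', valid setT g r' c' Y ->
     ed (g (last x us)) (g q5) \in r' -> G r' c') ->
  wf G (#|~: S| + 2) r c.
Proof.
move=> qs I pxS px pqS pq u E sz DK qk H; have V := i_valid I.
have cS : #|~: S| = size us + 7.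
  rewrite -(eq_card E) (card_uniqP u) size_cat /=; clear; lia.
have nS z : z \in (x :: us) ++ (q0 :: qs) -> z \notin S by rewrite E in_setC.
have xS : x \notin S by apply: nS; rewrite mem_cat mem_head.
have q0S : q0 \notin S by apply: nS; rewrite mem_cat mem_head orbT.
move: (u); rewrite cat_uniq => /and3P[uxs /hasPn dis uq].
have xus : x \notin us by case/andP: uxs.
have uus : uniq us by case/andP: uxs.
have qnx z : z \in q0 :: qs -> z != x /\ z \notin us.
  by move=> /dis; rewrite /= in_cons negb_or => /andP[].
have bx := bad_le I pxS.
have S1 := card_free_step xS.
have -> : #|~: S| + 2 = (5 + (#|~: S| - 7 + 2)).+2 by rewrite cS; clear; lia.
apply: (step_avoid (X := bad S f c (par x)) I xS pxS) => //.
- by rewrite cS; move: bx sz; arith.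
- by move: bx DK; arith.
set Sx := x |: S in S1 *; move=> y1 y1' r1 y1S y1'S yy1 _ _ c1 I1.
have q0Sx : q0 \notin Sx.
  by rewrite in_setU1 negb_or q0S andbT; case: (qnx q0 (mem_head _ _)).
have pqSx : par q0 \in Sx by rewrite in_setU1 pqS orbT.
have bq := bad_le I1 pqSx; have S2 := card_free_step q0Sx.
have xb1 : bad Sx (upd f x y1) c1 x = set0 by apply: (bad_new V).
apply: (step_avoid (X := bad Sx (upd f x y1) c1 (par q0)) I1 q0Sx pqSx) => //.
- by move: S1; rewrite cS addnS => -[<-]; move: bq sz; arith.
- by move: bq DK; arith.
set Sq := q0 |: Sx in S2 *; move=> y2 y2' r2 y2S y2'S yy2 _ _ c2 I2.
have V1 := i_valid I1.
have E2 : ext [set x] Sx (upd f x y1) c1 Sq (upd (upd f x y1) q0 y2) c2.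
  apply: (ext_step V1) => //; first by rewrite sub1set setU11.
  by rewrite in_set1; apply: contraNneq xS => <-.
have xb2 : bad Sq (upd (upd f x y1) q0 y2) c2 x = set0.
  by apply/eqP; rewrite -subset0 -xb1; apply: bad_ext E2 (set11 _).
have qb2 : bad Sq (upd (upd f x y1) q0 y2) c2 q0 = set0 by apply: (bad_new V1).
have cSq : #|~: Sq| = size us + 5.
  by move: S1 S2; rewrite cS; clear; move: #|~: Sx| #|~: Sq|; lia.
have qsSq : {in qs, forall z, z \notin Sq}.
  move=> z zq; rewrite !in_setU1 !negb_or.
  have [zx _] := qnx z (mem_behead (s := q0 :: qs) zq).
  rewrite zx nS ?mem_cat ?[_ \in q0 :: _]in_cons ?zq ?orbT // !andbT.
  by apply: contraTneq zq => ->; case/andP: uq.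
have uqs : uniq qs by case/andP: uq.
apply: (@path_dist G _ qs Sq _ r2 c2 Y q0 set0 0 I2) => //.
- exact: setU11.
- exact: sub0set.
- by rewrite inE.
- by rewrite big_set0 cards0.
- by move=> y _ z; rewrite inE.
- by move=> z; rewrite inE.
- by rewrite cSq [size qs]/=; move: sz; arith.
- by move: DK; rewrite [size qs]/=; arith.
move=> f3 r3 c3 S3 Q3 I3 E3 e3 b5 _ dd l5.
have V3 := i_valid I3.
have S3E : us =i ~: S3.
  have inS3 z : (z \in S3) = [|| z \in q0 :: qs, z == x | z \in S].
    rewrite in_setU [z \in [set _ in _]]in_set !in_setU1 [z \in q0 :: _]in_cons.
    by case: (z == q0); case: (z == x); case: (z \in S); case: (z \in qs).
  move=> z; rewrite in_setC inS3; apply/idP/norP=> [zus|[zq /norP[zx zS]]].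
    split; first by apply/negP=> /qnx[_]; rewrite zus.
    apply/norP; split; first by apply: contraTneq zus => ->.
    by apply: nS; rewrite mem_cat in_cons zus orbT.
  have := E z; rewrite in_setC zS mem_cat in_cons (negbTE zx) (negbTE zq) orbF.
  by move=> /esym.
have cS3 : #|~: S3| = #|~: S| - 7.
  by rewrite -(eq_card S3E) (card_uniqP uus) cS addnK.
rewrite -cS3.
have xSq : x \in Sq by rewrite in_setU1 in_setU1 eqxx orbT.
have xq0 : x != q0 by rewrite eq_sym; case: (qnx q0 (mem_head _ _)).
have Q3E z : z \in [:: q0; q1; q2; q3; q4] -> z \in Q3.
  by move=> h; rewrite in_setU [z \in [set _ in _]]in_set h orbT.
apply: (chain_endgame (x := x) (us := us) (q0 := q0) (q1 := q1)
  (q2 := q2) (q3 := q3) (q4 := q4) (q5 := q5) V3) => //.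
- by rewrite in_setU xSq.
- apply/eqP; rewrite -subset0 -xb2; apply: bad_ext E3 _.
  by rewrite in_setD1 xq0.
- by apply: leq_trans sz; rewrite leq_addl.
- by rewrite in_setU setU11.
- by move=> z zq; rewrite in_setU [z \in [set _ in _]]in_set zq orbT.
- move=> z /qsSq; apply: contra => zR; rewrite !in_setU1.
  by rewrite (subsetP (v_R V) _ zR) !orbT.
- apply/negP=> xq; have := qnx x xq; by rewrite eqxx => -[].
- move=> p pY; have [h1 h2 _] := v_Y V pY.
  by split; [apply: contraL h1|apply: contraL h2] => zq; apply: nS;
    rewrite mem_cat [_ \in q0 :: _]in_cons zq !orbT.
- by move=> y /dd h a b; rewrite !in_set => ha hb; apply: h; apply: Q3E.
move=> z zq; apply: l5.
  by apply: Q3E; move: zq; rewrite !inE => /or4P[->|->|->|->]; rewrite ?orbT.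
have -> : par (last q0 qs) = q4 by move: pq; rewrite /= => /and5P[_ _ _ _ /andP[/eqP]].
have u04 : q4 \notin [:: q0; q1; q2; q3].
  move: uq; rewrite -[q0 :: qs]/([:: q0; q1; q2; q3] ++ [:: q4; q5]) cat_uniq.
  by case/and3P=> _ /hasPn hh _; apply: hh; rewrite mem_head.
by apply: contraNneq u04 => <-.
Qed.

Lemma pure_endgame G S f r c Y x rs :
  good S f r c Y -> uniq (x :: rs) -> {in x :: rs &, injective lab} ->
  {in x :: rs, forall x, [/\ x \in R, top x \in R, top x != x,
     lab (top x) = lab x & path child (top x) (pth x)]} ->
  {in x :: rs, forall x, uniq (pth x) /\ 6 <= size (pth x)} ->
  {in x :: rs, forall x z, z \in pth x -> lab z = lab x /\ z \notin S} ->
  (forall v, v \in S -> v \notin R -> lab v \notin map lab (x :: rs)) ->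
  flatten (map pth (x :: rs)) =i ~: S -> 12 <= #|~: S| -> l + 10 <= K ->
  (forall u, u \notin R -> par u \in pth x -> u \in pth x) ->
  (forall g r' c' Y', valid setT g r' c' Y' ->
     (forall p, p \in Y' = (p \in Y) || (p \in [seq (x, last (top x) (pth x)) | x <- rs])) ->
     ed (g x) (g (last (top x) (pth x))) \in r' -> G r' c') ->
  wf G (#|~: S| + 2 * size (x :: rs) + 1) r c.
Proof.
move=> I u linj tP pP pS sS fE S12 lK kx H; have V := i_valid I.
have RS := subsetP (v_R V).
have xx : x \in x :: rs by apply: mem_head.
have rsx y : y \in rs -> y \in x :: rs by move=> h; rewrite in_cons h orbT.
have [xR tR tx lt pq] := tP x xx; have [upx s6] := pP x xx.
have pxS := pS x xx.
have fr z : z \in R -> lab z = lab x -> bad S f c z = set0.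
  move=> zR lz; apply: (fresh_bad I) => // v vS vR.
  apply: contraNneq (sS v vS vR) => vz.
  by rewrite -lab_par // vz lz mem_head.
have xrs : x \notin rs by case/andP: u.
have lxrs : lab x \notin map lab rs.
  apply/mapP=> -[y yrs /linj E]; move: xrs; rewrite (E _ (rsx y yrs)) ?yrs //.
have urs : uniq rs by case/andP: u.
have pdis y z : y \in rs -> z \in pth y -> z \notin pth x.
  move=> yrs zy; have [lz _] := pS y (rsx y yrs) z zy; apply/negP=> /pxS[lzx _].
  by move: lxrs; rewrite -lzx lz map_f.
have cS : #|~: S| = size (pth x) + size (flatten (map pth rs)).
  have uf : uniq (flatten (map pth (x :: rs))).
    apply: uniq_flatten => // [y yx|y z t yx zx ty tz]; first by case: (pP y yx).
    have [ly _] := pS y yx t ty; have [lz _] := pS z zx t tz.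
    by apply: linj => //; rewrite -ly lz.
  by rewrite -(eq_card fE) (card_uniqP uf) /= size_cat.
set w := last (top x) (pth x) in H.
move: s6 upx pq pxS kx pdis fE cS @w H.
case Ep: (pth x) => [|q1 [|q2 [|q3 [|q4 [|q5 rest]]]]] // s6.
case/lastP: rest Ep s6 => [|rest' w'] // Ep _ upx pq pxS kx pdis fE cS w H.
have wE : w = w' by rewrite /w /= last_rcons.
rewrite {}wE in H *; clear w; move: w' => w in Ep upx pq pxS kx pdis fE cS H *.
set q0 := top x in tR tx lt pq H.
pose p1 := [:: q1; q2; q3; q4; q5].
pose qs := [:: q1, q2, q3, q4, q5 & rest'].
have EE : [:: q1, q2, q3, q4, q5 & rcons rest' w] = rcons qs w by [].
rewrite EE in upx pq pxS kx pdis cS.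
have p1s : {subset p1 <= rcons qs w}.
  move=> z; rewrite mem_rcons in_cons -[qs]/(p1 ++ rest') mem_cat => ->.
  by rewrite orbT.
have p1S : {in p1, forall z, z \notin S} by move=> z /p1s/pxS[].
have q0S : q0 \in S by apply: RS.
have upw : uniq (p1 ++ (rest' ++ [:: w])) by rewrite catA cats1.
move: (upw); rewrite cat_uniq => /and3P[up1 /hasPn dis1].
rewrite cat_uniq => /and3P[urest /hasPn disw _].
have pw1 : path child q0 (p1 ++ (rest' ++ [:: w])) by rewrite catA cats1.
move: (pw1); rewrite cat_path => /andP[pp1]; rewrite cat_path => /andP[prest _].
have szx : #|~: S| = 5 + (size rest' + 1) + size (flatten (map pth rs)).
  by rewrite cS size_rcons /=; arith.
have -> : #|~: S| + 2 * size (x :: rs) + 1 =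
    5 + (size (flatten (map pth rs)) + 2 * size rs + (size rest' + 4)).
  by rewrite szx /=; arith.
apply: (@path_dist G _ p1 S f r c Y q0 set0 0 I) => //.
- exact: fr.
- exact: sub0set.
- by rewrite inE.
- by rewrite big_set0 cards0.
- by move=> y _ z; rewrite inE.
- by move=> z; rewrite inE.
- by apply: leq_trans S12.
- by move: lK; rewrite [size p1]/=; clear; lia.
move=> f1 r1 c1 S1 Q1 I1 E1 e1 b5 _ dd l5.
have V1 := i_valid I1.
have cS1 : #|~: S1| = size rest' + 1 + size (flatten (map pth rs)).
  have := card_free_seq up1 p1S; rewrite -/S1 szx [size p1]/=; arith.
have p1S1 z : z \in p1 -> z \in S1 by move=> zp; rewrite in_setU [z \in [set _ in _]]in_set zp orbT.
have SS1 : S \subset S1 by apply: subsetUl.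
have labp1 z : z \in p1 -> lab z = lab x by move=> /p1s/pxS[].
have pathS1 y z : y \in rs -> z \in pth y -> lab z = lab y /\ z \notin S1.
  move=> yrs zy; have [h1 h2] := pS y (rsx y yrs) z zy; split=> //.
  rewrite in_setU negb_or h2 in_set; apply: contra (pdis y z yrs zy); exact: p1s.
apply: (close_all (rs := rs) I1) => //.
- by move=> a b ha hb; apply: linj; apply: rsx.
- by move=> y /rsx; apply: tP.
- by move=> y /rsx/pP[h1 h2]; split=> //; apply: leq_trans h2.
- by move=> y yrs z; apply: pathS1.
- move=> v; rewrite in_setU [v \in [set _ in _]]in_set => /orP[vS|/labp1->] vR //.
  by have := sS v vS vR; rewrite in_cons negb_or => /andP[].
- by rewrite cS1; clear; move: (size _) (size _); lia.
- by move: lK; clear; lia.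
set S2 := S1 :|: _ => f2 r2 c2 Y2 I2 E2 Y2E.
have SS2 : S1 \subset S2 by apply: subsetUl.
have q05 : {subset q0 :: p1 <= S1}.
  by move=> z; rewrite in_cons => /orP[/eqP->|/p1S1//]; apply: (subsetP SS1).
have labq z : z \in q0 :: p1 -> lab z = lab x.
  by rewrite in_cons => /orP[/eqP->|/labp1].
pose W := x |: [set z in q0 :: p1].
have WS1 : W \subset S1.
  apply/subsetP=> z; rewrite in_setU1 in_set => /orP[/eqP->|]; last exact: q05.
  by apply: (subsetP SS1); apply: RS.
have E2W : ext W S1 f1 c1 S2 f2 c2.
  apply: E2 => // z; rewrite in_setU1 in_set => /orP[/eqP->|/labq->] //.
have q5W : q5 \in W by rewrite in_setU1 in_set !in_cons eqxx !orbT.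
have b5' : bad S2 f2 c2 q5 = set0.
  by apply/eqP; rewrite -subset0 -b5; apply: bad_ext E2W q5W.
have rS2 z : z \in rest' ++ [:: w] -> z \notin S2.
  move=> zr; have zp : z \in rcons qs w by rewrite -cats1 -[qs]/(p1 ++ rest') -catA mem_cat zr orbT.
  have zp1 : z \notin p1 := dis1 z zr.
  rewrite in_setU negb_or in_setU negb_or ![z \in [set _ in _]]in_set (negbTE zp1).
  have [_ ->] := pxS z zp; apply/negP=> /flattenP[_ /mapP[y yrs ->] zy].
  by have := pdis y z yrs zy; rewrite zp.
have cS2 : #|~: S2| = size rest' + 1.
  have uf : uniq (rest' ++ [:: w]) by have := upw; rewrite cat_uniq => /and3P[].
  have E3 : rest' ++ [:: w] =i ~: S2.
    move=> z; rewrite in_setC; apply/idP/idP=> [/rS2//|].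
    rewrite !in_setU ![z \in [set _ in _]]in_set => /norP[/norP[zS zp1] zf].
    have : z \in rcons qs w ++ flatten (map pth rs) by move: (fE z); rewrite in_setC zS -EE -Ep.
    by rewrite mem_cat (negbTE zf) orbF -cats1 -[qs]/(p1 ++ rest') -catA mem_cat (negbTE zp1).
  by rewrite -(eq_card E3) (card_uniqP uf) size_cat.
apply: (path_plain I2 _ b5' prest urest) => //.
- by apply: (subsetP SS2); apply: p1S1; rewrite !in_cons eqxx !orbT.
- by move=> z zr; apply: rS2; rewrite mem_cat zr.
- by rewrite cS2 addn1.
- by move: lK; clear; lia.
move=> f3 r3 c3 S3 I3 E3 bl e3 _; have V3 := i_valid I3.
have SS3 : S2 \subset S3 by apply: subsetUl.
have wS3 : w \notin S3.
  rewrite in_setU [w \in [set _ in _]]in_set negb_or rS2 ?mem_cat ?mem_head ?orbT //=.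
  by apply: disw; rewrite mem_head.
have rrS2 : {in rest', forall z, z \notin S2}.
  by move=> z zr; apply: rS2; rewrite mem_cat zr.
have cS3 : #|~: S3| = 1.
  have := card_free_seq urest rrS2; rewrite cS2 -/S3 [_ + 1]addnC => /eqP.
  by rewrite eqn_add2r eq_sym => /eqP.
have wT : w |: S3 = setT.
  apply/eqP; rewrite eqEsubset subsetT /=; apply/subsetP=> z _.
  have /cards1P[z0 zE] : #|~: S3| == 1 by rewrite cS3.
  have : w \in ~: S3 by rewrite in_setC.
  rewrite zE => /set1P w0; rewrite in_setU1; case zS: (z \in S3); rewrite ?orbT //.
  have : z \in ~: S3 by rewrite in_setC zS.
  by rewrite zE w0 => /set1P->; rewrite eqxx.
have SS03 : S \subset S3 by apply: subset_trans SS1 (subset_trans SS2 SS3).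
have W5 : W :\ q5 \subset S2 :\ q5.
  by apply: setSD; apply: subset_trans SS2.
have E13 : ext (W :\ q5) S1 f1 c1 S3 f3 c3.
  by apply: ext_trans (ext_sub _ E2W) (ext_sub W5 E3); apply: subsetDl.
have q5S : q5 \notin S by apply: p1S; rewrite !in_cons eqxx !orbT.
have x5 : x != q5 by apply: contraNneq q5S => <-; apply: RS.
have xW : x \in W :\ q5 by rewrite in_setD1 x5 in_setU1 eqxx.
have u0 : uniq (q0 :: p1).
  by rewrite cons_uniq up1 andbT; apply: contraL q0S => /p1S.
have q45 z : z \in [:: q0; q1; q2; q3; q4] -> z \in W :\ q5.
  move=> zq; rewrite in_setD1 in_setU1 in_set; apply/andP; split.
    have := u0; rewrite -[q0 :: p1]/([:: q0; q1; q2; q3; q4] ++ [:: q5]) cat_uniq.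
    case/and3P=> _ /hasPn hh _; have := hh q5 (mem_head _ _); rewrite /=.
    by apply: contraNneq => <-.
  by rewrite -[q0 :: p1]/([:: q0; q1; q2; q3; q4] ++ [:: q5]) mem_cat zq orbT.
have f31 z : z \in S1 -> f3 z = f2 z by move=> zS; rewrite e3 // (subsetP SS2).
have eW z : z \in W :\ q5 -> f3 z = f1 z by case: E13 => _ _ e _ /e.
have Q1E z : z \in [:: q0; q1; q2; q3; q4] -> z \in Q1.
  by move=> h; rewrite in_setU [z \in [set _ in _]]in_set h orbT.
have col z y : z \in W :\ q5 -> ed (f3 z) y \in c3 -> ed (f1 z) y \in c1.
  move=> zW h; have [_ _ _ nn] := E13.
  by rewrite -(eW z zW); apply: (nn z) => //; rewrite -(eW z zW) edl.
have qsS3 : {subset qs <= S3}.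
  move=> z; rewrite -[qs]/(p1 ++ rest') mem_cat => /orP[/p1S1 h|h].
    by apply: (subsetP SS3); apply: (subsetP SS2).
  by rewrite in_setU [z \in [set _ in _]]in_set h orbT.
have qsw z : z \in qs -> z \in rcons qs w by move=> h; rewrite mem_rcons in_cons h orbT.
have xS3 : x \in S3 by apply: (subsetP SS03); apply: RS.
have f3p z : z \in q0 :: p1 -> f3 z = f1 z.
  move=> zq; rewrite f31 ?q05 //; have [_ _ e2 _] := E2W.
  by rewrite e2 // in_setU1 in_set zq orbT.
have f1S z : z \in p1 -> f1 z \notin f @: S.
  move=> zp; apply/imsetP=> -[y yS]; rewrite -e1 // => h.
  have := p1S z zp; rewrite (_ : z = y) ?yS //.
  by apply: (v_inj V1) h; [exact: p1S1|exact: (subsetP SS1)].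
have f3r z : z \in rest' -> f3 z \notin f1 @: S1.
  move=> zr; have [im _ _ _] := E2W; apply/negP=> /(subsetP im)/imsetP[y yS2].
  rewrite -e3 // => h; have := rrS2 z zr; rewrite (_ : z = y) ?yS2 //.
  apply: (v_inj V3) h; last exact: (subsetP SS3).
  by rewrite in_setU [z \in [set _ in _]]in_set zr orbT.
have xq0 : x \in S :\ q0 by rewrite in_setD1 eq_sym tx RS.
have bx1 : bad S1 f1 c1 x = set0.
  by apply/eqP; rewrite -subset0 -(fr x xR erefl); apply: bad_ext E1 xq0.
have yS3 y : y \notin f3 @: S3 -> y \notin f1 @: S1.
  by case: E13 => im _ _ _; apply: contra; apply: (subsetP im).
apply: (path_endgame (x := x) (w := w) (q0 := q0) (q1 := q1) (q2 := q2) (q3 := q3)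
  (q4 := q4) (qs' := q5 :: rest') V3) => //.
- by apply/eqP; rewrite -subset0 -bx1; apply: bad_ext E13 xW.
- exact: (subsetP SS03).
- have := upw; rewrite catA cats1 rcons_uniq -[p1 ++ rest']/qs => /andP[_ uq].
  rewrite cons_uniq uq andbT; apply: contraL q0S => /qsw/pxS[] //.
- move=> z /qsw/pxS[_]; apply: contra; exact: RS.
- rewrite in_cons negb_or eq_sym tx /=; apply: contraL xR => /qsw/pxS[_].
  by apply: contra; apply: RS.
- move=> p; rewrite Y2E => /orP[pY|/mapP[y yrs ->]].
    have [h1 h2 _] := v_Y V pY.
    by split; [apply: contraL h1|apply: contraL h2] => /qsw/pxS[].
  have yx := rsx y yrs; have [yR _ _ _ _] := tP y yx; have [_ sy] := pP y yx.
  split=> /=; first by apply: contraL yR => /qsw/pxS[_]; apply: contra; apply: RS.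
  have ly : last (top y) (pth y) \in pth y by case: (pth y) sy => // a t _; apply: (mem_last a t).
  by apply: contra (pdis y _ yrs ly); apply: qsw.
- move=> z; rewrite -[_ :: _]/(p1 ++ rest') mem_cat => /orP[zp|zr]; apply/negP=> /(col x _ xW).
    rewrite f3p; last by rewrite in_cons zp orbT.
    move=> h.
    have [_ _ _ n1] := E1; have := n1 x _ xq0 h; rewrite e1 ?RS // edl => /(_ isT) h'.
    have : f1 z \in bad S f c x by rewrite inE f1S.
    by rewrite (fr x xR erefl) inE.
  move=> h; have : f3 z \in bad S1 f1 c1 x by rewrite inE f3r.
  by rewrite bx1 inE.
- move=> y yS a b; rewrite !in_set => ha hb /(col a _ (q45 a ha)) h /(col b _ (q45 b hb)) h'.
  by apply: (dd y (yS3 y yS)) h h'; apply: Q1E.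
- have q4' z : z \in [:: q0; q1; q2; q3] -> z \in [:: q0; q1; q2; q3; q4].
    by rewrite -[[:: q0; q1; q2; q3; q4]]/([:: q0; q1; q2; q3] ++ [:: q4]) mem_cat => ->.
  move=> a b; rewrite !in_set => ha hb.
  move=> /(col a _ (q45 a (q4' a ha))) h /(col b _ (q45 b (q4' b hb))) h'.
  case Er: rest' h h' => [|z t] h h'.
    have p5 : par q5 = q4 by move: pp1; rewrite /= => /and5P[_ _ _ _ /andP[/eqP]].
    have := l5 a (Q1E a (q4' a ha)); rewrite /= p5 f3p ?in_cons ?eqxx ?orbT // in h *.
    rewrite h; suff -> : a != q4 by move/(_ isT).
    have := u0; rewrite -[q0 :: p1]/([:: q0; q1; q2; q3] ++ [:: q4; q5]) cat_uniq.
    by case/and3P=> _ /hasPn hh _; have := hh q4 (mem_head _ _); apply: contraNneq => <-.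
  have lz : last q0 [:: q1, q2, q3, q4, q5, z & t] \in rest'.
    by rewrite Er; apply: (mem_last z t).
  by apply: (dd _ (f3r _ lz)) h h'; apply: Q1E; apply: q4'.
move=> g r' c' Vg ed_; apply: (H g r' c' Y2) => //.
Qed.

(** * From the empty board to an endgame *)

Lemma good_init : {in R &, injective phi} -> good R phi set0 set0 [::].
Proof.
move=> pI; split; first split=> //; try by move=> v ->.
- by move=> x y _ _; rewrite inE.
- move=> u _; rewrite (_ : bad _ _ _ _ = set0) ?cards0 //.
  by apply/setP=> y; rewrite !inE andbF.
move=> _; apply: (@leq_trans (\sum_(a : T) 1)); last by rewrite sum1_card card_ord.
rewrite big_mkcond /=; apply: leq_sum => a _; case: ifP => // _.
rewrite (_ : dg _ _ = 0) //; apply/eqP; rewrite cards_eq0.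
by apply/eqP/setP=> e; rewrite !inE.
Qed.

(** The paths between two roots come first, while these roots are clean; the rest of [S] is then
    filled greedily, the vertices outside [S] providing the reserve [D + 3]. *)
Lemma build G k S rs :
  {in R &, injective phi} -> R \subset S -> uniq rs -> {in rs &, injective lab} ->
  {in rs, forall x, [/\ x \in R, top x \in R, top x != x,
     lab (top x) = lab x & path child (top x) (pth x)]} ->
  {in rs, forall x, uniq (pth x) /\ 5 <= size (pth x)} ->
  {in rs, forall x z, z \in pth x -> [/\ lab z = lab x, z \notin R & z \in S]} ->
  (forall v, v \in S -> v \notin R -> par v \in S) ->
  D + 3 <= #|~: S| -> D + l + 5 <= K ->
  (forall f r c Y, good S f r c Y ->
     (forall p, p \in Y = (p \in [seq (x, last (top x) (pth x)) | x <- rs])) ->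
     wf G k r c) ->
  wf G (#|S :\: R| + 2 * size rs + k) set0 set0.
Proof.
move=> pI RS urs linj tP pP zP parS cS lK H.
set F := flatten (map pth rs).
have FS z : z \in F -> z \notin R /\ z \in S.
  by move=> /flattenP[_ /mapP[y yrs ->] zy]; case: (zP y yrs z zy).
have uF : uniq F.
  apply: uniq_flatten => // [y yx|y z t yx zx ty tz]; first by case: (pP y yx).
  have [ly _ _] := zP y yx t ty; have [lz _ _] := zP z zx t tz.
  by apply: linj => //; rewrite -ly lz.
pose S1 := R :|: [set z in F]; pose U := S :\: S1.
have F_R : {in F, forall z, z \notin R} by move=> z /FS[].
have cR := card_free_seq uF F_R; rewrite -/S1 in cR.
have S1S : S1 \subset S.
  by apply/subsetP=> z; rewrite in_setU in_set => /orP[/(subsetP RS)|/FS[]].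
have SU : S1 :|: U = S.
  by rewrite -[RHS](setID S S1) (setIidPr S1S).
have cU : #|~: S1| = #|U| + #|~: S|.
  have := cardsID (~: S) (~: S1); rewrite -setCU (setUidPr S1S) => <-.
  by rewrite addnC setDE setCK setIC -setDE.
have cD : #|S :\: R| = size F + #|U|.
  have := cardsID (~: S) (~: R); rewrite -setCU (setUidPr RS) => h.
  have E : (~: R) :\: (~: S) = S :\: R by rewrite setDE setCK setIC -setDE.
  apply/eqP; rewrite -(eqn_add2l #|~: S|) -E h cR cU.
  by rewrite [#|U| + _]addnC -addnA [#|U| + _]addnC.
rewrite cD (_ : _ + _ + k = size F + 2 * size rs + (#|U| + k)); last by arith.
apply: (close_all (rs := rs) (good_init pI)) => //.
- by move=> x xrs z zx; have [h1 h2 _] := zP x xrs z zx.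
- by move=> v ->.
- by rewrite cR cU; move: cS; move: (size _) #|U| #|~: S|; clear; lia.
- by move: lK; clear; lia.
move=> f r c Y I _ YE.
apply: (greedy_fill (U := U) erefl I) => //.
- by move=> v; rewrite in_setD => /andP[].
- move=> v; rewrite in_setD -/F -/S1 SU => /andP[vS1 vS]; apply: parS => //.
  by apply: contra vS1 => vR; rewrite in_setU vR.
- by rewrite -/F -/S1 cU -addnA leq_add2l.
- by move: lK; clear; lia.
rewrite -/F -/S1 SU => f' r' c' I'; exact: (H f' r' c' Y).
Qed.

End Play.

(** * Rooted forests *)

Section Forest.
Variables (n : nat) (Rt R1 : {set 'I_n}) (par rt phi : 'I_n -> 'I_n).
Variables (dep : 'I_n -> nat) (l D : nat).
Notation T := 'I_n.
Implicit Types (S : {set T}) (f : T -> T) (r c : {set {set T}}) (u v w x y z : T).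
Hypothesis R1s : R1 \subset Rt.
Hypothesis dep_par : forall v, v \notin R1 -> dep (par v) < dep v.
Hypothesis rt_par : forall v, v \notin R1 -> rt (par v) = rt v.
Hypothesis rt_R1 : {in R1, forall x, rt x = x}.
Notation R2 := (Rt :\: R1).
(** [R1] holds one root of each component, and [rt] names the component by it. Injectivity on the
    other roots says that no component has a third root. *)
Hypothesis rt_inj : {in R2 &, injective rt}.
Hypothesis up7 : {in R2, forall x i, i < 7 -> iter i par x \notin R1}.
Hypothesis kid_R1 : {in R1, forall x, exists2 v, v \notin R1 & par v = x}.
Hypothesis kidsD : forall u, #|[set v | (v \notin R1) && (par v == u)]| <= D.
Hypothesis nl : n < 2 ^ l.+1.
Hypothesis phi_inj : {in Rt &, injective phi}.

Definition copied r := exists f, [/\ injective f,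
  forall v, v \notin R1 -> ed (f v) (f (par v)) \in r & {in Rt, f =1 phi}].

Let dep_par' v : v \notin Rt -> dep (par v) < dep v.
Proof. by move=> vR; apply: dep_par; apply: contra vR; apply: (subsetP R1s). Qed.

Let rt_par' v : v \notin Rt -> rt (par v) = rt v.
Proof. by move=> vR; apply: rt_par; apply: contra vR; apply: (subsetP R1s). Qed.

Let kidsD' u : #|[set v | (v \notin Rt) && (par v == u)]| <= D.
Proof.
apply: leq_trans (kidsD u); apply: subset_leq_card; apply/subsetP=> v.
by rewrite !inE => /andP[vR ->]; rewrite andbT; apply: contra vR; apply: (subsetP R1s).
Qed.

(** * Heights and the paths between two roots *)

Lemma up_ex v : exists i, iter i par v \in R1.
Proof.
have [m] := ubnP (dep v); elim: m v => // m IH v; rewrite ltnS => dm.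
have [vR|vR] := boolP (v \in R1); first by exists 0.
have [|i iR] := IH (par v); first by apply: leq_trans dm; apply: dep_par.
by exists i.+1; rewrite iterSr.
Qed.

Definition ht v := ex_minn (up_ex v).

Lemma ht_in v : iter (ht v) par v \in R1.
Proof. by rewrite /ht; case: ex_minnP. Qed.

Lemma ht_min v i : i < ht v -> iter i par v \notin R1.
Proof.
rewrite /ht; case: ex_minnP => m _ h im; apply/negP=> /h.
by rewrite leqNgt im.
Qed.

Lemma rt_iter v i : i <= ht v -> rt (iter i par v) = rt v.
Proof.
elim: i => //= i IH im; rewrite rt_par ?IH //; last exact: ht_min.
exact: ltnW.
Qed.

Lemma iter_ht v : iter (ht v) par v = rt v.
Proof. by rewrite -(rt_iter (leqnn _)) rt_R1 // ht_in. Qed.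

Lemma rt_in v : rt v \in R1.
Proof. by rewrite -iter_ht ht_in. Qed.

Lemma ht7 x : x \in R2 -> 7 <= ht x.
Proof.
move=> xR; rewrite leqNgt; apply/negP=> h.
by have := up7 xR h; rewrite ht_in.
Qed.

(** The path from [rt x] down to [x] without these two roots. The edge from its last vertex [par x]
    to [x] is the one gained by rotation; height at least 7 gives at least six vertices. *)
Definition pth x := rev (traject par (par x) (ht x).-1).

Lemma mem_pth x z :
  reflect (exists2 i, 0 < i < ht x & z = iter i par x) (z \in pth x).
Proof.
rewrite mem_rev; apply: (iffP trajectP) => [[i ih ->]|[[|i] // /andP[_ ih] ->]].
  by exists i.+1; rewrite ?iterSr //=; move: ih; case: (ht x).
by exists i; rewrite ?iterSr //; move: ih; case: (ht x).
Qed.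

Lemma Rt_rt x z : x \in R2 -> z \in Rt -> rt z = rt x -> z != x -> z = rt x.
Proof.
move=> xR zR zx; have [z1 _|z1] := boolP (z \in R1); first by rewrite -zx rt_R1.
by rewrite (rt_inj _ xR zx) ?eqxx // in_setD z1.
Qed.

Lemma dep_iter v i j : i < j <= ht v -> dep (iter j par v) < dep (iter i par v).
Proof.
case/andP=> ij jh; elim: j ij jh => // j IH; rewrite ltnS leq_eqVlt.
case/predU1P=> [->|ij] jh; first by rewrite iterS dep_par // ht_min.
rewrite iterS; apply: ltn_trans (IH ij (ltnW jh)).
by apply: dep_par; apply: ht_min.
Qed.

Lemma pth_out x z : x \in R2 -> z \in pth x ->
  [/\ z \notin Rt, rt z = rt x & z \notin R1].
Proof.
move=> xR /mem_pth[i /andP[i0 ih] ->]; set z' := iter i par x.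
have zz : rt z' = rt x by apply: rt_iter; apply: ltnW.
have zR : z' \notin R1 by apply: ht_min.
split=> //; apply: contra zR => zR; rewrite (Rt_rt xR zR zz) ?rt_in //.
apply/eqP=> h; have := @dep_iter x 0 i; rewrite i0 (ltnW ih) => /(_ isT).
by rewrite -/z' h ltnn.
Qed.

Lemma pth_ok x : x \in R2 ->
  [/\ path (child par) (rt x) (pth x), uniq (pth x), 6 <= size (pth x),
   last (rt x) (pth x) = par x & rt x != x].
Proof.
move=> xR; have h7 := ht7 xR; have [m hE] : exists m, ht x = m.+2.
  by case: (ht x) h7 => [|[|m]] // _; exists m.
split.
- have := rev_path (child par) (par x) (traject par (par (par x)) m.+1).
  rewrite last_traject -iterSr -hE iter_ht /pth hE [m.+2.-1]/=.
  rewrite (_ : belast _ _ = traject par (par x) m.+1); last first.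
    by rewrite [traject _ (par (par x)) _]trajectSr belast_rcons.
  by move=> ->; apply: fpath_traject.
- rewrite rev_uniq; apply/(uniqP (par x)) => i j; rewrite !inE size_traject => ih jh.
  rewrite !nth_traject // -!iterSr => e.
  wlog ij : i j ih jh e / i < j.
    by move=> hw; case: (ltngtP i j) => // ij; [|symmetry]; apply: hw.
  have h : i.+1 < j.+1 <= ht x by rewrite ltnS ij; move: jh; rewrite hE => /ltnW.
  by have := dep_iter h; rewrite e ltnn.
- by rewrite size_rev size_traject; move: h7; case: (ht x).
- by rewrite /pth hE /= rev_cons last_rcons.
by apply: contraTneq xR => <-; rewrite in_setD rt_in.
Qed.

(** Induction from kids to parents, well founded because [dep] increases towards the kids and is
    bounded on a finite set. *)
Lemma down_ind (P : T -> Prop) :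
  (forall v, (forall u, u \notin R1 -> par u = v -> P u) -> P v) -> forall v, P v.
Proof.
move=> H v; have [m] := ubnP (\max_u dep u - dep v).
elim: m v => // m IH v; rewrite ltnS => hm; apply: H => u uR uv; apply: IH.
have := dep_par uR; rewrite uv => d1; have d2 : dep u <= \max_u dep u by apply: leq_bigmax.
by move: hm d1 d2; move: (\max_u _) (dep _) (dep _); clear; lia.
Qed.

(** * Many leaf parents *)

Definition childless v := [forall u, (u \notin R1) ==> (par u != v)].
Definition nonroot_leaves := [set v | (v \notin Rt) && childless v].
Definition leaf_parents := par @: nonroot_leaves.

Lemma childlessPn v : ~~ childless v -> exists2 u, u \notin R1 & par u = v.
Proof.
rewrite negb_forall => /existsP[u]; rewrite negb_imply negbK => /andP[uR /eqP].
by exists u.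
Qed.

Lemma par_leaves u : u \notin R1 -> par u \notin nonroot_leaves.
Proof.
by move=> uR; rewrite inE; apply/negP=> /andP[_ /forallP/(_ u)]; rewrite uR eqxx.
Qed.

Lemma pth_leaves x z : x \in R2 -> z \in pth x -> z \notin nonroot_leaves.
Proof.
move=> xR /mem_pth[[|i] // /andP[_ ih] ->]; apply: par_leaves.
by apply: ht_min; apply: ltnW.
Qed.

Lemma build_all G k K S (A : {set T}) :
  A \subset R2 -> Rt \subset S -> {in A, forall x, {subset pth x <= S}} ->
  (forall v, v \in S -> v \notin Rt -> par v \in S) ->
  D + 3 <= #|~: S| -> D + l + 5 <= K ->
  (forall f r c Y, good Rt par phi K S f r c Y ->
     (forall p, p \in Y = (p \in [seq (x, par x) | x <- enum A])) ->
     wf G k r c) ->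
  wf G (#|S :\: Rt| + 2 * #|A| + k) set0 set0.
Proof.
move=> /subsetP A2 RS pS parS cS lK H; rewrite [#|A|]cardE.
have AR x : x \in enum A -> x \in R2 by rewrite mem_enum => /A2.
apply: (build (K := K) nl rt_par' dep_par' kidsD' (top := rt) (pth := pth) (rs := enum A) phi_inj) => //.
- exact: enum_uniq.
- by move=> x y /AR xR /AR yR; apply: rt_inj.
- move=> x /AR xR; have [h1 h2 h3 h4 h5] := pth_ok xR; split=> //.
  + by case/setDP: xR.
  + by apply: (subsetP R1s); apply: rt_in.
  + by rewrite rt_R1 ?rt_in.
- by move=> x /AR xR; have [h1 h2 h3 h4 h5] := pth_ok xR; split=> //; apply: ltnW.
- move=> x xA z zx; have [h1 h2 h3] := pth_out (AR _ xA) zx; split=> //.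
  by apply: pS zx; rewrite -mem_enum.
move=> f r c Y I YE; apply: H I _ => p; rewrite YE.
congr (_ \in _); apply/eq_in_map=> x /AR xR.
by have [_ _ _ -> _] := pth_ok xR.
Qed.

Lemma copied_valid g r c Y :
  valid Rt par phi setT g r c Y ->
  {in R2, forall x, ed (g x) (g (par x)) \in r} -> copied r.
Proof.
move=> V h; exists g; split; last exact: (v_phi V).
- by move=> x y; apply: (v_inj V); rewrite inE.
- move=> v vR; have [vRt|vRt] := boolP (v \in Rt); first by apply: h; rewrite in_setD vR.
  by have [] := v_par V (in_setT v) vRt.
Qed.

Lemma card_R1_R2 : #|~: R1| = #|~: Rt| + #|R2|.
Proof.
have := cardsID (~: Rt) (~: R1); rewrite -setCU (setUidPr R1s) => <-.
by rewrite setDE setCK setIC -setDE.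
Qed.

Lemma leaves_win G K :
  K <= #|leaf_parents| -> D + l + 5 <= K -> 2 * (D + 2) <= K ->
  2 * ((2 * l).+1 * (2 * l + 6) + 2 * l + 1) <= K ->
  (forall r c, copied r -> G r c) ->
  wf G (#|~: R1| + #|R2| + 1) set0 set0.
Proof.
move=> cL lK dK bK H.
(* One leaf is reserved per leaf parent, so that reserved leaves have distinct parents; on
   [leaf_parents] the default value is never taken. *)
pose pick_leaf u := odflt u [pick v in nonroot_leaves | par v == u].
have pickP u : u \in leaf_parents -> pick_leaf u \in nonroot_leaves /\ par (pick_leaf u) = u.
  move=> /imsetP[v vl ->]; rewrite /pick_leaf; case: pickP => [w /andP[wl /eqP]//|].
  by move/(_ v); rewrite vl eqxx.
pose X := pick_leaf @: leaf_parents.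
have Xl x : x \in X -> x \in nonroot_leaves by move=> /imsetP[u /pickP[h _] ->].
have parX : {in X &, injective par}.
  by move=> _ _ /imsetP[u uL ->] /imsetP[w wL ->]; rewrite !(proj2 (pickP _ _)) // => ->.
have cX : #|X| = #|leaf_parents|.
  apply: card_in_imset => u w uL wL h.
  by rewrite -(proj2 (pickP _ uL)) h (proj2 (pickP _ wL)).
have XR x : x \in X -> x \notin Rt by move=> /Xl; rewrite inE => /andP[].
have -> : #|~: R1| + #|R2| + 1 = #|~: X :\: Rt| + 2 * #|R2| + (#|~: ~: X| + 1).
  rewrite card_R1_R2 setCK; have := cardsID X (~: Rt).
  rewrite (_ : _ :&: X = X); last first.
    by apply/setIidPr/subsetP=> x /XR; rewrite in_setC.
  rewrite [~: Rt :\: X]setDE setIC -setDE => <-; arith.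
apply: (build_all (K := K) (S := ~: X)) => //.
- by apply/subsetP=> x xR; rewrite in_setC; apply: contraL xR; apply: XR.
- by move=> x xR z /(pth_leaves xR) zl; rewrite in_setC; apply: contra zl; apply: Xl.
- move=> v _ vR; rewrite in_setC; apply: (contraNN (Xl _)); apply: par_leaves.
  by apply: contra vR; apply: (subsetP R1s).
- by rewrite setCK cX; apply: leq_trans cL; apply: leq_trans dK; lia.
move=> f r c Y I YE.
have KX : K <= #|~: ~: X| by rewrite setCK cX.
(* From here on offers need not have equal degrees: the degree bound of this moment is converted
   into [low_deg], which the endgame maintains by itself. *)
have I' := good_big I (leqnn n.+1).
apply: (leaf_endgame nl kidsD' I') => //.
- split; last by rewrite setCK.
  move=> u v; rewrite in_setC negbK => /Xl vl uR; apply: contraTneq vl => <-.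
  by apply: par_leaves; apply: contra uR; apply: (subsetP R1s).
(* Reserved leaves have distinct parents, so each of them for which [a] is bad contributes its own
   coloured edge at [a]. *)
- move=> a; have [aS|aS] := boolP (a \in f @: (~: X)).
    rewrite (_ : [set _ in _ | _] = set0) ?cards0 //.
    by apply/setP=> v; rewrite !inE aS andbF.
  apply: leq_trans (dg_le nl I KX aS).
  rewrite -(card_in_imset (f := fun v => ed (f (par v)) a)); last first.
    move=> u v; rewrite !inE !negbK => /andP[uX _] /andP[vX _].
    rewrite ![ed _ a]edC => /ed_inj h; apply: parX => //.
    have V := i_valid I; apply: (v_inj V) h; rewrite in_setC; apply: (contraNN (Xl _)).
      by apply: par_leaves; apply: contra (XR _ uX); apply: (subsetP R1s).
    by apply: par_leaves; apply: contra (XR _ vX); apply: (subsetP R1s).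
  apply: subset_leq_card; apply/subsetP=> e /imsetP[v + ->].
  rewrite in_set => /andP[_]; rewrite in_set => /andP[_ h].
  by rewrite in_set h; apply: edr.
- by rewrite ltnS (leq_trans (max_card _)) // card_ord.
- have : #|~: ~: X| <= n by rewrite (leq_trans (max_card _)) // card_ord.
  by move: KX lK; clear; move: #|_|; lia.
- exact: leq_trans KX.
- exact: leq_trans KX.
move=> g r' c' V; apply: H; apply: (copied_valid V) => x xR.
by have [|_ _] := v_Y V (p := (x, par x)) _; rewrite // YE map_f // mem_enum.
Qed.

(** * Many components that are bare paths *)

Definition pure :=
  [set x in R2 | [forall v, (v \notin Rt) && (rt v == rt x) ==> (v \in pth x)]].

(** A descent from a vertex off the path reaches neither the path nor [x], because all ancestors of
    [x] below the main root lie on the path; it must end in a leaf that is not a root. *)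
Lemma leaf_below x : x \in R2 -> forall v, v \notin Rt -> rt v = rt x ->
  v \notin pth x -> exists2 w, w \in nonroot_leaves & rt w = rt x.
Proof.
move=> xR; apply: down_ind => v IH vR vx vp.
have [/childlessPn[u uR uv]|cl] := boolP (~~ childless v); last first.
  by exists v; rewrite ?inE ?vR //; rewrite negbK in cl.
have ux : rt u = rt x by rewrite -rt_par // uv.
have h7 := ht7 xR.
have vR1 : v \notin R1 by apply: contra vR; apply: (subsetP R1s).
have step i : i < ht x -> u = iter i par x -> v \in pth x.
  move=> ih uE; apply/mem_pth; exists i.+1; last by rewrite -uv uE.
  rewrite /= ltn_neqAle ih andbT; apply: contraNneq vR1 => iE.
  by rewrite -uv uE -iterS iE ht_in.
apply: (IH u) => //.
  apply/negP=> uRt; case/negP: vp; apply: (step 0); first by apply: leq_trans h7.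
  by apply: rt_inj => //; rewrite in_setD uR.
by apply: contra vp => /mem_pth[i /andP[_ ih]]; apply: step.
Qed.

(** Each component with two roots that is not pure contains a leaf parent, and [rt] separates these
    components. *)
Lemma card_nonpure : #|R2| <= #|pure| + #|leaf_parents|.
Proof.
rewrite -(cardsID pure R2); apply: leq_add.
  by apply: subset_leq_card; apply: subsetIr.
have rtI : {in R2 :\: pure &, injective rt}.
  by move=> x y /setDP[xR _] /setDP[yR _]; apply: rt_inj.
rewrite -(card_in_imset rtI).
apply: leq_trans (leq_imset_card rt _); apply: subset_leq_card.
apply/subsetP=> _ /imsetP[x /setDP[xR xp] ->].
move: xp; rewrite inE xR /= negb_forall => /existsP[v].
rewrite negb_imply => /andP[/andP[vR /eqP vx] vp].
have [w wl <-] := leaf_below xR vR vx vp; rewrite -rt_par; last first.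
  by apply/negP=> /(subsetP R1s); move: wl; rewrite inE => /andP[/negbTE->].
by apply: imset_f; apply: imset_f.
Qed.

(** All pure components are left to the end. Each has at least six vertices besides its roots, so
    the rest of the forest can be embedded with an ample reserve. *)
Lemma pures_win G K :
  K <= #|pure| -> D + l + 10 <= K -> (forall r c, copied r -> G r c) ->
  wf G (#|~: R1| + #|R2| + 1) set0 set0.
Proof.
move=> cP lK H.
have P2 : pure \subset R2 by apply/subsetP=> x; rewrite inE => /andP[].
have pR x : x \in enum pure -> x \in R2 by rewrite mem_enum => /(subsetP P2).
pose S := [set v | (v \in Rt) || (rt v \notin rt @: pure)].
have RS : Rt \subset S by apply/subsetP=> v; rewrite inE => ->.
have dR x z : x \in R2 -> z \in pth x -> rt z \notin rt @: pure -> z \in S.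
  by move=> _ _ h; rewrite inE h orbT.
have fE : flatten (map pth (enum pure)) =i ~: S.
  move=> z; rewrite in_setC inE negb_or negbK; apply/idP/idP.
    move=> /flattenP[_ /mapP[x xp ->] zx].
    have [-> -> _] := pth_out (pR x xp) zx.
    by apply: imset_f; rewrite -mem_enum.
  case/andP=> zR /imsetP[x xp zx]; apply/flattenP; exists (pth x).
    by apply: map_f; rewrite mem_enum.
  move: xp; rewrite inE => /andP[_ /forallP/(_ z)].
  by rewrite zR zx eqxx.
have cS : #|~: S| = size (flatten (map pth (enum pure))).
  rewrite -(eq_card fE); apply/card_uniqP.
  apply: uniq_flatten => [|y /pR/pth_ok[] //|y z u /pR yR /pR zR uy uz].
    exact: enum_uniq.
  have [_ ly _] := pth_out yR uy; have [_ lz _] := pth_out zR uz.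
  by apply: rt_inj => //; rewrite -ly.
have sz : 6 * #|pure| <= #|~: S|.
  rewrite cS cardE; elim: (enum pure) pR {fE cS} => //= y s IH pR.
  have [_ _ h _ _] := pth_ok (pR y (mem_head _ _)).
  rewrite size_cat mulnS leq_add // IH // => z zs; apply: pR.
  by rewrite in_cons zs orbT.
have R1R v : v \notin Rt -> v \notin R1 by apply: contra; apply: (subsetP R1s).
have -> : #|~: R1| + #|R2| + 1 =
    #|S :\: Rt| + 2 * #|R2 :\: pure| + (#|~: S| + 2 * size (enum pure) + 1).
  rewrite card_R1_R2 -cardE -(cardsID pure R2) (setIidPr P2).
  have := cardsID (~: S) (~: Rt); rewrite -setCU (setUidPr RS).
  rewrite [~: Rt :\: ~: S]setDE setCK setIC -setDE => <-; arith.
apply: (build_all (K := K) (S := S)) => //.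
- exact: subsetDl.
- move=> x /setDP[xR xp] z zx; have [h1 h2 _] := pth_out xR zx.
  rewrite inE h2; apply/orP; right; apply: contra xp => /imsetP[y yp h].
  by rewrite (rt_inj xR _ h) //; apply: (subsetP P2).
- move=> v; rewrite inE => /orP[->//|vp] vR; rewrite inE rt_par ?vp ?orbT //.
  exact: R1R.
- by apply: leq_trans sz; move: cP lK; move: #|pure|; clear; lia.
- by move: lK; clear; lia.
move=> f r c Y I YE.
case Ep: (enum pure) => [|x rs].
  by have := leq_trans lK cP; rewrite cardE Ep leqn0 addn_eq0 andbF.
have up := enum_uniq pure; rewrite Ep in up fE pR.
have rP y : y \in x :: rs -> y \in pure by rewrite -Ep mem_enum.
apply: (pure_endgame (K := K) nl (top := rt) (pth := pth) rt_par' I up) => //.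
- by move=> a b /pR ha /pR hb; apply: rt_inj.
- move=> y /pR yR; have [h1 h2 h3 h4 h5] := pth_ok yR; split=> //.
  + by case/setDP: yR.
  + by apply: (subsetP R1s); apply: rt_in.
  + by rewrite rt_R1 ?rt_in.
- by move=> y /pR yR; have [] := pth_ok yR.
- move=> y yx z zy; have [_ h _] := pth_out (pR y yx) zy; split=> //.
  rewrite -in_setC -fE; apply/flattenP; exists (pth y) => //; exact: map_f.
- move=> v; rewrite inE => /orP[->//|vp] _; apply: contra vp => /mapP[y yx ->].
  by apply: imset_f; apply: rP.
- by apply: leq_trans sz; move: cP lK; move: #|pure|; clear; lia.
- by move: lK; clear; lia.
- move=> u uR ux; have [_ h _] := pth_out (pR x (mem_head _ _)) ux.
  have := rP x (mem_head _ _); rewrite inE => /andP[_ /forallP/(_ u)].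
  by rewrite uR -(rt_par' uR) h eqxx.
move=> g r' c' Y' V Y'E gx; apply: H; apply: (copied_valid V) => y yR.
have lp z : z \in x :: rs -> last (rt z) (pth z) = par z.
  by move=> /pR/pth_ok[].
have [yp|yp] := boolP (y \in pure).
  move: yp; rewrite -mem_enum Ep in_cons => /predU1P[->|yr].
    by rewrite -(lp x (mem_head _ _)).
  have [|_ _] := v_Y V (p := (y, par y)) _; rewrite // Y'E.
  apply/orP; right; apply/mapP; exists y => //; congr (_, _).
  by rewrite lp // in_cons yr orbT.
have [|_ _] := v_Y V (p := (y, par y)) _; rewrite // Y'E YE map_f //.
by rewrite mem_enum in_setD yp.
Qed.

(** * A long bare path *)

Definition kid v := [set u | (u \notin R1) && (par u == v)].
(** Inner vertices of bare paths. Leaf parents are left out because branchings are counted after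
    deleting the leaves, while the kid of a link must be the only one in the full forest. *)
Definition links := [set v | [&& v \notin Rt, v \notin leaf_parents & #|kid v| == 1]].

Lemma links_kid v u w : v \in links -> u \notin R1 -> w \notin R1 ->
  par u = v -> par w = v -> u = w.
Proof.
rewrite inE => /and3P[_ _ /cards1P[z zE]] uR wR uv wv.
have : u \in kid v by rewrite inE uR uv eqxx.
have : w \in kid v by rewrite inE wR wv eqxx.
by rewrite zE => /set1P-> /set1P->.
Qed.

Lemma card_leaves : #|nonroot_leaves| <= D * #|leaf_parents|.
Proof.
have -> : #|nonroot_leaves| = \sum_(u in leaf_parents) #|[set v in nonroot_leaves | par v == u]|.
  rewrite -sum1_card (partition_big par (mem leaf_parents)) /=; last by move=> v; apply: imset_f.
  by apply: eq_bigr => u _; rewrite -sum1_card; apply: eq_bigl => v; rewrite inE.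
rewrite mulnC -sum_nat_const; apply: leq_sum => u _; apply: leq_trans (kidsD u).
apply: subset_leq_card; apply/subsetP=> v; rewrite !inE => /andP[/andP[vR _] ->].
by rewrite andbT; apply: contra vR; apply: (subsetP R1s).
Qed.

(* Count branchings against ends in the forest without [nonroot_leaves]. *)
Lemma card_branch : #|~: (links :|: nonroot_leaves)| <= 2 * (#|leaf_parents| + #|R2|).
Proof.
pose X := ~: nonroot_leaves.
pose B := [set v in X | [&& v \notin Rt, v \notin leaf_parents & #|kid v| != 1]].
pose kid' v := [set u in X :\: R1 | par u == v].
(* Every vertex is charged one and a branching two. Kids pay for this, except that leaf parents and
   second roots may have none left and pay by themselves. At most [#|X| - #|R1|] kids are available,
   so [#|B| + #|R1|] is at most [#|leaf_parents| + #|R2|]. *)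
have k1 v : v \in X -> 1 + (v \in B) <= #|kid' v| + (v \in leaf_parents) + (v \in R2).
  move=> vX; have [vL|vL] := boolP (v \in leaf_parents).
    by rewrite [v \in B]inE vL /= !andbF addn0 -addnA addnC -addnA leq_addr.
  have kE : kid' v = kid v.
    apply/setP=> u; rewrite in_set [u \in kid v]in_set in_setD in_setC.
    case: (u \in R1) => //=; apply: andb_idl => /eqP uv.
    by apply: contra vL => ul; rewrite -uv; apply: imset_f.
  rewrite kE addn0 in_setD [v \in B]inE vX vL /=.
  have [vR1|vR1] := boolP (v \in R1).
    rewrite (subsetP R1s v vR1) /= addn0 addn0 card_gt0; apply/set0Pn.
    by have [u uR uv] := kid_R1 vR1; exists u; rewrite inE uR uv eqxx.
  have [vR|vR] /= := boolP (v \in Rt); first by rewrite addn0 addn1.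
  have : 0 < #|kid v|.
    rewrite card_gt0; apply/set0Pn; have : v \notin nonroot_leaves by rewrite -in_setC.
    rewrite inE vR => /childlessPn[u uR uv].
    by exists u; rewrite inE uR uv eqxx.
  by move: #|kid v| => [|[|m]] //=; rewrite ?addn0.
have R1X : R1 \subset X.
  by apply/subsetP=> v /(subsetP R1s) vR; rewrite !inE vR.
have sk : \sum_(v in X) #|kid' v| + #|R1| <= #|X|.
  rewrite -(cardsID R1 X) (setIidPr R1X) addnC leq_add2l.
  have -> : #|X :\: R1| = \sum_v #|kid' v|.
    rewrite -sum1_card (partition_big par predT) //=; apply: eq_bigr => v _.
    by rewrite -sum1_card; apply: eq_bigl => u; rewrite [RHS]in_set.
  by rewrite [leqRHS](bigID (mem X)) /=; apply: leq_addr.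
have cB (A : {set T}) : \sum_(v in X) (v \in A : nat) <= #|A|.
  rewrite big_mkcond -sum1_card [leqRHS]big_mkcond /=; apply: leq_sum => v _.
  by case: (v \in X); case: (v \in A).
have cBX : \sum_(v in X) (v \in B : nat) = #|B|.
  rewrite big_mkcond -sum1_card [RHS]big_mkcond /=; apply: eq_bigr => v _.
  by rewrite [v \in B]inE; case: (v \in X) => //=; case: (_ && _).
have s1 : #|X| + #|B| <= \sum_(v in X) #|kid' v| + #|leaf_parents| + #|R2|.
  rewrite -cBX -sum1_card -big_split /=.
  apply: (@leq_trans (\sum_(v in X) (#|kid' v| + (v \in leaf_parents) + (v \in R2)))).
    by apply: leq_sum => v; apply: k1.
  by rewrite !big_split /= !leq_add.
have sB : ~: (links :|: nonroot_leaves) \subset B :|: (R1 :|: (R2 :|: leaf_parents)).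
  apply/subsetP=> v; rewrite in_setC in_setU negb_or => /andP[vm vl].
  rewrite !in_setU in_setD [v \in B]inE in_setC vl /=; move: vm; rewrite inE.
  case: (v \in R1); rewrite ?orbT //=; case: (v \in Rt); rewrite ?orbT //=.
  by case: (v \in leaf_parents); rewrite ?orbT //= => ->.
have := leq_trans (subset_leq_card sB) (leq_card_setU _ _).
have [h1 _] := leq_card_setU R1 (R2 :|: leaf_parents); have [h2 _] := leq_card_setU R2 leaf_parents.
move: s1 sk h1 h2; move: (\sum_(v in X) _) => s; arith.
Qed.

(** Descending through links from a vertex outside the leaves ends at one of the few vertices
    counted by [card_branch]. If all such descents were shorter than [L], each of these ends would
    account for at most [L] vertices, and [n] would be too small. *)
Lemma long_chain L : 0 < L -> D * #|leaf_parents| + L * (2 * (#|leaf_parents| + #|R2|)) < n ->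
  exists2 b, b \notin R1 & forall j, 0 < j <= L -> iter j par b \in links.
Proof.
move=> L0 hn.
have [/existsP[b /andP[bR /forallP h]]|hb] :=
  boolP [exists b, (b \notin R1) && [forall j : 'I_L, iter j.+1 par b \in links]].
  by exists b => // -[|j] // jL; apply: (h (Ordinal jL)).
have cov : forall v, v \notin nonroot_leaves -> exists b i,
    [/\ b \in ~: (links :|: nonroot_leaves), v = iter i par b, 0 < i -> b \notin R1 &
      forall j, 0 < j <= i -> iter j par b \in links].
  apply: down_ind => v IH vl; have [vm|vm] := boolP (v \in links); last first.
    by exists v, 0; split=> //; [rewrite in_setC in_setU negb_or vm|case].
  have vLp : v \notin leaf_parents by move: vm; rewrite inE => /and3P[].
  have [u uk] : exists u, u \in kid v.
    by move: vm; rewrite inE => /and3P[_ _ /cards1P[u ->]]; exists u; apply: set11.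
  move: uk; rewrite inE => /andP[uR /eqP uv].
  have [|b [i [bB uE b1 ib]]] := IH u uR uv.
    by apply: contra vLp => ul; rewrite -uv; apply: imset_f.
  exists b, i.+1; split=> // [|_|j]; first by rewrite -uv uE.
    by case: i uE b1 {ib} => [/= <-|i _ ->].
  rewrite [j <= _]leq_eqVlt => /andP[j0 /predU1P[->|ji]]; last by apply: ib; rewrite j0.
  by rewrite iterS -uE uv.
have sub : ~: nonroot_leaves \subset \bigcup_(i in [set: 'I_L]) [set iter i par b | b in ~: (links :|: nonroot_leaves)].
  apply/subsetP=> v; rewrite in_setC => /cov[b [i [bB vE b1 ib]]].
  have [iL|Li] := ltnP i L.
    by apply/bigcupP; exists (Ordinal iL) => //; rewrite vE; apply: imset_f.
  case/negP: hb; apply/existsP; exists b; rewrite b1 ?(leq_trans L0) //=.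
  by apply/forallP=> j; apply: (ib j.+1) => /=; apply: leq_trans Li; apply: ltn_ord.
have : #|~: nonroot_leaves| <= L * #|~: (links :|: nonroot_leaves)|.
  apply: leq_trans (subset_leq_card sub) _.
  rewrite -[L in leqRHS]card_ord -cardsT; apply: card_bigcup_le => i _.
  exact: leq_imset_card.
have := card_branch; have := card_leaves; have := cardsC nonroot_leaves; rewrite card_ord.
move=> cn h1 h2 h3; suff: n <= D * #|leaf_parents| + L * (2 * (#|leaf_parents| + #|R2|)).
  by rewrite leqNgt hn.
by rewrite -[leqLHS]cn leq_add // (leq_trans h3) // leq_mul2l h2 orbT.
Qed.

Section Chain.
Variables (c0 : T) (t L : nat) (phi' : T -> T).
Notation ch i := (iter i par c0).
Hypothesis chR1 : forall i, i <= t + L -> ch i \notin R1.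
Hypothesis chRt : forall i, 0 < i <= t + L -> ch i \notin Rt.
Hypothesis chM : forall i, t < i <= t + L -> ch i \in links.
Hypothesis chP : {in R2, forall x, x != c0 -> forall i, i <= t + L -> ch i \notin pth x}.
Hypothesis phi'E : {in Rt, phi' =1 phi}.
Hypothesis phi'I : {in c0 |: Rt &, injective phi'}.
(** Seven bare vertices play the parts of [x] and [q0] to [q5] in [bare_endgame]. The other [L - 7]
    form the long path and must number at least [D + 1 + 6], since reversing parents can give a
    vertex one more kid. *)
Hypothesis LD : L = D + 14.

(* The chain is cut between [ch (t + 6)] and [ch (t + 7)], and below the cut the parents are
   reversed: both sides then grow towards the cut, which is closed last. *)
Definition turn := mkseq (fun i => ch i) (t + 7).
Definition par' v := if v \in turn then ch (index v turn).-1 else par v.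
(** Reversed vertices precede all others, in their order from [c0], so that parents under [par']
    still come first. *)
Definition dep' v := if v \in turn then index v turn else t + 7 + dep v.
Notation R' := (c0 |: Rt).

Lemma ht_ch : t + L < ht c0.
Proof.
rewrite ltnNge; apply/negP=> h; have := chR1 h.
by rewrite ht_in.
Qed.

Lemma ch_inj i j : i <= (t + L).+1 -> j <= (t + L).+1 -> ch i = ch j -> i = j.
Proof.
move=> ih jh e; wlog ij : i j ih jh e / i < j.
  by move=> hw; case: (ltngtP i j) => // ij; [|symmetry]; apply: hw.
have h : i < j <= ht c0 by rewrite ij (leq_trans jh) // ht_ch.
by have := dep_iter h; rewrite e ltnn.
Qed.

Lemma uniq_turn : uniq turn.
Proof.
apply/mkseq_uniqP=> i j; rewrite !inE => ih jh; apply: ch_inj; move: ih jh; rewrite LD; lia.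
Qed.

Lemma index_turn i : i < t + 7 -> index (ch i) turn = i.
Proof.
move=> ih; have := index_uniq c0 (i := i) (s := turn).
by rewrite size_mkseq nth_mkseq // => ->; rewrite ?uniq_turn.
Qed.

Lemma turnP z : reflect (exists2 i, i < t + 7 & z = ch i) (z \in turn).
Proof.
apply: (iffP mapP) => [[i + ->]|[i ih ->]]; first by rewrite mem_iota => ih; exists i.
by exists i; rewrite ?mem_iota.
Qed.

Lemma par_turn i : i < t + 7 -> par' (ch i) = ch i.-1.
Proof.
move=> ih; rewrite /par' index_turn // ifT //.
by apply/turnP; exists i.
Qed.

Lemma par_off v : v \notin turn -> par' v = par v.
Proof. by rewrite /par' => /negbTE->. Qed.

Lemma dep_par_turn v : v \notin R' -> dep' (par' v) < dep' v.
Proof.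
rewrite in_setU1 negb_or => /andP[v0 vR].
have [/turnP[i ih vE]|vt] := boolP (v \in turn).
  have i0 : 0 < i by rewrite lt0n; apply: contraNneq v0 => i0; rewrite vE i0.
  have i1 : i.-1 < t + 7 by rewrite (leq_ltn_trans (leq_pred i)).
  have m j : j < t + 7 -> ch j \in turn by move=> jh; apply/turnP; exists j.
  by rewrite vE par_turn // /dep' !m // !index_turn // prednK.
rewrite par_off // /dep' (negbTE vt); have := dep_par' vR.
case: ifP => [|_ h]; last by rewrite ltn_add2l.
by rewrite -index_mem size_mkseq => h _; rewrite (leq_trans h) // leq_addr.
Qed.

Lemma rt_par_turn v : v \notin R' -> rt (par' v) = rt v.
Proof.
rewrite in_setU1 negb_or => /andP[v0 vR].
have [/turnP[i ih vE]|vt] := boolP (v \in turn); last by rewrite par_off // rt_par'.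
have ih' : i <= ht c0 by apply: ltnW; apply: leq_ltn_trans ht_ch; rewrite LD; lia.
by rewrite vE par_turn // !rt_iter // (leq_trans (leq_pred i)).
Qed.

Lemma kids_turn u : #|[set v | (v \notin R') && (par' v == u)]| <= D.+1.
Proof.
apply: leq_trans (_ : #|ch (index u turn).+1 |: [set v | (v \notin R1) && (par v == u)]| <= _).
  apply: subset_leq_card; apply/subsetP=> v; rewrite in_set in_setU1 negb_or.
  case/andP=> /andP[v0 vR] /eqP; have [/turnP[i ih vE]|vt] := boolP (v \in turn).
    rewrite vE par_turn //; have i0 : 0 < i.
      by rewrite lt0n; apply: contraNneq v0 => i0; rewrite vE i0.
    rewrite in_setU1 => <-; rewrite index_turn ?prednK ?eqxx //.
    exact: ltnW.
  rewrite par_off // in_setU1 in_set => ->; rewrite eqxx andbT.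
  by rewrite (contra _ vR) ?orbT //; apply: (subsetP R1s).
by rewrite cardsU1; apply: (@leq_add _ _ 1 D); [case: (_ \notin _)|].
Qed.

Definition bare : {set T} := [set ch (nat_of_ord i) | i in [pred i : 'I_(t + L).+1 | t < i]].

Lemma bareP z : reflect (exists2 i, t < i <= t + L & z = ch i) (z \in bare).
Proof.
apply: (iffP imsetP) => [[i + ->]|[i /andP[ti ih] ->]].
  by rewrite inE => ti; exists i => //; rewrite ti -ltnS ltn_ord.
by exists (Ordinal (n := (t + L).+1) (m := i) ih).
Qed.

Lemma ch_turn i : i <= (t + L).+1 -> (ch i \in turn) = (i < t + 7).
Proof.
move=> ih; apply/turnP/idP => [[j jh e]|h]; last by exists i.
by rewrite (ch_inj ih _ e) //; move: jh; rewrite LD; lia.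
Qed.

Lemma ch_bare i : i <= (t + L).+1 -> (ch i \in bare) = (t < i <= t + L).
Proof.
move=> ih; apply/bareP/idP => [[j jh e]|h]; last by exists i.
by rewrite (ch_inj ih _ e) //; case/andP: jh => _ /leqW.
Qed.

(* The kids of a bare vertex are all known, so only [ch t] hangs below. *)
Lemma par_bare v : v \notin R1 -> par v \in bare -> v \in bare \/ v = ch t.
Proof.
move=> vR /bareP[i /andP[ti iL] vi]; have iE : i = i.-1.+1 by case: (i) ti.
have {}vi : v = ch i.-1.
  apply: (@links_kid (ch i)) => //; first by apply: chM; rewrite ti.
    by apply: chR1; apply: leq_trans (leq_pred i) iL.
  by rewrite [in RHS]iE.
have [it|it] := eqVneq i.-1 t; first by right; rewrite vi it.
left; rewrite vi ch_bare; last by apply: leqW; apply: leq_trans (leq_pred i) iL.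
by move: it ti iL; clear; lia.
Qed.

Let out_bare z : z \in R' -> z \notin bare.
Proof.
rewrite in_setU1 => /predU1P[->|zR].
  by rewrite -[c0]/(ch 0) ch_bare //.
apply: contraL zR => /bareP[i /andP[ti iL] ->]; apply: chRt.
by rewrite iL (leq_ltn_trans _ ti).
Qed.

Definition ups := mkseq (fun i => ch (t + L - i.+1)) (L - 7).

Lemma ups_path : path (child par') (ch (t + L)) ups.
Proof.
apply/(pathP c0) => i; rewrite size_mkseq => ih.
have -> : nth c0 (ch (t + L) :: ups) i = ch (t + L - i).
  case: i ih => [|i] ih; first by rewrite subn0.
  by rewrite /= nth_mkseq // ltnW.
rewrite nth_mkseq // /child par_off; last first.
  by rewrite ch_turn; move: ih; rewrite LD; lia.
apply/eqP; rewrite -iterS; congr (iter _ par c0); move: ih; rewrite LD; lia.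
Qed.

Lemma last_ups : last (ch (t + L)) ups = ch (t + 7).
Proof.
have [m hm] : exists m, L - 7 = m.+1 by exists (L - 8); rewrite LD; lia.
rewrite /ups hm (last_nth c0) size_mkseq [nth _ _ _]/= nth_mkseq //.
congr (iter _ par c0); move: hm; rewrite LD; lia.
Qed.

Lemma bare_seq :
  let s := (ch (t + L) :: ups) ++ [seq ch (t + i) | i <- iota 1 6] in
  uniq s /\ s =i bare.
Proof.
move=> s; pose idx := [seq t + L - i | i <- iota 0 (L - 6)] ++ [seq t + i | i <- iota 1 6].
have sE : s = [seq ch i | i <- idx].
  rewrite map_cat -!map_comp /s; congr (_ ++ _).
  have -> : L - 6 = (L - 7).+1 by rewrite LD; lia.
  rewrite /= subn0; congr (_ :: _); rewrite /ups /mkseq -[1]/(1 + 0) iotaDl -map_comp.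
  exact: eq_map.
have ix i : (i \in idx) = (t < i <= t + L).
  rewrite mem_cat; apply/orP/idP.
    by case=> /mapP[j]; rewrite mem_iota LD => h ->; move: h; lia.
  move=> h; have [i6|i6] := leqP i (t + 6).
    by right; apply/mapP; exists (i - t); rewrite ?mem_iota; move: h i6; lia.
  by left; apply/mapP; exists (t + L - i); rewrite ?mem_iota; move: h i6; lia.
split; last first.
  move=> z; rewrite sE; apply/mapP/bareP => [[i + ->]|[i ih ->]].
    by rewrite ix; exists i.
  by exists i; rewrite ?ix.
rewrite sE map_inj_in_uniq; last first.
  by move=> i j; rewrite !ix => /andP[_ ih] /andP[_ jh]; apply: ch_inj; apply: leqW.
rewrite cat_uniq (map_inj_uniq (@addnI t)) iota_uniq andbT; apply/andP; split.
  rewrite map_inj_in_uniq ?iota_uniq // => i j; rewrite !mem_iota LD; lia.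
apply/hasPn=> _ /mapP[i + ->]; rewrite mem_iota => ih; apply/mapP=> -[j].
by rewrite mem_iota LD; move: ih; lia.
Qed.

Lemma path_off x : x \in R2 -> x != c0 -> path (child par') (rt x) (pth x).
Proof.
move=> xR x0; have [p _ _ _ _] := pth_ok xR.
have : {in pth x, forall z, par' z = par z}.
  move=> z zx; apply: par_off; apply/turnP=> -[i ih zE].
  by have := chP xR x0 (i := i); rewrite -zE zx => /(_ _)/negP[] //; move: ih; rewrite LD; lia.
elim: (pth x) (rt x) p => //= z s IH a /andP[az p] h.
rewrite IH ?andbT //; last by move=> y ys; apply: h; rewrite in_cons ys orbT.
by rewrite /child h ?mem_head.
Qed.

(** With [c0] as a root, [par'] describes the forest with the edge across the cut removed. That edge
    is the one produced by the final rotation, which accounts for the last two rounds. *)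
Lemma chain_wins G K : D + l + 11 <= K -> (forall r c, copied r -> G r c) ->
  wf G (#|~: R'| + 2 * #|R2 :\ c0| + 2) set0 set0.
Proof.
move=> lK H; have [us sb] := bare_seq.
set s := _ ++ _ in us sb.
have cb : #|~: ~: bare| = L.
  rewrite setCK -(eq_card sb) (card_uniqP us) size_cat /= size_mkseq LD; lia.
have R'S : R' \subset ~: bare.
  by apply/subsetP=> z /out_bare; rewrite in_setC.
have xR x : x \in enum (R2 :\ c0) -> x \in R2 /\ x != c0.
  by rewrite mem_enum in_setD1 => /andP[].
have R1' v : v \notin R' -> v \notin R1.
  by apply: contra => /(subsetP R1s) h; rewrite in_setU1 h orbT.
have RR x : x \in R1 -> x \in R' by move=> /(subsetP R1s) h; rewrite in_setU1 h orbT.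
have -> : #|~: R'| + 2 * #|R2 :\ c0| + 2 =
    #|~: bare :\: R'| + 2 * size (enum (R2 :\ c0)) + (#|~: ~: bare| + 2).
  rewrite -cardE; have := cardsID (~: ~: bare) (~: R').
  rewrite -setCU (setUidPr R'S) [~: R' :\: _]setDE setCK setIC -setDE => <-; arith.
apply: (build (K := K) nl rt_par_turn dep_par_turn kids_turn (top := rt) (pth := pth)
  phi'I R'S) => //.
- exact: enum_uniq.
- by move=> x y /xR[hx _] /xR[hy _]; apply: rt_inj.
- move=> x /xR[hx x0]; have [h1 h2 h3 h4 h5] := pth_ok hx; split=> //.
  + by rewrite in_setU1; case/setDP: hx => ->; rewrite orbT.
  + by apply: RR; apply: rt_in.
  + by rewrite rt_R1 ?rt_in.
  + exact: path_off.
- by move=> x /xR[hx _]; have [h1 h2 h3 h4 h5] := pth_ok hx; split=> //; apply: ltnW.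
- move=> x /xR[hx x0] z zx; have [h1 h2 h3] := pth_out hx zx.
  have nch i : i <= t + L -> z != ch i.
    by move=> iL; apply: contraNneq (chP hx x0 iL) => <-.
  split=> //; first by rewrite in_setU1 negb_or h1 (nch 0).
  by rewrite in_setC; apply/bareP=> -[i /andP[_ /nch/eqP]].
- move=> v; rewrite !in_setC => vb vR'; have vR := R1' v vR'.
  have [/turnP[i ih vE]|vt] := boolP (v \in turn).
    rewrite vE par_turn // ch_bare; last by move: ih; rewrite LD; lia.
    by move: vb; rewrite vE ch_bare; move: ih; rewrite LD; lia.
  rewrite par_off //; apply/negP=> /(par_bare vR)[vb'|vE]; first by rewrite vb' in vb.
  by move: vt; rewrite vE ch_turn; clear; lia.
- by rewrite cb LD; lia.
- by move: lK; clear; lia.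
move=> f r c Y I YE.
apply: (bare_endgame (K := K) (D := D.+1) (x := ch (t + L)) (us := ups)
  (q0 := ch (t + 1)) (q1 := ch (t + 2)) (q2 := ch (t + 3)) (q3 := ch (t + 4))
  (q4 := ch (t + 5)) (q5 := ch (t + 6)) nl kids_turn I) => //.
- rewrite par_off; last by rewrite ch_turn LD; lia.
  by rewrite in_setC -iterS ch_bare //; lia.
- exact: ups_path.
- by rewrite par_turn ?in_setC ?ch_bare; rewrite ?LD; lia.
- by rewrite /= /child !par_turn ?addnS ?eqxx //; lia.
- by move=> z; rewrite setCK -sb.
- by rewrite size_mkseq LD; lia.
- by move: lK; clear; lia.
- have qs z : z \in [seq ch (t + i) | i <- iota 2 5] <-> exists2 i, t + 2 <= i <= t + 6 & z = ch i.
    split=> [/mapP[i + ->]|[i ih ->]].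
      by rewrite mem_iota => ih; exists (t + i) => //; move: ih; lia.
    apply/mapP; exists (i - t); first by rewrite mem_iota; move: ih; lia.
    by rewrite subnKC //; move: ih; lia.
  move=> v vR' /qs[i ih vi]; apply/qs; have vR := R1' v vR'.
  have [/turnP[j jh vE]|vt] := boolP (v \in turn).
    move: vi; rewrite vE par_turn // => /ch_inj hj; exists j => //.
    by move: (hj) ih jh; rewrite LD; lia.
  move: vi; rewrite par_off // => vi; have vE : v = ch i.-1.
    apply: (@links_kid (ch i)) => //; first by apply: chM; move: ih; rewrite LD; lia.
      by apply: chR1; move: ih; rewrite LD; lia.
    by rewrite -iterS prednK //; move: ih; lia.
  by case/negP: vt; rewrite vE ch_turn; move: ih; rewrite ?LD; clear; lia.
move=> g r' c' V; rewrite last_ups => tE; apply: H.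
exists g; split; first by move=> x y; apply: (v_inj V); rewrite inE.
- have vp v : v \notin R' -> ed (g v) (g (par' v)) \in r'.
    by move=> vR; have [] := v_par V (in_setT v) vR.
  move=> v vR; have [/turnP[i ih vE]|vt] := boolP (v \in turn).
    have [i6|i6] := eqVneq i (t + 6).
      by rewrite vE i6 -iterS edC -addnS.
    have := vp (ch i.+1); rewrite par_turn /=; last by move: ih i6; lia.
    rewrite edC vE; apply; rewrite in_setU1 negb_or; apply/andP; split; last first.
      by apply: (chRt (i := i.+1)); move: ih; rewrite LD; lia.
    by apply/eqP=> /(@ch_inj i.+1 0); rewrite LD; move: ih; lia.
  have [vR'|vR'] := boolP (v \in R'); last by rewrite -(par_off vt); apply: vp.
  have v0 : v != c0.
    by apply: contraNneq vt => ->; apply/turnP; exists 0; rewrite // addn_gt0 orbT.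
  move: vR'; rewrite in_setU1 (negbTE v0) /= => vRt.
  have vR2 : v \in R2 by rewrite in_setD vR.
  have [|_ _] := v_Y V (p := (v, par v)) _; rewrite // YE; apply/mapP; exists v.
    by rewrite mem_enum in_setD1 v0.
  by have [_ _ _ -> _] := pth_ok vR2.
- by move=> x xRt; rewrite (v_phi V) ?phi'E // in_setU1 xRt orbT.
Qed.

End Chain.

(** The reversed part has to hang from a root. If [b] lies on the way up from a second root [x],
    then [x] serves, and the two rounds for closing its path are spent at the cut instead. Otherwise
    [b] becomes a root with any image not yet assigned: the round for [b] is saved, two are spent at
    the cut, and the balance is the one wasted round. *)
Lemma bare_wins G K L b : b \notin R1 -> (forall j, 0 < j <= L -> iter j par b \in links) ->
  L = D + 14 -> D + l + 11 <= K -> (forall r c, copied r -> G r c) ->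
  exists2 m, m <= #|~: R1| + #|R2| + 1 & wf G m set0 set0.
Proof.
move=> bR bM LD lK H; rewrite card_R1_R2.
have mR z : z \in links -> z \notin Rt by rewrite inE => /and3P[].
have R1R z : z \notin Rt -> z \notin R1 by apply: contra; apply: (subsetP R1s).
have [/existsP[x /andP[xR /existsP[[t tx] /= /eqP bE]]]|hb] :=
  boolP [exists x in R2, [exists t : 'I_(ht x), b == iter t par x]].
  have xRt : x \in Rt by case/setDP: xR.
  have xE : x |: Rt = Rt by apply/setUidPr; rewrite sub1set.
  have up i : t < i -> iter i par x = iter (i - t) par b.
    by move=> ti; rewrite bE -iterD subnK // ltnW.
  have upM i : t < i <= t + L -> iter i par x \in links.
    by case/andP=> ti iL; rewrite up // bM // subn_gt0 ti leq_subLR.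
  have upR i : i <= t + L -> iter i par x \notin R1.
    by move=> iL; case: (leqP i t) => it;
      [apply: ht_min; apply: leq_ltn_trans tx|apply/R1R/mR/upM; rewrite it].
  have upRt i : 0 < i <= t + L -> iter i par x \notin Rt.
    case/andP=> i0 iL; case: (leqP i t) => it; last by apply/mR/upM; rewrite it.
    have [] // := @pth_out x (iter i par x) xR.
    by apply/mem_pth; exists i => //; rewrite i0 (leq_ltn_trans it).
  have upP : {in R2, forall y, y != x -> forall i, i <= t + L -> iter i par x \notin pth y}.
    move=> y yR yx i iL; apply: contra yx => /(pth_out yR)[_ h _].
    apply/eqP/rt_inj => //; rewrite -h rt_iter // ltnW //.
    exact: leq_ltn_trans iL (ht_ch upR).
  have pI : {in x |: Rt &, injective phi} by rewrite xE.
  exists (#|~: (x |: Rt)| + 2 * #|R2 :\ x| + 2).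
    by rewrite xE; have := cardsD1 x R2; rewrite xR; arith.
  exact: (chain_wins upR upRt upM upP (fun _ _ => erefl) pI LD lK H).
have nb x : x \in R2 -> forall t, t < ht x -> b != iter t par x.
  move=> xR t tx; apply: contra hb => /eqP bE; apply/existsP; exists x; rewrite xR.
  by apply/existsP; exists (Ordinal tx) => /=; rewrite bE.
have bRt : b \notin Rt.
  apply/negP=> h; have xR : b \in R2 by rewrite in_setD bR.
  by have := nb b xR 0 (leq_trans _ (ht7 xR)); rewrite /= eqxx => /(_ isT).
have [y yR] : exists y, y \notin phi @: Rt.
  have : #|phi @: Rt| < n.
    apply: leq_ltn_trans (leq_imset_card _ _) _; rewrite -[n in _ < n]card_ord -cardsT.
    by apply: proper_card; rewrite properT; apply: contraNneq bRt => ->; rewrite inE.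
  rewrite -[n in _ < n]card_ord -cardsT => h.
  have /subsetPn[y _ h'] : ~~ ([set: T] \subset phi @: Rt).
    by apply: contraL h => /subset_leq_card; rewrite -leqNgt.
  by exists y.
have pE : {in Rt, upd phi b y =1 phi} by apply: upd_in.
have pI : {in b |: Rt &, injective (upd phi b y)}.
  move=> u v; rewrite !in_setU1 => /predU1P[->|uR] /predU1P[->|vR] //.
  - by rewrite upd_same pE // => h; move: yR; rewrite h imset_f.
  - by rewrite upd_same pE // => h; move: yR; rewrite -h imset_f.
  - by rewrite !pE //; apply: phi_inj.
have upM i : 0 < i <= 0 + L -> iter i par b \in links by apply: bM.
have upRt i : 0 < i <= 0 + L -> iter i par b \notin Rt by move=> h; apply/mR/upM.
have upR i : i <= 0 + L -> iter i par b \notin R1.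
  by case: i => // i iL; apply/R1R/upRt.
(* A path to a second root that meets the chain passes through the only kid of each link below,
   hence through [b], which is excluded in this case. *)
have upP : {in R2, forall x, x != b -> forall i, i <= 0 + L -> iter i par b \notin pth x}.
  move=> x xR xb; elim=> [|i IH] iL.
    by apply/mem_pth=> -[k /andP[_ kx] /= h]; have := nb x xR k kx; rewrite h eqxx.
  apply/mem_pth=> -[[|k] // /andP[_ kx] h].
  have kE : iter i par b = iter k par x.
    apply: (@links_kid (iter i.+1 par b)) => //; first by apply: upM.
    - by apply: upR; apply: ltnW.
    - by apply: ht_min; apply: ltnW.
  case: k kx kE {h} => [|k] kx kE.
    case: i IH iL kE => [|i] IH iL kE.
      by move: kE xb => /= ->; rewrite eqxx.
    by case/negP: (mR _ (upM i.+1 (ltnW iL))); rewrite kE /=; case/setDP: xR.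
  by case/negP: (IH (ltnW iL)); apply/mem_pth; exists k.+1; rewrite //= ltnW.
exists (#|~: (b |: Rt)| + 2 * #|R2 :\ b| + 2).
  have -> : R2 :\ b = R2.
    by apply/setDidPl; rewrite disjoint_sym disjoints1 in_setD (negbTE bRt) andbF.
  have -> : ~: (b |: Rt) = ~: Rt :\ b.
    by rewrite setCU setIC -setDE.
  by have := cardsD1 b (~: Rt); rewrite in_setC bRt; arith.
exact: (chain_wins upR upRt upM upP pE pI LD lK H).
Qed.

Lemma forest_wins G K :
  D + l + 11 <= K -> 2 * (D + 2) <= K ->
  2 * ((2 * l).+1 * (2 * l + 6) + 2 * l + 1) <= K ->
  D * K + (D + 14) * (6 * K) <= n -> (forall r c, copied r -> G r c) ->
  exists2 m, m <= #|~: R1| + #|R2| + 1 & wf G m set0 set0.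
Proof.
move=> lK dK bK nK H.
have [cL|cL] := leqP K #|leaf_parents|.
  by eexists; [|apply: leaves_win cL _ dK bK H]; move: lK; clear; lia.
have [cP|cP] := leqP K #|pure|.
  by eexists; [|apply: pures_win cP _ H]; move: lK; clear; lia.
have [b bR bM] : exists2 b, b \notin R1 & forall j, 0 < j <= D + 14 -> iter j par b \in links.
  (* By [card_nonpure] there are fewer than [2 * K] second roots, so leaf parents and second roots
     together number fewer than [3 * K]; this gives the factor [6 * K]. *)
  apply: long_chain; first by rewrite addnS.
  apply: leq_trans nK; rewrite -addnS leq_add ?leq_mul2l ?(ltnW cL) ?orbT //.
  rewrite ltn_mul2l addn_gt0 orbT /=; move: card_nonpure cL cP; arith.
exact: bare_wins bR bM erefl lK H.
Qed.

End Forest.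

(** * Orienting the forest towards its roots *)

Section Graph.
Variables (n : nat) (E : rel 'I_n) (Rt : {set 'I_n}).
Notation T := 'I_n.
Implicit Types u v w x y : T.
Hypothesis simpleE : simple_graph E.
Hypothesis forestE : is_forest E.
Hypothesis nontriv : forall C, C \in components E -> nontrivial_comp E C.
Hypothesis rooted : forall C, C \in components E ->
  rooted_comp Rt C || double_rooted_comp Rt C.
Hypothesis far : forall C, C \in components E -> double_rooted_comp Rt C ->
  forall r1 r2, r1 \in C :&: Rt -> r2 \in C :&: Rt -> r1 != r2 -> dist_ge E r1 r2 7.

Let symE : symmetric E. Proof. by case: simpleE. Qed.
Let csym : connect_sym E. Proof. exact: sym_connect_sym symE. Qed.
Let compE v : component E v \in components E. Proof. exact: imset_f. Qed.

(* Depends on the component of [v] only. *)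
Definition top_root v := odflt (root E v) [pick x in Rt | connect E (root E v) x].
Definition main_roots := [set top_root v | v : T].
Notation R1 := main_roots.
Notation R2 := (Rt :\: R1).

Lemma top_rootP v : top_root v \in Rt /\ connect E v (top_root v).
Proof.
have rv : connect E (root E v) v by rewrite csym connect_root.
rewrite /top_root; case: pickP => [x /andP[xR xc]|h] /=.
  by split=> //; apply: connect_trans xc; apply: connect_root.
have : 0 < #|component E v :&: Rt|.
  by have := rooted (compE v); rewrite /rooted_comp /double_rooted_comp => /orP[]/eqP->.
case/card_gt0P=> x /setIP[]; rewrite inE => vx xR.
by have := h x; rewrite xR (connect_trans rv vx).
Qed.

Lemma top_root_connect u v : connect E u v -> top_root u = top_root v.
Proof.
by move=> /(rootP csym) e; rewrite /top_root e.
Qed.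

Lemma main_rootsS : R1 \subset Rt.
Proof. by apply/subsetP=> _ /imsetP[v _ ->]; case: (top_rootP v). Qed.

Lemma top_root_main : {in R1, forall x, top_root x = x}.
Proof.
by move=> _ /imsetP[v _ ->]; rewrite -(top_root_connect (proj2 (top_rootP v))).
Qed.

Lemma dist_ex v : exists k, [exists p : k.-tuple T, path E v p && (last v p \in R1)].
Proof.
have [_ /connectP[p pp pl]] := top_rootP v; exists (size p).
by apply/existsP; exists (in_tuple p); rewrite pp -pl imset_f.
Qed.

(** The distance to the main roots; a neighbour one step closer exists for every other vertex and
    serves as its parent. *)
Definition depth v := ex_minn (dist_ex v).
Definition parent v := odflt v [pick u | E v u && (depth u < depth v)].

Lemma parentP v : v \notin R1 -> E v (parent v) /\ depth (parent v) < depth v.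
Proof.
move=> vR; rewrite /parent; case: pickP => [u /andP[]//|h] /=.
have [u vu du] : exists2 u, E v u & depth u < depth v.
  rewrite {2}/depth; case: ex_minnP => k /existsP[[p /= /eqP sp] /andP[pp pl]] _.
  case: p sp pp pl => [_ _ vR1|u p sp /andP[vu pp] pl]; first by case/negP: vR.
  exists u => //; rewrite /depth; case: ex_minnP => m _ hm; rewrite -sp /= ltnS.
  by apply: hm; apply/existsP; exists (in_tuple p); apply/andP.
by have := h u; rewrite vu du.
Qed.

Lemma top_root_parent v : v \notin R1 -> top_root (parent v) = top_root v.
Proof.
by move=> /parentP[h _]; symmetry; apply: top_root_connect; apply: connect1.
Qed.

Lemma card_roots v : #|component E v :&: Rt| <= 2.
Proof.
by have := rooted (compE v); rewrite /rooted_comp /double_rooted_comp => /orP[]/eqP->.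
Qed.

Lemma top_root_inj : {in R2 &, injective top_root}.
Proof.
move=> x y /setDP[xR x1] /setDP[yR y1] e; apply/eqP; apply: contraT => xy.
have [_ cx] := top_rootP x; have [tR cy] := top_rootP y.
have := card_roots x; rewrite leqNgt => /negP[].
have tx : x != top_root x by apply: contraNneq x1 => ->; apply: imset_f.
have ty : y != top_root x by rewrite e; apply: contraNneq y1 => ->; apply: imset_f.
apply: leq_trans (_ : #|[set x; y; top_root x]| <= _).
  by rewrite setUC cardsU1 !inE negb_or eq_sym tx eq_sym ty cards2 xy.
apply/subset_leq_card/subsetP=> z; rewrite !inE -orbA.
case/or3P=> /eqP->; rewrite ?connect0 ?xR ?yR ?andbT //; last first.
  by rewrite cx e tR.
by apply: connect_trans cx _; rewrite e csym.
Qed.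

Definition tree_edge u v :=
  (u \notin R1) && (parent u == v) || (v \notin R1) && (parent v == u).

Lemma tree_edge_sub u v : tree_edge u v -> E u v.
Proof.
by case/orP=> /andP[/parentP[h _] /eqP <-] //; rewrite symE.
Qed.

Lemma tree_connect v : connect tree_edge v (top_root v).
Proof.
have [m] := ubnP (depth v); elim: m v => // m IH v; rewrite ltnS => dm.
have [/top_root_main->//|vR] := boolP (v \in R1).
have [_ dv] := parentP vR; rewrite -top_root_parent //.
apply: connect_trans (IH _ (leq_trans dv dm)); apply: connect1.
by rewrite /tree_edge vR eqxx.
Qed.

(** The ends of an edge share their [top_root], so parent edges connect them; an edge that is not
    itself a parent edge would close a cycle with that connection. *)
Lemma edge_tree u v : E u v -> tree_edge u v.
Proof.
move=> uv; apply: contraT => ntr.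
have trC : connect_sym tree_edge.
  by apply: sym_connect_sym => a b; rewrite /tree_edge orbC.
have : connect tree_edge u v.
  apply: connect_trans (tree_connect u) _; rewrite trC.
  by rewrite (top_root_connect (connect1 uv)) tree_connect.
case/connectP=> p0 pp0 vE; move: vE; case/shortenP: pp0 => p pp up _ vE.
case: forestE; exists (u :: p); split.
  case: p pp up vE => [_ _ vE|a [|b p]] //.
    by move: uv; rewrite vE (proj2 simpleE).
  by rewrite /= andbT => h _ vE; move: ntr; rewrite vE h.
rewrite /ucycle up andbT /= rcons_path -vE symE uv andbT.
exact: sub_path tree_edge_sub _ _ pp.
Qed.

Lemma main_kid : {in R1, forall x, exists2 v, v \notin R1 & parent v = x}.
Proof.
move=> x xR; have [a [b [ax [_ ab]]]] := nontriv (compE x).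
have [u xu] : exists u, E x u.
  move: ax; rewrite inE => /connectP[[|u p] /= + aE]; first by rewrite -aE; exists b.
  by case/andP=> xu _; exists u.
move: (edge_tree xu); rewrite /tree_edge xR /= => /andP[uR /eqP uE].
by exists u.
Qed.

(** Up to the first main root met, the ancestors of [x] form a walk in [E] joining two distinct
    roots of one component, to which the distance hypothesis applies. *)
Lemma main_far : {in R2, forall x i, i < 7 -> iter i parent x \notin R1}.
Proof.
move=> x /setDP[xR x1] i; elim/ltn_ind: i => i IH i7; apply/negP=> iR.
have pi : path E x (traject parent (parent x) i).
  have : forall j, j < i -> iter j parent x \notin R1.
    by move=> j ji; apply: IH => //; apply: ltn_trans ji i7.
  elim: i x {IH i7 iR xR x1} => //= i IH x h.
  rewrite (proj1 (parentP (h 0 isT))) IH // => j ji.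
  by rewrite -iterSr; apply: h.
have lE : last x (traject parent (parent x) i) = iter i parent x by rewrite last_traject.
have cx : connect E x (iter i parent x) by apply/connectP; exists (traject parent (parent x) i).
set y := iter i parent x in iR lE cx.
have xy : x != y by apply: contraNneq x1 => ->.
have yR : y \in Rt by apply: (subsetP main_rootsS).
have yC : y \in component E x :&: Rt by rewrite !inE cx.
have xC : x \in component E x :&: Rt by rewrite !inE connect0.
have d2 : double_rooted_comp Rt (component E x).
  have := rooted (compE x); rewrite /rooted_comp => /orP[/cards1P[z zE]|//].
  by move: xC yC xy; rewrite zE => /set1P-> /set1P->; rewrite eqxx.
have := far (compE x) d2 xC yC xy pi lE.
by rewrite size_traject leqNgt i7.
Qed.

Lemma card_double : #|R2| <= n_double_rooted E Rt.
Proof.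
have inj : {in R2 &, injective (component E)}.
  move=> x y xR yR e; apply: top_root_inj => //; apply: top_root_connect.
  have : y \in component E y by rewrite inE.
  by rewrite -e inE.
rewrite -(card_in_imset inj); apply/subset_leq_card/subsetP=> _ /imsetP[x xR ->].
rewrite inE compE; have := rooted (compE x); rewrite /rooted_comp => /orP[/cards1P[z zE]|//].
have [xRt x1] := setDP xR; have [tR tx] := top_rootP x.
have : x \in component E x :&: Rt by rewrite !inE connect0.
have : top_root x \in component E x :&: Rt by rewrite !inE tx.
rewrite zE => /set1P zt /set1P zx; case/negP: x1.
by rewrite zx -zt imset_f.
Qed.

Lemma card_nonmain : #|~: R1| <= n_edges E.
Proof.
have inj : {in ~: R1 &, injective (fun v => ed v (parent v))}.
  move=> v w; rewrite !in_setC => /parentP[_ dv] /parentP[_ dw] e.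
  have : v \in ed w (parent w) by rewrite -e edl.
  have : w \in ed v (parent v) by rewrite e edl.
  rewrite !in_ed => /predU1P[//|/eqP wE] /predU1P[//|/eqP vE].
  by rewrite -wE in dv; rewrite -vE in dw; have := ltn_trans dv dw; rewrite ltnn.
rewrite -(card_in_imset inj); apply/subset_leq_card/subsetP=> _ /imsetP[v + ->].
rewrite in_setC => /parentP[h _]; rewrite inE; apply/existsP; exists v.
by apply/existsP; exists (parent v); rewrite h /=.
Qed.

Lemma graph_wins (phi : T -> T) l D K :
  {in Rt &, injective phi} -> (forall v, degree E v <= D) -> n < 2 ^ l.+1 ->
  D + l + 11 <= K -> 2 * (D + 2) <= K ->
  2 * ((2 * l).+1 * (2 * l + 6) + 2 * l + 1) <= K ->
  D * K + (D + 14) * (6 * K) <= n ->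
  waiter_forces (red_rooted_copy E Rt phi) (n_edges E + n_double_rooted E Rt + 1)
    set0 set0.
Proof.
move=> phi_inj degD nl lK dK bK nK.
have kidsD u : #|[set v | (v \notin R1) && (parent v == u)]| <= D.
  apply: leq_trans (degD u); apply/subset_leq_card/subsetP=> v.
  rewrite inE => /andP[/parentP[h _] /eqP <-]; by rewrite inE symE.
have [//|m mN] := forest_wins main_rootsS (fun v h => proj2 (parentP h)) top_root_parent
  top_root_main top_root_inj main_far main_kid kidsD nl phi_inj lK dK bK nK
  (G := fun r _ => red_rooted_copy E Rt phi r).
  move=> r _ [f [fI fE fR]]; exists f; split=> //; split=> // u v /edge_tree.
  case/orP=> /andP[/fE h /eqP <-] //; by rewrite setUC.
move=> w; apply: (@forces_mono _ _ m).
  by apply: leq_trans mN _; rewrite leq_add2r leq_add ?card_nonmain ?card_double.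
by apply: wf_forces; rewrite setU0.
Qed.

End Graph.

(** * The choice of constants *)

Lemma polylog_small : exists N, forall n, N <= n ->
  22 * (8 * (trunc_log 2 n).+1 * (trunc_log 2 n + 3)) ^ 2 <= n.
Proof.
(* With [k] the quotient of [l + 3] by 8, the left side is at most [2 ^ (4 * k + 23)], and
   [4 * k + 23 <= l] holds as soon as [l] is at least 49. *)
exists (2 ^ 49) => n nN; have n0 : 0 < n by apply: leq_trans nN; rewrite expn_gt0.
have : 49 <= trunc_log 2 n by apply: trunc_log_max.
have := trunc_logP (isT : 1 < 2) n0; move: (trunc_log 2 n) => l ln l49.
apply: leq_trans ln; clear n nN n0.
have [k [hk1 hk2]] : exists k, l + 3 <= 8 * k.+1 /\ 4 * k + 23 <= l.
  by exists ((l + 3) %/ 8); lia.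
have k2 : l + 3 <= 2 ^ (3 + k).
  by apply: leq_trans hk1 _; rewrite expnD leq_mul2l /= ltn_expl.
apply: (@leq_trans (2 ^ (4 * k + 23))); last by rewrite leq_pexp2l.
apply: (@leq_trans (2 ^ 5 * (2 ^ 3 * 2 ^ (3 + k) * 2 ^ (3 + k)) ^ 2)).
  apply: leq_mul => //; rewrite leq_exp2r // leq_mul // leq_mul //.
  by apply: leq_trans k2; rewrite addnS ltnS leq_addr.
by rewrite -!expnD -expnM -expnD leq_pexp2l //; clear; lia.
Qed.

Lemma square_degree n d : Rle (INR d) (Rmult (/ 7) (sqrt (INR n))) -> 49 * d ^ 2 <= n.
Proof.
move=> h; apply/leP/INR_le; rewrite mult_INR.
have d0 : Rle 0 (INR d) by apply: pos_INR.
have n0 : Rle 0 (INR n) by apply: pos_INR.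
have s0 := sqrt_pos (INR n); have s2 := sqrt_sqrt _ n0.
have -> : INR (d ^ 2) = Rmult (INR d) (INR d) by rewrite -mulnn mult_INR.
rewrite -s2; have -> : INR 49 = IZR 49 by rewrite INR_IZR_INZ.
move: (sqrt _) (INR d) h d0 s0 => s e h e0 s0; clear -h e0 s0.
have h' : Rle (Rmult 7 e) s by lra.
nra.
Qed.

Theorem theorem3p24 :
  exists alpha : R, Rlt 0 alpha /\
  exists n_alpha : nat, forall n : nat, n_alpha <= n ->
  forall (E : rel 'I_n) (Rt : {set 'I_n}),
    simple_graph E ->
    is_forest E ->
    (forall v : 'I_n, Rle (INR (degree E v)) (Rmult alpha (sqrt (INR n)))) ->
    (forall C, C \in components E -> nontrivial_comp E C) ->
    (forall C, C \in components E -> rooted_comp Rt C || double_rooted_comp Rt C) ->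
    (forall C, C \in components E -> double_rooted_comp Rt C ->
       forall r1 r2, r1 \in C :&: Rt -> r2 \in C :&: Rt -> r1 != r2 ->
       dist_ge E r1 r2 7) ->
    forall d : nat, d = n_double_rooted E Rt ->
    forall phi : 'I_n -> 'I_n, {in Rt &, injective phi} ->
      waiter_forces (red_rooted_copy E Rt phi) (n_edges E + d + 1) set0 set0.
Proof.
have [N HN] := polylog_small.
exists (Rinv 7); split; first by lra.
exists N => n nN E Rt simpleE forestE degE nontriv rooted far d -> phi phi_inj.
(* [g] bounds the reserve [2 * ((2 * l).+1 * (2 * l + 6) + 2 * l + 1)] of the leaf endgame. The
   threshold [K] is [2 * D + g], the first term coming from [2 * (D + 2) <= K]. *)
set l := trunc_log 2 n; pose g := 8 * l.+1 * (l + 3).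
pose D := \max_v degree E v.
have gn : 22 * g ^ 2 <= n by apply: HN.
have g24 : 24 <= g by rewrite /g; move: (l) => k; clear; nia.
have Dn : 49 * D ^ 2 <= n.
  rewrite /D; elim/big_ind: _ => // [x y hx hy|v _]; last exact: square_degree.
  by rewrite /maxn; case: ifP.
apply: (@graph_wins n E Rt simpleE forestE nontriv rooted far phi l D (2 * D + g)) => //.
- by move=> v; apply: leq_bigmax.
- exact: trunc_log_ltn.
- by rewrite /g; move: (l) => k; clear; nia.
- by move: g24; clear; lia.
- by rewrite /g; move: (l) => k; clear; nia.
(* The left side is [14 D^2 + 7 D g + 168 D + 84 g]. By [24 <= g] it is at most
   [14 D^2 + 14 D g + 7 g^2 / 2], which lies below a convex combination of [49 D^2] and [22 g^2]. *)
move: gn g24 Dn; clear; move: D g => D g; nia.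
Qed.
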